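(* Let $a>0$, $b\in\mathbb{R}$ and $u>0$, where in the case $b<0$ it is required that $u<-a/b$ (there is no constraint on $u$ if $b\ge 0$). Then $$\mathbf{P}^{BES}_0\left(H_{a,b}>u\right)=2\sum_{k=-\infty}^\infty e^{-2k^2ab}\left[\left(1-4k^2ab\right)\left(\Phi\left(\frac{a+bu-2ka}{\sqrt{u}}\right)-\Phi\left(-\frac{2ka}{\sqrt{u}}\right)\right)+\frac{2kbu-a-bu}{\sqrt{u}}\,\varphi\left(\frac{a+bu-2ka}{\sqrt{u}}\right)\right].$$
   Context: $\mathbf{P}^{BES}_0$ is the law, on the space of continuous functions $\omega:[0,\infty)\to\mathbb{R}$ with coordinate process $\omega_t=\omega(t)$, of the three-dimensional Bessel process started at $0$ (the law of the Euclidean norm of a standard three-dimensional Brownian motion started at the origin). $H_{a,b}:=\inf\{t:\ \omega_t=a+bt\}$ (with $\inf\emptyset=+\infty$). $\varphi(x)=\frac{1}{\sqrt{2\pi}}e^{-x^2/2}$ is the standard normal density and $\Phi(x)=\int_{-\infty}^x\varphi(y)\,dy$ the standard normal distribution function. *)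

(* Defs.v *)
From HB Require Import structures.
From mathcomp Require Import all_boot all_order all_algebra.
From mathcomp Require Import all_classical all_reals all_analysis.

Set Implicit Arguments.
Unset Strict Implicit.
Unset Printing Implicit Defensive.

Import Order.TTheory GRing.Theory Num.Theory.
Import numFieldNormedType.Exports.

Local Open Scope classical_set_scope.
Local Open Scope ring_scope.

(* The time axis [0, +oo[ with the subset topology inherited from R. *)
Notation halfline R := (set_type (`[0%R, +oo[%classic : set R)).

(* The space of continuous functions [0, +oo[ -> R with the sigma-algebra
   generated by the coordinate maps w |-> w t. *)
Definition cpath (R : realType) : Type := continuousType (halfline R) R.

HB.instance Definition _ (R : realType) := Choice.on (cpath R).
HB.instance Definition _ (R : realType) :=
  isPointed.Build (cpath R) (mkcts (@cst_continuous (halfline R) R 0)).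

Definition path_at (R : realType) (t : halfline R) (w : cpath R) : R :=
  (w : continuousType (halfline R) R) t.

Definition cylinders (R : realType) : set (set (cpath R)) :=
  [set C | exists (t : halfline R) (A : set R),
     measurable A /\ C = path_at t @^-1` A].

Definition path_space (R : realType) := g_sigma_algebraType (@cylinders R).

Definition mutually_independent (d : measure_display) (Omega : measurableType d)
    (R : realType) (P : probability Omega R) (I : finType)
    (X : I -> Omega -> R) : Prop :=
  forall A : I -> set R, (forall i, measurable (A i)) ->
    P [set w | forall i, A i (X i w)] = (\prod_(i : I) P (X i @^-1` A i))%E.

(* B i t is the i-th coordinate at time t of a standard n-dimensional Brownian
   motion started at the origin.  Joint independence over the pairs (i, j)
   expresses at once that the vector increments over successive time intervals
   are independent and that each has independent coordinates, so that
   B t - B s has law N(0, (t - s) I_n).  The second argument of [normal_prob]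
   is the standard deviation. *)
Definition standard_brownian_motion (d : measure_display)
    (Omega : measurableType d) (R : realType) (P : probability Omega R)
    (n : nat) (B : 'I_n -> halfline R -> Omega -> R) : Prop :=
  [/\ forall i t, measurable_fun [set: Omega] (B i t),
      forall i (t : halfline R) w, \val t = 0 -> B i t w = 0,
      forall i w, continuous (fun t => B i t w),
      forall i (s t : halfline R), \val s < \val t ->
        forall A : set R, measurable A ->
          P ((fun w => B i t w - B i s w) @^-1` A) =
          normal_prob 0 (Num.sqrt (\val t - \val s)) A
    & forall (m : nat) (t : nat -> halfline R),
        (forall j, \val (t j) <= \val (t j.+1)) ->
        mutually_independent P
          (fun (ij : 'I_n * 'I_m) w =>
             B ij.1 (t ij.2.+1) w - B ij.1 (t ij.2) w)].

(* Q is the law of the three-dimensional Bessel process started at 0.  That a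
   given Q is such a law does not depend on the Brownian motion realising it. *)
Definition is_bessel3_law (R : realType)
    (Q : probability (path_space R) R) : Prop :=
  exists (d : measure_display) (Omega : measurableType d)
         (P : probability Omega R) (B : 'I_3 -> halfline R -> Omega -> R)
         (X : {mfun Omega >-> path_space R}),
    [/\ standard_brownian_motion P B,
        forall t w, path_at t (X w) = Num.sqrt (\sum_(i < 3) B i t w ^+ 2)
      & forall A : set (path_space R), measurable A -> Q A = distribution P X A].

Definition hitting_time (R : realType) (a b : R) (w : path_space R) : \bar R :=
  ereal_inf [set (\val t)%:E | t in
               [set t : halfline R | path_at t w = a + b * \val t]].

Definition phi (R : realType) (x : R) : R :=
  (Num.sqrt (2 * pi))^-1 * expR (- (x ^+ 2 / 2)).

Definition Phi (R : realType) (x : R) : R :=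
  \int[@lebesgue_measure R]_(y in `]-oo, x]) phi y.

Lemma phiE (R : realType) (x : R) : phi x = normal_pdf 0 1 x.
Proof.
rewrite /normal_pdf ifN ?oner_neq0// /normal_peak /normal_fun /phi.
by rewrite expr1n mul1r subr0 mulr_natl mulNr.
Qed.

(* Convergence and value of sum_{k in Z} f k: the series over k >= 0 and over
   k < 0 are required to converge separately. *)
Definition is_cvg_bisum (R : realType) (f : int -> R) : Prop :=
  cvgn (series (fun n : nat => f n%:Z)) /\
  cvgn (series (fun n : nat => f (- n.+1%:Z))).

Definition bisum (R : realType) (f : int -> R) : R :=
  limn (series (fun n : nat => f n%:Z)) +
  limn (series (fun n : nat => f (- n.+1%:Z))).

(* Main.v *)
(* Put c = a + b u and let G be the odd function that equals z on ]-c, c[ and is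
   continued by images in such a way that its mean w(s, r) under the normal law
   N(r, s) vanishes at r = c - b s.  Set F(r) = G(r) / r, which is 1 on [0, c[.
   The transition density of the Bessel process is
   q / (2 r) * (N(r, s)(q) - N(-r, s)(q)), so the conditional mean of F at time u
   given the value r at time t is w(u - t, r) / r, which vanishes on the line
   r = a + b t.  Optional stopping on dyadic grids then shows that all the dyadic
   values up to u lie below the line with probability
   I(a) = \int G(q) q / u N(0, u)(q) dq.  The event that the path does not touch
   the line is the limit of these events for lower lines a_n, a_n --> a, and I
   is continuous in a.  On the j-th cell |q - 2 j c| < c the integrand of I has a
   primitive in terms of Phi and phi, and each half cell on the positive axis
   yields one term of the series, up to a boundary term at the centre of the
   cell that cancels between the two halves.

   The transition law is identified by the Laplace transform of the squared
   norm of the Brownian motion, in which the three coordinates of the last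
   increment are integrated out one at a time. *)
Require Import Defs.
From HB Require Import structures.
From mathcomp Require Import all_boot all_order all_algebra.
From mathcomp Require Import all_classical all_reals all_analysis.
From mathcomp Require Import measurable_realfun ring lra zify.

Set Implicit Arguments.
Unset Strict Implicit.
Unset Printing Implicit Defensive.

Import Order.TTheory GRing.Theory Num.Theory.
Import numFieldNormedType.Exports.

Local Open Scope classical_set_scope.
Local Open Scope ring_scope.

(** Two exponential rates compete throughout. The image function grows at most like exp(max(b,0)
    z^2/(2c)), while a Gaussian weight of variance s <= u decays at least like exp(-z^2/(2u)) up to
    linear terms. From a > 0 and a + b u > 0 one gets max(b,0) u < c, so the decay wins, uniformly
    in s <= u and also along the lower lines. The obstacle to stopping on a grid is overshoot: at a
    grid time the path has already passed the line, so w is not 0 there, and w is not controlled as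
    the remaining time tends to 0. Exits are therefore sorted by a tolerance e. Those before u with
    |w| <= e r contribute at most e in all, being disjoint. The others have no quantitative bound,
    but along a fixed path they disappear on fine grids, unless the crossing times tend to u, where
    F(c) = 0 removes their contribution; dominated convergence then applies. A dense grid cannot
    tell touching the line from staying below it, which is why the lower lines are needed. Functions
    of the squared norm are tested on exponentials because these factor over the coordinates;
    independence enters only as a product formula for integrals. *)

Section finite_measure_integral.
Context {d} {T : measurableType d} {R : realType}.
Variable m : {measure set T -> \bar R}.
Hypothesis mfin : (m [set: T] < +oo)%E.

Lemma bounded_integrable (f : T -> R) (M : R) :
  measurable_fun [set: T] f -> (forall x, `|f x| <= M) ->
  m.-integrable [set: T] (EFin \o f).
Proof.
move=> mf fM; apply: measurable_bounded_integrable => //.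
exists M; split; first exact: num_real.
by move=> y My x _ /=; rewrite (le_trans (fM x))// ltW.
Qed.

Lemma bounded_cvg_integral (f_ : nat -> T -> R) (f : T -> R) (M : R) :
  (forall n, measurable_fun [set: T] (f_ n)) ->
  (forall n x, `|f_ n x| <= M) ->
  (forall x, f_ n x @[n --> \oo] --> f x) ->
  (\int[m]_x (f_ n x)%:E)%E @[n --> \oo] --> (\int[m]_x (f x)%:E)%E.
Proof.
move=> mf fM ff.
have intM : m.-integrable [set: T] (EFin \o cst M).
  by apply: (@bounded_integrable _ `|M|) => // x; exact: lexx.
apply: (@dominated_cvg _ _ _ m setT measurableT (fun n x => (f_ n x)%:E) _
  (EFin \o cst M)) => //.
- by move=> n; exact/measurable_EFinP.
- by move=> x _; apply: cvg_EFin; [exact: nearW|exact: ff].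
- by move=> n x _ /=; rewrite lee_fin.
Qed.

End finite_measure_integral.

(** * Injectivity of the Laplace transform on finite measures of the half-line *)

Section laplace_transform.
Context {R : realType}.

Lemma le_nat_expR (c : R) (n : nat) : 0 < c -> n%:R <= c^-1 * expR (c * n%:R).
Proof.
move=> c0; rewrite ler_pdivlMl// (le_trans _ (expR_ge1Dx _))// lerDr//.
Qed.

(** Half of the exponent absorbs the factor [n]; the other half leaves a summable geometric
    sequence. *)
Lemma nat_expR_le (c : R) (n : nat) : 0 < c ->
  n%:R * expR (- (c * n%:R)) <= 2 / c * expR (- (c / 2)) ^+ n.
Proof.
move=> c0; have c20 : 0 < c / 2 by rewrite divr_gt0.
have /(ler_wpM2r (expR_ge0 (- (c * n%:R)))) := le_nat_expR n c20.
move/le_trans; apply; rewrite -[leLHS]mulrA -expRD -expRM_natr.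
have -> : (c / 2)^-1 = 2 / c by field; rewrite gt_eqF.
rewrite ler_pM2l ?divr_gt0// ler_expR.
by have -> : c / 2 * n%:R - c * n%:R = - (c / 2) * n%:R by field.
Qed.

Lemma expR_geometric_lt1 (c : R) : 0 < c -> `|expR (- c)| < 1.
Proof. by move=> c0; rewrite ger0_norm ?expR_ge0// expR_lt1 oppr_lt0. Qed.

Lemma cvg_nat_expR (c : R) : 0 < c ->
  (n%:R * expR (- (c * n%:R)) : R) @[n --> \oo] --> (0:R).
Proof.
move=> c0; have c20 : 0 < c / 2 by rewrite divr_gt0.
apply: (@squeeze_cvgr _ _ _ _ (cst 0) (geometric (2 / c) (expR (- (c / 2))))).
- near=> n; rewrite /= nat_expR_le// andbT mulr_ge0// expR_ge0.
- exact: cvg_cst.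
- by apply: cvg_geometric; exact: expR_geometric_lt1.
Unshelve. all: end_near. Qed.

Lemma cvg_expR_nat (c : R) : 0 < c ->
  (expR (- (c * n%:R)) : R) @[n --> \oo] --> (0:R).
Proof.
move=> c0; under eq_fun do rewrite -mulNr expRM_natr.
by apply: cvg_expr; exact: expR_geometric_lt1.
Qed.

Lemma bernoulli_ineq (x : R) (n : nat) : 0 <= x <= 1 ->
  1 - n%:R * x <= (1 - x) ^+ n.
Proof.
move=> /andP[x0 x1]; elim: n => [|n IH]; first by rewrite expr0 mul0r subr0.
rewrite exprS; have [n1|n1] := leP (n%:R * x) 1.
  apply: le_trans (ler_wpM2l _ IH); last by rewrite subr_ge0.
  rewrite -natr1; have : 0 <= n%:R * x * x by rewrite !mulr_ge0.
  lra.
rewrite (@le_trans _ _ 0)//; last by rewrite mulr_ge0 ?exprn_ge0 ?subr_ge0.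
by rewrite -natr1; lra.
Qed.

(* With q = exp(-l n), the exponent K = n/q separates x <= 1 from x > 1. *)
Definition separating_exponent (n : nat) : nat := (n * 2 ^ n)%N.

(** For [x > 1] Bernoulli's inequality bounds the power below by [1 - n exp(- n ln 2 (x - 1))]. For
    [x <= 1] the exponential is at least [2^-n], and [1 - y <= expR (- y)] bounds the power above by
    [exp(-n)]. The rate [ln 2] makes the exponent [n 2^n] an integer. *)
Lemma cvg_separating (x : R) : 0 <= x ->
  ((1 - expR (- (n%:R * ln 2 * x))) ^+ separating_exponent n : R)
    @[n --> \oo] --> (\1_[set y | 1 < y] x : R).
Proof.
move=> x0; have l0 : 0 < ln (2:R) by rewrite ln_gt0// ltr1n.
have pow2 (n : nat) : expR (n%:R * ln (2:R)) = 2 ^+ n.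
  by rewrite mulrC expRM_natr lnK// posrE.
have e01 (n : nat) : 0 <= expR (- (n%:R * ln (2:R) * x)) <= 1.
  by rewrite expR_ge0 -[leRHS]expR0 ler_expR oppr_le0 !mulr_ge0// ltW.
rewrite indicE; have [x1|x1] := ltP 1 x.
  rewrite mem_set//=.
  pose c := ln (2:R) * (x - 1); have c0 : 0 < c by rewrite mulr_gt0// subr_gt0.
  apply: (@squeeze_cvgr _ _ _ _
    (fun n => 1 - n%:R * expR (- (c * n%:R))) (cst 1)).
  - near=> n; apply/andP; split; last first.
      by rewrite exprn_ile1// ?subr_ge0; have /andP[] := e01 n => // ? ?; lra.
    apply: le_trans (bernoulli_ineq _ (e01 n)).
    rewrite lerB// /separating_exponent natrM natrX -pow2 -mulrA -expRD.
    by rewrite ler_wpM2l// ler_expR /c; lra.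
  - rewrite -[X in _ --> X]subr0; apply: cvgB; first exact: cvg_cst.
    exact: cvg_nat_expR.
  - exact: cvg_cst.
rewrite memNset/=; last by rewrite /= ltNge x1.
apply: (@squeeze_cvgr _ _ _ _ (cst 0) (fun n => expR (- (1 * n%:R)))).
- near=> n; rewrite /= exprn_ge0 ?subr_ge0; last by have /andP[] := e01 n.
  have step : 1 - expR (- (n%:R * ln (2:R) * x)) <= expR (- (2 ^+ n)^-1).
    rewrite (le_trans _ (expR_ge1Dx _))// lerD2l lerN2 -pow2 -expRN ler_expR.
    by rewrite lerN2 ler_piMr// mulr_ge0// ltW.
  rewrite (le_trans (lerXn2r (separating_exponent n) _ _ step))//.
  + by rewrite nnegrE subr_ge0; have /andP[] := e01 n.
  + by rewrite nnegrE expR_ge0.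
  rewrite -expRM_natr ler_expR /separating_exponent natrM natrX.
  by rewrite mulNr mulrCA mulVf ?expf_neq0// mulr1 mul1r.
- exact: cvg_cst.
- exact: cvg_expR_nat.
Unshelve. all: end_near. Qed.

Variables m1 m2 : {measure set (measurableTypeR R) -> \bar R}.
Hypothesis m1fin : (m1 [set: R] < +oo)%E.
Hypothesis m1_supp : m1 `]-oo, 0[%classic = 0%E.
Hypothesis m2_supp : m2 `]-oo, 0[%classic = 0%E.
Hypothesis eq_laplace : forall l : R, 0 <= l ->
  (\int[m1]_x (expR (- (l * `|x|)))%:E = \int[m2]_x (expR (- (l * `|x|)))%:E)%E.

Let eq_mass : m1 [set: R] = m2 [set: R].
Proof.
have := eq_laplace (lexx 0).
under eq_integral do rewrite mul0r oppr0 expR0.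
under [RHS]eq_integral do rewrite mul0r oppr0 expR0.
by rewrite !integral_cst// !mul1e.
Qed.

Let m2fin : (m2 [set: R] < +oo)%E.
Proof. by rewrite -eq_mass. Qed.

Let measurable_pow (l : R) (j k : nat) : measurable_fun [set: R]
  (fun x => expR (- (l * `|x|)) ^+ j * (1 - expR (- (l * `|x|))) ^+ k).
Proof.
have me : measurable_fun [set: R] (fun x => expR (- (l * `|x|))).
  apply: measurableT_comp => //; apply: measurable_funN.
  by apply: measurable_funM => //; exact: normr_measurable.
apply: measurable_funM; apply: measurable_funX => //.
exact: measurable_funB.
Qed.

Let pow_le1 (l : R) (j k : nat) (x : R) : 0 <= l ->
  `|expR (- (l * `|x|)) ^+ j * (1 - expR (- (l * `|x|))) ^+ k| <= 1.
Proof.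
move=> l0; have e1 : expR (- (l * `|x|)) <= 1.
  by rewrite -[leRHS]expR0 ler_expR oppr_le0 mulr_ge0.
have e0 := expR_ge0 (- (l * `|x|)).
have d0 : 0 <= 1 - expR (- (l * `|x|)) by rewrite subr_ge0.
have d1 : 1 - expR (- (l * `|x|)) <= 1 by rewrite gerBl.
rewrite normrM !normrX (ger0_norm e0) (ger0_norm d0).
by apply: mulr_ile1; [exact: exprn_ge0|exact: exprn_ge0|exact: exprn_ile1|
  exact: exprn_ile1].
Qed.

(** One factor [1 - e] splits the integrand into a difference of two with one factor fewer, and the
    case [k = 0] is the Laplace transform at [j l]. The two measures thus agree on these polynomials
    in [exp(- l |x|)]. *)
Let integral_pow (l : R) (j k : nat) : 0 <= l ->
  (\int[m1]_x (expR (- (l * `|x|)) ^+ j * (1 - expR (- (l * `|x|))) ^+ k)%:E =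
   \int[m2]_x (expR (- (l * `|x|)) ^+ j * (1 - expR (- (l * `|x|))) ^+ k)%:E)%E.
Proof.
move=> l0; elim: k j => [|k IH] j.
  have := eq_laplace (mulr_ge0 (ler0n R j) l0).
  have e (x : R) : expR (- (j%:R * l * `|x|)) =
      expR (- (l * `|x|)) ^+ j * (1 - expR (- (l * `|x|))) ^+ 0.
    by rewrite expr0 mulr1 -expRM_natr mulNr; congr (expR (- _)); ring.
  by under eq_integral do rewrite e; under [X in _ = X -> _]eq_integral do rewrite e.
pose f j := fun x : R => expR (- (l * `|x|)) ^+ j * (1 - expR (- (l * `|x|))) ^+ k.
have e (x : R) : (expR (- (l * `|x|)) ^+ j * (1 - expR (- (l * `|x|))) ^+ k.+1)%:E =
    ((f j x)%:E - (f j.+1 x)%:E)%E.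
  by rewrite /f -EFinB !exprS; congr (_%:E); ring.
under eq_integral do rewrite e; under [RHS]eq_integral do rewrite e.
have fint i (m : {measure set (measurableTypeR R) -> \bar R}) :
    (m [set: R] < +oo)%E -> m.-integrable [set: R] (EFin \o f i).
  move=> mf; apply: (bounded_integrable mf (M := 1)) => [|x].
    exact: measurable_pow.
  exact: pow_le1.
rewrite (integralB_EFin _ (fint j m1 _) (fint j.+1 m1 _))//.
rewrite (integralB_EFin _ (fint j m2 _) (fint j.+1 m2 _))//.
by congr (_ - _)%E; exact: IH.
Qed.

(** The indicator of [r < |x|] is a pointwise limit of functions bounded by 1 whose integrals agree
    by [integral_pow]. *)
Let eq_norm_gt (r : R) : 0 <= r ->
  m1 [set x : R | r < `|x|] = m2 [set x : R | r < `|x|].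
Proof.
move=> r0.
have [l [K [l0 hK]]] : exists (l : nat -> R) (K : nat -> nat),
    (forall n, 0 <= l n) /\ forall x : R,
    ((1 - expR (- (l n * `|x|))) ^+ K n : R) @[n --> \oo] -->
      (\1_[set x : R | r < `|x|] x : R).
  move: r0; rewrite le_eqVlt => /predU1P[<-|r0].
    (* Rescaling by [r] is impossible here; the functions [1 - exp(- n |x|)] already tend to the
       indicator of [x != 0]. *)
    exists (fun n => n%:R), (fun=> 1%N); split => // x.
    under eq_fun do rewrite expr1 mulrC.
    rewrite indicE; have [->|x0] := eqVneq x 0.
      rewrite memNset/= ?normr0 ?ltxx//.
      by under eq_fun do rewrite mul0r oppr0 expR0 subrr; exact: cvg_cst.
    rewrite mem_set; last by rewrite /= normr_gt0.
    suff : ((1 - expR (- (`|x| * n%:R))) : R) @[n --> \oo] --> (1 - 0 : R).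
      by rewrite subr0.
    by apply: cvgB; [exact: cvg_cst|apply: cvg_expR_nat; rewrite normr_gt0].
  exists (fun n => n%:R * ln 2 / r), separating_exponent; split => [n|x].
    by rewrite divr_ge0 ?mulr_ge0 ?ln_ge0 ?ler1n// ltW.
  have := @cvg_separating (`|x| / r); rewrite divr_ge0// ?ltW// => /(_ isT).
  rewrite !indicE; have -> : (`|x| / r \in [set y : R | 1 < y]) =
      (x \in [set x | r < `|x|]).
    by apply/idP/idP; rewrite !inE/= ltr_pdivlMr// mul1r.
  by under eq_fun do rewrite mulrA mulrAC.
have mS : measurable [set x : R | r < `|x|].
  have -> : [set x : R | r < `|x|] = (@Num.norm R R) @^-1` `]r, +oo[%classic.
    by apply/seteqP; split => x; rewrite /= in_itv/= andbT.
  rewrite -[X in measurable X]setTI; exact: normr_measurable.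
have cv (m : {measure set (measurableTypeR R) -> \bar R}) :
    (m [set: R] < +oo)%E ->
    (\int[m]_x (expR (- (l n * `|x|)) ^+ 0 *
      (1 - expR (- (l n * `|x|))) ^+ K n)%:E)%E @[n --> \oo] -->
    m [set x : R | r < `|x|].
  move=> mf; rewrite -[X in m X]setIT -integral_indic//.
  apply: (bounded_cvg_integral mf (M := 1)).
  - by move=> n; exact: measurable_pow.
  - by move=> n x; exact: pow_le1.
  - by move=> x; under eq_fun do rewrite expr0 mul1r; exact: hK.
have c2 := cv m2 m2fin.
have := cv m1 m1fin; under eq_fun do rewrite integral_pow//.
by move=> c1; apply: cvg_unique c1 c2.
Qed.

(** The open right half-lines form a generating pi-system. Since the negative half-line is null for
    both measures, it may be added to such a half-line, which turns it into a set described by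
    [|x|]. *)
Lemma laplace_transform_inj (A : set (measurableTypeR R)) : measurable A -> m1 A = m2 A.
Proof.
have mN : measurable (`]-oo, 0[%classic : set (measurableTypeR R)) by [].
have key (r : R) (m : {measure set (measurableTypeR R) -> \bar R}) :
    m `]-oo, 0[%classic = 0%E ->
    m `]r, +oo[%classic = m [set x : R | Num.max r 0 < `|x| \/ r < 0].
  move=> m0; have mr : measurable (`]r, +oo[%classic : set (measurableTypeR R)).
    exact: measurable_itv.
  rewrite -(measureU0 mr mN m0); have [r0|r0] := ltP r 0.
    congr (m _); apply/seteqP; split => x /=; first by move=> _; right.
    by rewrite !in_itv/= andbT; have [x0|x0] := ltP x 0; [right|left;
      rewrite (lt_le_trans r0)].
  rewrite -[RHS](measureU0 _ mN m0)//.
    congr (m _); apply/seteqP; split => x /=; rewrite !in_itv/= andbT.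
      move=> [rx|x0]; last by right.
      by left; left; rewrite ger0_norm// ltW// (le_lt_trans r0).
    move=> [[rx|//]|x0]; last by right.
    by have [x0|x0] := ltP x 0; [right|left; rewrite ger0_norm in rx].
  rewrite (_ : mkset _ = (@Num.norm R R) @^-1` `]r, +oo[%classic); last first.
    apply/seteqP; split => x; rewrite /= in_itv/= andbT; last by left.
    by case.
  rewrite -[X in measurable X]setTI; exact: normr_measurable.
apply: (@measure_unique _ _ (measurableTypeR R) (@RGenOInfty.G R)
  (fun n => `](- n%:R)%R, +oo[%classic)).
- exact: RGenOInfty.measurableE.
- move=> _ _ [x ->] [y ->]; exists (Num.max x y).
  apply/seteqP; split => z; rewrite /= !in_itv/= !andbT gt_max.
    by move=> [-> ->].
  by move=> /andP.
- by move=> n; exists (- n%:R).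
- apply/seteqP; split => // x _; exists (Num.Def.archi_bound `|x|) => //=.
  rewrite in_itv/= andbT ltrNl (le_lt_trans (ler_norm _))// normrN.
  exact: archi_boundP.
- move=> _ [r ->]; rewrite !key//; have [r0|r0] := ltP r 0.
    by rewrite (_ : mkset _ = setT)//; apply/seteqP; split => // x _; right.
  have -> : [set x : R | r < `|x| \/ is_true false] = [set x : R | r < `|x|].
    by apply/seteqP; split => x /=; [case|left].
  exact: eq_norm_gt.
- by move=> k; apply: le_lt_trans m1fin; apply: le_measure; rewrite ?inE.
Qed.

End laplace_transform.

(** * Lebesgue integrals with a known finite value *)

Section has_integral.
Context {R : realType}.
Notation mu := (@lebesgue_measure R).

(** Integrability travels with the value, so that linear combinations and reflections of Gaussian
    integrals produce no separate integrability goals. *)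
Definition has_integral (f : R -> R) (v : R) : Prop :=
  mu.-integrable [set: R] (EFin \o f) /\ (\int[mu]_x (f x)%:E = v%:E)%E.

Lemma has_integral_ext (f g : R -> R) (v : R) :
  f =1 g -> has_integral f v -> has_integral g v.
Proof. by move=> /funext ->. Qed.

Lemma has_integralZ (k : R) (f : R -> R) (v : R) :
  has_integral f v -> has_integral (fun x => k * f x) (k * v).
Proof.
move=> [fi fv]; split.
  by have := integrableZl measurableT k fi; apply: eq_integrable.
under eq_integral do rewrite EFinM.
by rewrite integralZl// fv.
Qed.

Lemma has_integralD (f g : R -> R) (v w : R) :
  has_integral f v -> has_integral g w ->
  has_integral (fun x => f x + g x) (v + w).
Proof.
move=> [fi fv] [gi gw]; split.
  by have := integrableD measurableT fi gi; apply: eq_integrable.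
under eq_integral do rewrite EFinD.
by rewrite integralD_EFin// fv gw.
Qed.

Lemma has_integralB (f g : R -> R) (v w : R) :
  has_integral f v -> has_integral g w ->
  has_integral (fun x => f x - g x) (v - w).
Proof.
move=> hf /(has_integralZ (-1)) hg; rewrite -[in - w]mulN1r.
have := has_integralD hf hg; apply: has_integral_ext => x.
by rewrite mulN1r.
Qed.

Lemma has_integral_eq (f : R -> R) (v w : R) :
  v = w -> has_integral f v -> has_integral f w.
Proof. by move=> ->. Qed.

Lemma has_integral_Rintegral (f : R -> R) :
  mu.-integrable [set: R] (EFin \o f) -> has_integral f (\int[mu]_x f x).
Proof. by move=> fi; split => //; rewrite fineK// integrable_fin_num. Qed.

Lemma has_integral_RintegralE (f : R -> R) (v : R) :
  has_integral f v -> \int[mu]_x f x = v.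
Proof. by move=> [_]; rewrite /Rintegral => ->. Qed.

Lemma cvg_integral_symmetric (f : R -> R) :
  mu.-integrable [set: R] (EFin \o f) ->
  (\int[mu]_(x in `[(- n.+1%:R)%R, n.+1%:R]) (f x)%:E)%E @[n --> \oo] -->
  (\int[mu]_x (f x)%:E)%E.
Proof.
move=> fi; have mf := measurable_int _ fi.
under eq_fun do rewrite integral_mkcond.
apply: (@dominated_cvg _ _ _ mu setT measurableT
  (fun n => (EFin \o f) \_ `[(- n.+1%:R)%R, n.+1%:R]) _ (abse \o (EFin \o f))) => //.
- move=> n; apply/(measurable_restrictT _ _).1 => //.
  exact: measurable_funTS.
- move=> x _; apply: cvg_near_cst.
  exists (Num.Def.archi_bound `|x|) => // n /= nx.
  rewrite patchE mem_set//= in_itv/= -ler_norml.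
  rewrite ltW// (lt_le_trans (archi_boundP (normr_ge0 x)))//.
  by rewrite ler_nat (leq_trans nx).
- exact: integrable_abse fi.
- move=> n x _; rewrite patchE; case: ifPn => // _.
  by rewrite (_ : `|point| = 0)%E ?abse_ge0//; exact: abse0.
Qed.

Lemma has_integral_derivative (F f : R -> R) :
  (forall x : R, is_derive x 1 F (f x)) -> continuous f ->
  mu.-integrable [set: R] (EFin \o f) ->
  (F n.+1%:R - F (- n.+1%:R)) @[n --> \oo] --> (0 : R) ->
  has_integral f 0.
Proof.
move=> dF cf fi F0; split => //.
have dr x : derivable F x 1 by exact: ex_derive.
have cF x : F y @[y --> x] --> F x by exact/differentiable_continuous/derivable1_diffP.
have FTC n : (\int[mu]_(x in `[(- n.+1%:R)%R, n.+1%:R]) (f x)%:E =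
    (F n.+1%:R - F (- n.+1%:R))%:E)%E.
  rewrite EFinB; apply: continuous_FTC2.
  - by rewrite -subr_gt0 opprK addr_gt0.
  - exact: continuous_subspaceT.
  - by split => [x _||]; [exact: dr|exact/cvg_at_right_filter/cF|
      exact/cvg_at_left_filter/cF].
  - by move=> x _; rewrite derive1E derive_val.
have := cvg_integral_symmetric fi.
under eq_fun do rewrite FTC.
move=> h; apply: (cvg_unique (@ereal_hausdorff R) h).
by apply: cvg_EFin; [exact: nearW|exact: F0].
Qed.

Lemma measurable_reflect (c : R) :
  measurable_fun [set: R] (fun x => c - x : measurableTypeR R).
Proof. exact: measurable_funB. Qed.

(** Half-open intervals determine Lebesgue measure, and a reflection keeps their length although it
    moves the closed end to the other side. *)
Lemma lebesgue_measure_reflect (c : R) (A : set (measurableTypeR R)) :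
  measurable A ->
  pushforward mu (fun x => c - x : measurableTypeR R) A = mu A.
Proof.
have mf := measurable_reflect c.
move=> mA; apply/esym/lebesgue_measure_unique => //= _ [[a b]] _ <-.
rewrite /pushforward.
have -> : (fun x => c - x) @^-1` `]a, b]%classic = `[c - b, c - a[%classic.
  apply/seteqP; split => x; rewrite /= !in_itv/= => /andP[h1 h2];
  by apply/andP; split; lra.
rewrite !lebesgue_measure_itv/= !lte_fin.
have -> : (c - b < c - a) = (a < b) by apply/idP/idP; lra.
by case: ifP => // _; rewrite -!EFinB; congr (_%:E); lra.
Qed.

Lemma integrable_reflect (c : R) (f : R -> R) :
  mu.-integrable [set: R] (EFin \o f) ->
  mu.-integrable [set: R] (EFin \o (fun x => f (c - x))).
Proof.
move=> /integrableP[mf fi]; have mc := measurable_reflect c.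
apply/integrableP; split; first exact: (measurableT_comp mf).
apply: le_lt_trans fi; rewrite le_eqVlt; apply/orP; left; apply/eqP.
transitivity (\int[pushforward mu (fun x => (c - x)%R : measurableTypeR R)]_x
    `|(EFin \o f) x|)%E.
  by rewrite ge0_integral_pushforward//; exact: measurableT_comp.
by apply: eq_measure_integral => A mA _; exact: lebesgue_measure_reflect.
Qed.

Lemma has_integral_reflect (c : R) (f : R -> R) (v : R) :
  has_integral f v -> has_integral (fun x => f (c - x)) v.
Proof.
move=> [fi fv]; have mc := measurable_reflect c.
have fc := integrable_reflect c fi.
split => //; rewrite -fv.
transitivity (\int[pushforward mu (fun x => (c - x)%R : measurableTypeR R)]_x
    (f x)%:E)%E.
  by rewrite integral_pushforward//; exact: measurable_int fi.
by apply: eq_measure_integral => A mA _; exact: lebesgue_measure_reflect.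
Qed.

End has_integral.

(** * Gaussian densities: domination and the first two moments *)

Section gaussian.
Context {R : realType}.
Notation mu := (@lebesgue_measure R).
Implicit Types s m x : R.

(* The second argument of [normal_pdf] is the standard deviation, whereas s is
   the variance. *)
Definition gaussian s m x : R := normal_pdf m (Num.sqrt s) x.

Lemma gaussianE s m x : 0 < s ->
  gaussian s m x =
    (Num.sqrt (2 * pi * s))^-1 * expR (- ((x - m) ^+ 2 / (2 * s))).
Proof.
move=> s0; rewrite /gaussian normal_pdfE ?gt_eqF ?sqrtr_gt0//.
rewrite /normal_peak /normal_fun !sqr_sqrtr ?ltW//.
congr (_ * expR _); last by rewrite mulNr -[s *+ 2]mulr_natl.
by congr (Num.sqrt _)^-1; rewrite -mulr_natl; ring.
Qed.

Lemma gaussian_ge0 s m x : 0 <= gaussian s m x.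
Proof. exact: normal_pdf_ge0. Qed.

Lemma gaussianN s m x : 0 < s -> gaussian s (- m) x = gaussian s m (- x).
Proof.
move=> s0; rewrite !gaussianE//.
by have -> : (x - - m) ^+ 2 = (- x - m) ^+ 2 by ring.
Qed.

Lemma continuous_gaussian s m : 0 < s -> continuous (gaussian s m).
Proof. by move=> s0; apply: continuous_normal_pdf; rewrite gt_eqF// sqrtr_gt0. Qed.

Lemma measurable_gaussian s m : measurable_fun [set: R] (gaussian s m).
Proof. exact: measurable_normal_pdf. Qed.

Lemma measurable_gaussian2 d (T : measurableType d) s (f g : T -> R) : 0 < s ->
  measurable_fun [set: T] f -> measurable_fun [set: T] g ->
  measurable_fun [set: T] (fun t => gaussian s (f t) (g t)).
Proof.
move=> s0 mf mg; under eq_fun do rewrite gaussianE//.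
apply: measurable_funM => //; apply: measurableT_comp => //.
apply: measurable_funN; apply: measurable_funM => //.
by apply: measurable_funX; exact: measurable_funB.
Qed.

Lemma has_integral_gaussian s m : has_integral (gaussian s m) 1.
Proof.
split; first exact: integrable_normal_pdf.
exact: integral_normal_pdf.
Qed.

Lemma is_derive_gaussian s m x : 0 < s ->
  is_derive x 1 (gaussian s m) (- ((x - m) / s) * gaussian s m x).
Proof.
move=> s0.
have -> : gaussian s m = fun x =>
    (Num.sqrt (2 * pi * s))^-1 * expR (- ((x - m) ^+ 2 / (2 * s))).
  by apply/funext => y; rewrite gaussianE.
pose g y : R := - ((y - m) ^+ 2 / (2 * s)).
have dg : is_derive x 1 g (- ((x - m) / s)).
  have -> : g = (fun y => (- (2 * s)^-1) *: ((id \- cst m) y ^+ 2)).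
    by apply/funext => y; rewrite /g /= mulrC -mulNr.
  apply: is_derive_eq; rewrite /GRing.scale/=.
  by field; rewrite gt_eqF.
have de : is_derive x 1 (expR \o g) (expR (g x) * - ((x - m) / s)).
  exact: is_derive1_comp.
have -> : (fun x : R => (Num.sqrt (2 * pi * s))^-1 *
    expR (- ((x - m) ^+ 2 / (2 * s)))) =
    (fun x => (Num.sqrt (2 * pi * s))^-1 *: (expR \o g) x) by [].
by apply: is_derive_eq; rewrite /GRing.scale/= /g; ring.
Qed.

Lemma gaussian_le s u m r x : 0 < s -> s <= u -> `|m| <= r ->
  gaussian s m x <=
    (Num.sqrt (2 * pi * s))^-1 * expR (r / u * `|x| - (2 * u)^-1 * x ^+ 2).
Proof.
move=> s0 su mr; have u0 : 0 < u by exact: lt_le_trans su.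
rewrite gaussianE// ler_wpM2l ?invr_ge0 ?sqrtr_ge0// ler_expR lerNl.
apply: (@le_trans _ _ ((x - m) ^+ 2 / (2 * u))); last first.
  by rewrite ler_wpM2l ?sqr_ge0// lef_pV2 ?posrE ?mulr_gt0// ler_pM2l.
have xm : x * m <= r * `|x|.
  rewrite (le_trans (ler_norm _))// normrM mulrC ler_wpM2r//.
have -> : (x - m) ^+ 2 / (2 * u) = (x ^+ 2 - 2 * (x * m) + m ^+ 2) / (2 * u).
  by congr (_ / _); ring.
have -> : - (r / u * `|x| - (2 * u)^-1 * x ^+ 2) =
    (x ^+ 2 - 2 * (r * `|x|)) / (2 * u) by field; rewrite gt_eqF.
rewrite ler_pM2r ?invr_gt0 ?mulr_gt0//.
have := sqr_ge0 m; lra.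
Qed.

Lemma integrable_expR_sqr (g : R) : 0 < g ->
  mu.-integrable [set: R] (fun x => (expR (- (g * x ^+ 2)))%:E).
Proof.
move=> g0; have s0 : 0 < (2 * g)^-1 by rewrite invr_gt0 mulr_gt0.
have [gi _] := has_integralZ (Num.sqrt (2 * pi * (2 * g)^-1))
  (has_integral_gaussian (2 * g)^-1 0).
apply: eq_integrable gi => // x _ /=.
rewrite gaussianE// subr0 mulrA divff ?mul1r; last first.
  by rewrite gt_eqF// sqrtr_gt0 !mulr_gt0// pi_gt0.
by congr (expR (- _))%:E; field; rewrite gt_eqF.
Qed.

Lemma ler_linear_sqr (b g x : R) : 0 < g ->
  b * `|x| - g * x ^+ 2 <= b ^+ 2 / (2 * g) - g / 2 * x ^+ 2.
Proof.
move=> g0; rewrite -subr_ge0 -(real_normK (num_real x)).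
have -> : b ^+ 2 / (2 * g) - g / 2 * `|x| ^+ 2 - (b * `|x| - g * `|x| ^+ 2) =
   (b - g * `|x|) ^+ 2 / (2 * g) by field; rewrite gt_eqF.
by rewrite divr_ge0 ?sqr_ge0 ?mulr_ge0 ?ltW.
Qed.

Lemma integrable_gauss_bound (f : R -> R) (K b g : R) :
  measurable_fun [set: R] f -> 0 < g ->
  (forall x, `|f x| <= K * expR (b * `|x| - g * x ^+ 2)) ->
  mu.-integrable [set: R] (EFin \o f).
Proof.
move=> mf g0 fK; have g20 : 0 < g / 2 by rewrite divr_gt0.
have := integrableZl measurableT (`|K| * expR (b ^+ 2 / (2 * g)))
  (integrable_expR_sqr g20).
apply: le_integrable => //; first exact/measurable_EFinP.
move=> x _ /=; rewrite lee_fin (le_trans (fK x))// (le_trans (ler_norm _))//.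
have ne y : `|expR y : R| = expR y by rewrite ger0_norm// expR_ge0.
rewrite !normrM normr_id !ne -mulrA ler_wpM2l//.
by rewrite -expRD ler_expR ler_linear_sqr.
Qed.

Lemma norm_le_expR x : `|x| <= expR `|x|.
Proof. by rewrite (le_trans _ (expR_ge1Dx _))// lerDr. Qed.

Lemma integrable_gaussianX s m (k : nat) : 0 < s ->
  mu.-integrable [set: R] (EFin \o (fun x => x ^+ k * gaussian s m x)).
Proof.
move=> s0.
apply: (@integrable_gauss_bound _ (Num.sqrt (2 * pi * s))^-1
  (`|m| / s + k%:R) (2 * s)^-1).
- apply: measurable_funM; last exact: measurable_gaussian.
  exact: exprn_measurable.
- by rewrite invr_gt0 mulr_gt0.
move=> x; rewrite normrM normrX (ger0_norm (gaussian_ge0 _ _ _)).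
have -> : (`|m| / s + k%:R) * `|x| - (2 * s)^-1 * x ^+ 2 =
  k%:R * `|x| + (`|m| / s * `|x| - (2 * s)^-1 * x ^+ 2) by ring.
rewrite expRD mulrCA.
apply: ler_pM; [by rewrite exprn_ge0|exact: gaussian_ge0| |].
  by rewrite expRM_natl lerXn2r ?nnegrE ?expR_ge0// norm_le_expR.
exact: gaussian_le.
Qed.

(** The reflection at [m] changes the sign of [(x - m) * gaussian s m x], so the integral of this
    function equals its own opposite. *)
Lemma has_integral_gaussian_mean s m : 0 < s ->
  has_integral (fun x => x * gaussian s m x) m.
Proof.
move=> s0.
have hx := has_integral_Rintegral (integrable_gaussianX m 1 s0).
have h : has_integral (fun x => (x - m) * gaussian s m x)
    ((\int[mu]_x (x ^+ 1 * gaussian s m x)) - m * 1).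
  have := has_integralB hx (has_integralZ m (has_integral_gaussian s m)).
  by apply: has_integral_ext => x; rewrite expr1 mulrBl.
have h' := has_integral_reflect (2 * m) h.
have {}h' : has_integral (fun x => (-1) * ((x - m) * gaussian s m x))
    ((\int[mu]_x (x ^+ 1 * gaussian s m x)) - m * 1).
  apply: has_integral_ext h' => x.
  rewrite !gaussianE// -[(x - m) ^+ 2]sqrrN.
  have -> : - (x - m) = 2 * m - x - m by ring.
  ring.
have e : \int[mu]_x (x ^+ 1 * gaussian s m x) = m.
  have := has_integral_RintegralE h'.
  by rewrite (has_integral_RintegralE (has_integralZ (-1) h)); lra.
by move: hx; rewrite e; apply: has_integral_ext => x; rewrite expr1.
Qed.

(** Integration by parts: [x * gaussian s 0 x] has derivative [(1 - x^2 / s) * gaussian s 0 x] and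
    vanishes at infinity. *)
Lemma has_integral_gaussian_sqr s : 0 < s ->
  has_integral (fun x => x ^+ 2 * gaussian s 0 x) s.
Proof.
move=> s0.
have hx := has_integral_Rintegral (integrable_gaussianX 0 2 s0).
have h1 := has_integralB (has_integral_gaussian s 0) (has_integralZ s^-1 hx).
have h0 : has_integral (fun x => gaussian s 0 x - s^-1 * (x ^+ 2 * gaussian s 0 x)) 0.
  apply: (@has_integral_derivative _ (fun x => x * gaussian s 0 x)).
  - move=> x; have dg := is_derive_gaussian 0 x s0.
    have -> : (fun x => x * gaussian s 0 x) = (id * gaussian s 0 : R -> R) by [].
    by apply: is_derive_eq; rewrite /GRing.scale/= subr0; ring.
  - move=> x; apply: cvgB; first exact: continuous_gaussian.
    apply: cvgM; first exact: cvg_cst.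
    apply: cvgM; last exact: continuous_gaussian.
    exact: exprn_continuous.
  - by case: h1.
  - have K0 : 0 <= (Num.sqrt (2 * pi * s))^-1 by rewrite invr_ge0.
    have c0 : 0 < (2 * s)^-1 by rewrite invr_gt0 mulr_gt0.
    pose K := 2 * (Num.sqrt (2 * pi * s))^-1.
    have lim : (K * (n.+1%:R * expR (- ((2 * s)^-1 * n.+1%:R)))) @[n --> \oo] --> (0:R).
      rewrite -[X in _ --> X](mulr0 K); apply: cvgM; first exact: cvg_cst.
      by rewrite (cvg_shiftS (fun n => n%:R * expR (- ((2 * s)^-1 * n%:R)))); exact: cvg_nat_expR.
    apply: (@squeeze_cvgr _ _ _ _ (cst 0) _ _ _ _ _ lim); last exact: cvg_cst.
    near=> n; have n1 : (1:R) <= n.+1%:R by rewrite ler1n.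
    rewrite !gaussianE// !subr0 sqrrN mulNr opprK; apply/andP; split.
      by rewrite addr_ge0// !mulr_ge0 ?expR_ge0.
    have -> : forall y z : R, y * z + y * z = 2 * (y * z) by move=> y z; ring.
    rewrite /K -[leRHS]mulrA [leLHS](_ : _ = 2 * (n.+1%:R *
      ((Num.sqrt (2 * pi * s))^-1 * expR (- (n.+1%:R ^+ 2 / (2 * s))))))//.
    rewrite (ler_pM2l (ltr0n _ 2)) mulrCA ler_wpM2l// ler_wpM2l//.
    rewrite ler_expR lerN2 mulrC ler_pM2r// expr2 ler_peMr//.
have e : \int[mu]_x (x ^+ 2 * gaussian s 0 x) = s.
  have := has_integral_RintegralE h1; rewrite (has_integral_RintegralE h0).
  move=> /eqP; rewrite eq_sym subr_eq0 => /eqP e.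
  by apply: (@mulfI _ s^-1); rewrite ?invr_eq0 ?gt_eqF// -e mulVf// gt_eqF.
by move: hx; rewrite e.
Unshelve. all: end_near. Qed.

End gaussian.

(** * The Bessel transition density and its Laplace transform *)

Section bessel_kernel.
Context {R : realType}.
Implicit Types s r q l : R.

(** Completing the square: the tilted density is again Gaussian, with variance and mean divided by
    [1 + 2 l s]. The factor in front is the Laplace transform of the square of a normal variable. *)
Lemma gaussian_tilt s r l q : 0 < s -> 0 <= l ->
  expR (- (l * q ^+ 2)) * gaussian s r q =
  (Num.sqrt (1 + 2 * l * s))^-1 * expR (- (l / (1 + 2 * l * s) * r ^+ 2)) *
    gaussian (s / (1 + 2 * l * s)) (r / (1 + 2 * l * s)) q.
Proof.
move=> s0 l0; set D := 1 + 2 * l * s.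
have D0 : 0 < D by rewrite ltr_pwDl// !mulr_ge0// ltW.
rewrite !gaussianE ?divr_gt0// mulrCA -expRD mulrACA -expRD; congr (_ * expR _).
  rewrite -invfM -sqrtrM ?ltW//; congr (Num.sqrt _)^-1.
  by field; rewrite gt_eqF.
have -> : 2 * (s / D) = 2 * s / D by rewrite mulrA.
by rewrite /D; field; rewrite !gt_eqF.
Qed.

Lemma has_integral_gaussian_tilt s r l : 0 < s -> 0 <= l ->
  has_integral (fun q => expR (- (l * q ^+ 2)) * gaussian s r q)
    ((Num.sqrt (1 + 2 * l * s))^-1 * expR (- (l / (1 + 2 * l * s) * r ^+ 2))).
Proof.
move=> s0 l0; rewrite -[X in has_integral _ X]mulr1.
apply: has_integral_ext (has_integralZ _ (has_integral_gaussian _ _)) => q.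
by rewrite gaussian_tilt.
Qed.

(* [x^-1 = lim x / (x ^+ 2 + 1 / n)], also at [x = 0], where the inverse is 0. *)
Lemma measurable_invr : measurable_fun [set: R] (@GRing.inv R).
Proof.
apply: (@measurable_fun_cvg _ _ _ setT (fun n (x : R) => x / (x ^+ 2 + n.+1%:R^-1))).
  move=> n; apply: continuous_measurable_fun => x.
  have p0 : 0 < x ^+ 2 + n.+1%:R^-1 by rewrite ltr_wpDl ?sqr_ge0// invr_gt0.
  apply: cvgM; first exact: cvg_id.
  apply: cvgV; first by rewrite gt_eqF.
  by apply: cvgD; [exact: exprn_continuous|exact: cvg_cst].
move=> x _; have [->|x0] := eqVneq x 0.
  by under eq_fun do rewrite mul0r; rewrite invr0; exact: cvg_cst.
have -> : x^-1 = x / (x ^+ 2 + 0) by rewrite addr0; field.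
apply: cvgM; first exact: cvg_cst.
apply: cvgV; first by rewrite addr0 sqrf_eq0.
by apply: cvgD; [exact: cvg_cst|exact: cvg_harmonic].
Qed.

(* The transition density from r in time s, as a density in q over the whole
   line: it is even in q, and half of it lives on q < 0. *)
Definition bessel_pdf s r q : R :=
  if r == 0 then q ^+ 2 / s * gaussian s 0 q
  else q / (2 * r) * (gaussian s r q - gaussian s (- r) q).

Lemma bessel_pdf_ge0 s r q : 0 < s -> 0 <= r -> 0 <= bessel_pdf s r q.
Proof.
move=> s0 r0; rewrite /bessel_pdf; case: ifPn => [_|rn0].
  by rewrite mulr_ge0 ?gaussian_ge0 ?divr_ge0 ?sqr_ge0 ?ltW.
have {r0 rn0}r0 : 0 < r by rewrite lt_neqAle eq_sym rn0.
have K0 : 0 <= (Num.sqrt (2 * pi * s))^-1 by rewrite invr_ge0.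
have s20 : 0 <= (2 * s)^-1 by rewrite invr_ge0 mulr_ge0// ltW.
have [q0|q0] := leP 0 q.
  rewrite mulr_ge0 ?divr_ge0 ?mulr_ge0 ?(ltW r0)// subr_ge0 !gaussianE//.
  rewrite ler_wpM2l// ler_expR lerN2 ler_wpM2r//.
  rewrite -subr_ge0; have -> : (q - - r) ^+ 2 - (q - r) ^+ 2 = 4 * (q * r) by ring.
  by rewrite !mulr_ge0// ltW.
have qr : q / (2 * r) <= 0 by rewrite pmulr_lle0 ?invr_gt0 ?mulr_gt0// ltW.
rewrite mulr_le0// subr_le0 !gaussianE//.
rewrite ler_wpM2l// ler_expR lerN2 ler_wpM2r//.
rewrite -subr_ge0; have -> : (q - r) ^+ 2 - (q - - r) ^+ 2 = 4 * (- q * r) by ring.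
by rewrite !mulr_ge0// ?oppr_ge0 ltW.
Qed.

Lemma measurable_bessel_pdf d (T : measurableType d) s (f g : T -> R) : 0 < s ->
  measurable_fun [set: T] f -> measurable_fun [set: T] g ->
  measurable_fun [set: T] (fun t => bessel_pdf s (f t) (g t)).
Proof.
move=> s0 mf mg; rewrite /bessel_pdf; apply: measurable_fun_ifT.
- exact: measurable_fun_eqr.
- apply: measurable_funM; last exact: measurable_gaussian2.
  by apply: measurable_funM => //; exact: measurable_funX.
- apply: measurable_funM.
    apply: measurable_funM => //.
    apply: (measurableT_comp measurable_invr); exact: measurable_funM.
  apply: measurable_funB; apply: measurable_gaussian2 => //.
  exact: measurable_funN.
Qed.

(** After tilting, the two Gaussians share one prefactor and have means [r / D] and [- r / D]. Their
    first moments differ by [2 r / D], and division by [2 r] leaves the extra [D^-1] that raises the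
    power of [(sqrt D)^-1] from 1 to 3, the value for three coordinates. At [r = 0] the second
    moment [s / D] does the same. *)
Lemma has_integral_bessel_laplace s r l : 0 < s -> 0 <= l ->
  has_integral (fun q => expR (- (l * q ^+ 2)) * bessel_pdf s r q)
    ((Num.sqrt (1 + 2 * l * s))^-1 ^+ 3 * expR (- (l / (1 + 2 * l * s) * r ^+ 2))).
Proof.
move=> s0 l0; set D := 1 + 2 * l * s.
have D0 : 0 < D by rewrite ltr_pwDl// !mulr_ge0// ltW.
have D3 : (Num.sqrt D)^-1 ^+ 3 = (Num.sqrt D)^-1 * D^-1.
  by rewrite exprS exprVn sqr_sqrtr// ltW.
have sD0 : 0 < s / D by rewrite divr_gt0.
rewrite D3 /bessel_pdf; have [->|r0] := eqVneq r 0.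
  have h := has_integralZ (s^-1 * (Num.sqrt D)^-1) (has_integral_gaussian_sqr sD0).
  apply: has_integral_eq (has_integral_ext _ h).
    rewrite expr0n/= mulr0 oppr0 expR0 mulr1.
    by field; rewrite ?gt_eqF ?sqrtr_gt0.
  move=> q; rewrite [RHS]mulrCA gaussian_tilt// -/D mul0r expr0n/= mulr0 oppr0 expR0.
  by rewrite mulr1; ring.
pose C := (Num.sqrt D)^-1 * expR (- (l / D * r ^+ 2)).
have h := has_integralZ (C / (2 * r)) (has_integralB
  (has_integral_gaussian_mean (r / D) sD0) (has_integral_gaussian_mean (- r / D) sD0)).
apply: has_integral_eq (has_integral_ext _ h).
  by rewrite /C; field; rewrite ?r0 ?gt_eqF ?sqrtr_gt0.
move=> q; rewrite [RHS]mulrCA [in RHS]mulrBr !gaussian_tilt// -/D sqrrN -/C.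
by field; rewrite ?r0 ?gt_eqF.
Qed.

End bessel_kernel.

(** * Integrating out a variable that is independent of a sigma-algebra *)

Section integrate_out.
Local Open Scope ereal_scope.
Context {d} {Omega : measurableType d} {R : realType}.
Variables (P : probability Omega R) (nu : probability (measurableTypeR R) R).
Variables (Z : Omega -> R) (G : set (set Omega)).
Hypothesis mZ : measurable_fun [set: Omega] Z.
Hypothesis GI : setI_closed G.
Hypothesis GT : G [set: Omega].
Hypothesis Gm : G `<=` measurable.
Hypothesis indep : forall (E : set Omega) (C : set R), G E -> measurable C ->
  P (E `&` Z @^-1` C) = P E * nu C.

Let sub_G : <<s G >> `<=` measurable.
Proof. exact: smallest_sub (@sigma_algebra_measurable _ Omega) Gm. Qed.

Let preim_Z (C : set R) : measurable C -> measurable (Z @^-1` C).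
Proof. by move=> mC; rewrite -[X in measurable X]setTI; exact: mZ. Qed.

(** For fixed [C] both sides are finite measures in [E]; they agree on the pi-system [G], which
    contains the whole space, hence on the sigma-algebra it generates. *)
Let indep_sigma (E : set Omega) (C : set R) : <<s G >> E -> measurable C ->
  P (E `&` Z @^-1` C) = P E * nu C.
Proof.
move=> GE mC; have mZC := preim_Z mC.
have nuC : (fine (nu C))%:E = nu C.
  by rewrite fineK// fin_num_measure.
have nuC0 : (0 <= fine (nu C))%R by rewrite fine_ge0.
have cover : \bigcup_(k : nat) [set: Omega] = setT by rewrite bigcup_const.
have := @g_sigma_algebra_measure_unique _ _ _ G Gm (fun=> setT) (fun=> GT) cover
  (mrestr P mZC) (mscale (NngNum nuC0) P) GI.
move=> h; have {h} : mrestr P mZC E = mscale (NngNum nuC0) P E.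
  apply: h => //.
    by move=> A GA; rewrite /= /mrestr/= /mscale/= nuC indep// muleC.
  move=> _; rewrite /= /mrestr/= setTI ltey_eq fin_num_measure//.
by rewrite /= /mrestr/= /mscale/= nuC muleC.
Qed.

Notation OmegaG := (g_sigma_algebraType G).

Let mid : measurable_fun [set: Omega] (id : Omega -> OmegaG).
Proof. by move=> _ A mA; rewrite setTI; exact: sub_G. Qed.

Lemma sub_sigma_measurable d' (T : measurableType d') (f : OmegaG -> T) :
  measurable_fun [set: OmegaG] f -> measurable_fun [set: Omega] f.
Proof. by move=> mf; exact: (measurableT_comp mf mid). Qed.

Let PG := distribution P (mfun_Sub (mem_set mid)).

(** With [Omega] carrying only the sigma-algebra generated by [G], the joint law of the outcome and
    [Z] is a product measure, and Tonelli's theorem replaces a conditional expectation. *)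
Lemma ge0_integrate_out (F : OmegaG * R -> \bar R) :
  measurable_fun [set: OmegaG * measurableTypeR R] F -> (forall x, 0 <= F x) ->
  \int[P]_w F (w, Z w) = \int[P]_w \int[nu]_z F (w, z).
Proof.
move=> mF F0.
have mp : measurable_fun [set: Omega]
    (fun w => (w, Z w) : OmegaG * measurableTypeR R).
  exact: measurable_fun_pair mid mZ.
transitivity (\int[pushforward P
    (fun w => (w, Z w) : OmegaG * measurableTypeR R)]_x F x).
  by rewrite ge0_integral_pushforward.
transitivity (\int[PG \x nu]_x F x).
  apply/esym/eq_measure_integral => A mA _.
  exact: product_measure_unique.
rewrite fubini_tonelli1// /PG /distribution ge0_integral_pushforward//.
  exact: measurable_fun_fubini_tonelli_F.
by move=> y _; apply: integral_ge0.
Qed.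

Lemma ge0_integrate_out_shift (h : OmegaG -> \bar R) (Y : OmegaG -> R)
    (f : R -> \bar R) :
  measurable_fun [set: OmegaG] h -> (forall w, 0 <= h w) ->
  measurable_fun [set: OmegaG] Y ->
  measurable_fun [set: R] f -> (forall x, 0 <= f x) ->
  \int[P]_w (h w * f (Y w + Z w)%R) =
  \int[P]_w (h w * \int[nu]_z f (Y w + z)%R).
Proof.
move=> mh h0 mY mf f0.
pose F (x : OmegaG * R) := h x.1 * f (Y x.1 + x.2)%R.
have mF : measurable_fun [set: OmegaG * measurableTypeR R] F.
  apply: emeasurable_funM; first exact: (measurableT_comp mh).
  apply: (measurableT_comp mf); apply: measurable_funD => //.
  exact: (measurableT_comp mY).
have F0 x : 0 <= F x by rewrite mule_ge0.
rewrite (ge0_integrate_out mF F0); apply: eq_integral => w _.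
rewrite /F/= ge0_integralZl//.
by apply: (measurableT_comp mf); exact: measurable_funD.
Qed.

End integrate_out.

Section independent_family.
Context {d} {Omega : measurableType d} {R : realType}.
Variables (P : probability Omega R) (I : finType) (X : I -> Omega -> R).
Hypothesis mX : forall i, measurable_fun [set: Omega] (X i).
Hypothesis indX : mutually_independent P X.

(** One set is prescribed for every index except [i0], so intersecting two such events means
    intersecting their sets index by index: this is the pi-system [G] of the previous section. *)
Definition other_cylinders (i0 : I) : set (set Omega) :=
  [set E | exists2 A : I -> set R, (forall i, measurable (A i)) &
     E = [set w | forall i, i != i0 -> A i (X i w)]].

Lemma other_cylinders_setI i0 : setI_closed (other_cylinders i0).
Proof.
move=> _ _ [A mA ->] [B mB ->].
exists (fun i => A i `&` B i) => [i|]; first exact: measurableI.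
apply/seteqP; split => w /=; first by move=> [hA hB] i ii0; split; auto.
by move=> h; split => i /h[].
Qed.

Lemma other_cylinders_setT i0 : other_cylinders i0 [set: Omega].
Proof. by exists (fun=> setT) => //; apply/seteqP; split. Qed.

Lemma measurable_cylinder (A : I -> set R) : (forall i, measurable (A i)) ->
  measurable [set w | forall i, A i (X i w)].
Proof.
move=> mA; have -> : [set w | forall i, A i (X i w)] =
    \bigcap_(i in [set: I]) (X i @^-1` A i).
  by apply/seteqP; split => w /= h i; [move=> _; exact: h|exact: h].
apply: fin_bigcap_measurable => // i _.
by rewrite -[X in measurable X]setTI; exact: mX.
Qed.

Lemma other_cylinders_measurable i0 : other_cylinders i0 `<=` measurable.
Proof.
move=> _ [A mA ->].
have -> : [set w | forall i, i != i0 -> A i (X i w)] =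
    [set w | forall i, (if i == i0 then setT else A i) (X i w)].
  apply/seteqP; split => w /= h i; first by case: ifPn => // /h.
  by move=> /negbTE ii0; have := h i; rewrite ii0.
by apply: (measurable_cylinder (A := fun i => if i == i0 then setT else A i)) => i; case: ifP.
Qed.

(** The product formula is applied twice, with [C] and with the whole line at the index [i0]; the
    second use identifies the remaining product as [P E]. *)
Lemma other_cylinders_indep i0 (E : set Omega) (C : set R) :
  other_cylinders i0 E -> measurable C ->
  P (E `&` X i0 @^-1` C) = (P E * P (X i0 @^-1` C))%E.
Proof.
move=> [A mA ->] mC.
have PE (D : set R) : measurable D ->
    P ([set w | forall i, i != i0 -> A i (X i w)] `&` X i0 @^-1` D) =
    (P (X i0 @^-1` D) * \prod_(i | i != i0) P (X i @^-1` A i))%E.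
  move=> mD; pose B i := if i == i0 then D else A i.
  have mB i : measurable (B i) by rewrite /B; case: ifP.
  have := indX mB; rewrite (bigD1 i0)//= {2}/B eqxx => e.
  rewrite -(_ : (\prod_(i | i != i0) P (X i @^-1` B i) =
     \prod_(i | i != i0) P (X i @^-1` A i))%E); last first.
    by apply: eq_bigr => i /negbTE ii0; rewrite /B ii0.
  rewrite -e; congr (P _); apply/seteqP; split => w /=.
    by move=> [h hD] i; rewrite /B; case: eqP => [->//|/eqP/h].
  move=> h; split; last by have := h i0; rewrite /B eqxx.
  by move=> i /negbTE ii0; have := h i; rewrite /B ii0.
rewrite PE// muleC; congr (_ * _)%E.
have := PE setT measurableT.
by rewrite preimage_setT setIT probability_setT mul1e.
Qed.

Lemma measurable_other (i0 i : I) : i != i0 ->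
  measurable_fun [set: g_sigma_algebraType (other_cylinders i0)]
    (X i : g_sigma_algebraType (other_cylinders i0) -> R).
Proof.
move=> ii0 _ A mA; rewrite setTI; apply: sub_sigma_algebra.
exists (fun j => if j == i then A else setT) => [j|]; first by case: ifP.
apply/seteqP; split => w /= h; first by move=> j _; case: eqP => // ->.
by have := h i ii0; rewrite eqxx.
Qed.

End independent_family.

Section density_measure.
Import HBNNSimple.
Local Open Scope ereal_scope.
Context {d} {T : measurableType d} {R : realType}.
Variables (m : {measure set T -> \bar R}) (g : T -> R).

(** Carrying the two proofs as arguments lets the measure structure declared below attach to the
    term itself. *)
Definition density_measure (mg : measurable_fun [set: T] g)
  (g0 : forall x, (0 <= g x)%R) (A : set T) : \bar R := \int[m]_(x in A) (g x)%:E.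

Hypothesis mg : measurable_fun [set: T] g.
Hypothesis g0 : forall x, (0 <= g x)%R.

Local Notation dens := (density_measure mg g0).

Let density0 : dens set0 = 0.
Proof. exact: integral_set0. Qed.

Let density_ge0 A : 0 <= dens A.
Proof. by apply: integral_ge0 => x _; rewrite lee_fin. Qed.

Let density_sigma_additive : semi_sigma_additive dens.
Proof.
move=> A mA tA mUA; rewrite /density_measure ge0_integral_bigcup//.
- apply: is_cvg_ereal_nneg_natsum_cond => n _ _.
  by apply: integral_ge0 => x _; rewrite lee_fin.
- by apply: measurable_funTS; exact/measurable_EFinP.
- by move=> x _; rewrite lee_fin.
Qed.

HB.instance Definition _ := isMeasure.Build _ _ _ dens
  density0 density_ge0 density_sigma_additive.

Let mgE : measurable_fun [set: T] (EFin \o g).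
Proof. exact/measurable_EFinP. Qed.

Let ge0_integral_density_nnsfun (h : {nnsfun T >-> R}) :
  \int[dens]_x (h x)%:E = \int[m]_x ((h x)%:E * (g x)%:E).
Proof.
under [LHS]eq_integral do rewrite fimfunE -fsumEFin//.
rewrite ge0_integral_fsum//; last 2 first.
  - by move=> r; exact/measurable_EFinP/measurable_funM.
  - by move=> r x _; exact: nnfun_muleindic_ge0.
under [RHS]eq_integral => x _.
  rewrite fimfunE -fsumEFin// ge0_mule_fsuml; last first.
    by move=> r; exact: nnfun_muleindic_ge0.
  over.
rewrite ge0_integral_fsum//; last 2 first.
  - move=> r; apply: emeasurable_funM => //.
    exact/measurable_EFinP/measurable_funM.
  - by move=> r x _; rewrite mule_ge0 ?nnfun_muleindic_ge0// lee_fin.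
apply: eq_fsbigr => r _.
rewrite integralZl_indic_nnsfun// integral_indic// setIT.
have [r0|r0] := ltP r 0%R.
  rewrite preimage_nnfun0// measure0 mule0.
  by under eq_integral do rewrite indic0 mulr0 mul0e; rewrite integral0.
under eq_integral do rewrite EFinM -muleA.
rewrite ge0_integralZl//; last 2 first.
- by apply: emeasurable_funM => //; exact/measurable_EFinP.
- by move=> x _; rewrite mule_ge0// lee_fin.
congr (_ * _); rewrite [LHS]integral_mkcond; apply: eq_integral => x _.
rewrite /patch indicE; case: ifPn => _; first by rewrite mul1e.
by rewrite mul0e.
Qed.

Lemma ge0_integral_density (f : T -> \bar R) :
  measurable_fun [set: T] f -> (forall x, 0 <= f x) ->
  \int[dens]_x f x = \int[m]_x (f x * (g x)%:E).
Proof.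
move=> mf f0; pose h := nnsfun_approx measurableT mf.
have hf x : (h n x)%:E @[n --> \oo] --> f x by exact: cvg_nnsfun_approx.
have ndh x : {homo (fun n => (h n x)%:E) : n k / (n <= k)%N >-> n <= k}.
  by move=> n k nk; rewrite lee_fin; exact/lefP/nd_nnsfun_approx.
transitivity (limn (fun n => \int[dens]_x (h n x)%:E)).
  rewrite -monotone_convergence//.
  - by apply: eq_integral => x _; apply/esym/cvg_lim => //; exact: hf.
  - by move=> n; exact/measurable_EFinP.
  - by move=> n x _; rewrite lee_fin.
under eq_fun do rewrite ge0_integral_density_nnsfun.
rewrite -monotone_convergence//.
- apply: eq_integral => x _; apply/cvg_lim => //.
  by apply: cvgeZr => //; exact: hf.
- by move=> n; apply: emeasurable_funM => //; exact/measurable_EFinP.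
- by move=> n x _; rewrite mule_ge0// lee_fin.
- by move=> x _ n k nk; rewrite lee_wpmul2r ?lee_fin//; exact: ndh.
Qed.

End density_measure.

Section normal_prob_integral.
Local Open Scope ereal_scope.
Context {R : realType}.
Notation mu := (@lebesgue_measure R).

Lemma ge0_integral_normal_prob (s : R) (f : R -> \bar R) :
  measurable_fun [set: R] f -> (forall x, 0 <= f x) ->
  \int[normal_prob 0 (Num.sqrt s)]_x f x =
  \int[mu]_x (f x * (gaussian s 0 x)%:E).
Proof.
move=> mf f0.
rewrite -(ge0_integral_density mu (measurable_gaussian s 0) (gaussian_ge0 s 0) mf f0).
exact: eq_measure_integral.
Qed.

End normal_prob_integral.

(** * The transition law of the norm of the Brownian motion *)

Section bessel_transition.
Local Open Scope ereal_scope.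
Context {d} {Omega : measurableType d} {R : realType}.
Notation mu := (@lebesgue_measure R).
Variables (P : probability Omega R) (B : 'I_3 -> halfline R -> Omega -> R).
Hypothesis BM : standard_brownian_motion P B.
Variables (t : nat -> halfline R) (n : nat).
Hypothesis t0 : \val (t 0%N) = 0%R.
Hypothesis t_nd : forall j, (\val (t j) <= \val (t j.+1))%R.

Let measurable_B i s : measurable_fun [set: Omega] (B i s).
Proof. by have [+ _ _ _ _] := BM; exact. Qed.

Definition increments (ij : 'I_3 * 'I_n.+1) (w : Omega) : R :=
  (B ij.1 (t ij.2.+1) w - B ij.1 (t ij.2) w)%R.

Let last_incr (k : 'I_3) : 'I_3 * 'I_n.+1 := (k, ord_max).

(* The sigma-algebra of all the grid increments but the k-th coordinate of the
   last one; the intersection over k contains the past up to time [t n]. *)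
Definition past (k : 'I_3) :=
  g_sigma_algebraType (other_cylinders increments (last_incr k)).

Lemma measurable_increments ij : measurable_fun [set: Omega] (increments ij).
Proof. exact: measurable_funB. Qed.

Lemma mutually_independent_increments : mutually_independent P increments.
Proof. by have [_ _ _ _ /(_ n.+1 t t_nd)] := BM. Qed.

(** The motion starts at 0, so its value at [t j] is a sum of grid increments, and for [j <= n] the
    last increment is not among them. *)
Lemma measurable_past k i j : (j <= n)%N ->
  measurable_fun [set: past k] (B i (t j) : past k -> R).
Proof.
elim: j => [_|j IH jn].
  rewrite (_ : B i (t 0%N) = cst 0%R)//.
  by apply/funext => w; have [_ + _ _ _] := BM; exact.
have jn1 : (j < n.+1)%N by rewrite ltnS ltnW.
have -> : B i (t j.+1) = (B i (t j) \+ increments (i, Ordinal jn1))%R.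
  by apply/funext => w; rewrite /= /increments/= subrKC.
apply: measurable_funD; first exact: IH (ltnW jn).
apply: measurable_other; apply/eqP => -[_ jE].
by move: jn; rewrite jE ltnn.
Qed.

Lemma measurable_past_last k i : i != k ->
  measurable_fun [set: past k] (increments (last_incr i) : past k -> R).
Proof. by move=> ik; apply: measurable_other; rewrite xpair_eqE (negbTE ik). Qed.

Let s := (\val (t n.+1) - \val (t n))%R.
Hypothesis s0 : (0 < s)%R.

Lemma ge0_integral_last_increment k (h : past k -> \bar R) (Y : past k -> R)
    (f : R -> \bar R) :
  measurable_fun [set: past k] h -> (forall w, 0 <= h w) ->
  measurable_fun [set: past k] Y ->
  measurable_fun [set: R] f -> (forall x, 0 <= f x) ->
  \int[P]_w (h w * f (Y w + increments (last_incr k) w)%R) =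
  \int[P]_w (h w * \int[normal_prob 0 (Num.sqrt s)]_z f (Y w + z)%R).
Proof.
move=> mh h0 mY mf f0.
pose X := increments; pose i0 := last_incr k.
apply: (@ge0_integrate_out_shift _ _ _ P (normal_prob 0 (Num.sqrt s)) (X i0)
  (other_cylinders X i0)) => //.
- exact: measurable_increments.
- exact: other_cylinders_setI.
- exact: other_cylinders_setT.
- exact/other_cylinders_measurable/measurable_increments.
- move=> E C GE mC.
  rewrite (other_cylinders_indep mutually_independent_increments GE mC).
  congr (_ * _); have [_ _ _ + _] := BM; apply => //.
  by rewrite -subr_gt0.
Qed.

Let expsq l (x : R) : R := expR (- (l * x ^+ 2)).

Lemma integral_normal_prob_expsq (l y : R) : (0 <= l)%R ->
  \int[normal_prob 0 (Num.sqrt s)]_z (expR (- (l * (y + z) ^+ 2)))%:E =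
  ((Num.sqrt (1 + 2 * l * s))^-1 * expR (- (l / (1 + 2 * l * s) * y ^+ 2)))%:E.
Proof.
move=> l0; rewrite ge0_integral_normal_prob; last 2 first.
- apply/measurable_EFinP; apply: measurableT_comp => //.
  apply: measurable_funN; apply: measurable_funM => //.
  by apply: measurable_funX; exact: measurable_funD.
- by move=> z; rewrite lee_fin expR_ge0.
(* Two reflections compose to the translation [z -> y + z], which moves the mean [y] of the Gaussian
   to 0. *)
have [_ <-] := has_integral_reflect (- y)
  (has_integral_reflect 0 (has_integral_gaussian_tilt y s0 l0)).
apply: eq_integral => z _; rewrite -EFinM.
have -> : (0 - (- y - z) = y + z)%R by ring.
by rewrite !gaussianE// (_ : y + z - y = z - 0)%R//; ring.
Qed.

Variable h : Omega -> R.
Hypothesis h0 : forall w, (0 <= h w)%R.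
Hypothesis h1 : forall w, (h w <= 1)%R.
Hypothesis mh : forall k, measurable_fun [set: past k] (h : past k -> R).

Let Y i := B i (t n).
Let Z i := increments (last_incr i).

Let sqnorm j (w : Omega) : R := (\sum_(i < 3) B i (t j) w ^+ 2)%R.
Let radius w : R := Num.sqrt (sqnorm n w).

Let YZ i w : B i (t n.+1) w = (Y i w + Z i w)%R.
Proof. by rewrite /Y /Z /increments/= subrKC. Qed.

Let gap l (y : R) : R := ((Num.sqrt (1 + 2 * l * s))^-1 *
  expR (- (l / (1 + 2 * l * s) * y ^+ 2)))%R.

Let measurable_expsq l : measurable_fun [set: R] (expsq l).
Proof.
apply: measurableT_comp => //; apply: measurable_funN.
by apply: measurable_funM => //; exact: exprn_measurable.
Qed.

Let measurable_gap l : measurable_fun [set: R] (gap l).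
Proof. by apply: measurable_funM => //; exact: measurable_expsq. Qed.

Let gap_ge0 l y : (0 <= gap l y)%R.
Proof. by rewrite mulr_ge0 ?expR_ge0// invr_ge0. Qed.

Let step k l (g : Omega -> R) : (0 <= l)%R ->
  measurable_fun [set: past k] (g : past k -> R) -> (forall w, (0 <= g w)%R) ->
  \int[P]_w (g w * expsq l (Y k w + Z k w))%:E = \int[P]_w (g w * gap l (Y k w))%:E.
Proof.
move=> l0 mg g0; under eq_integral do rewrite EFinM.
have mY : measurable_fun [set: past k] (Y k : past k -> R) by exact: measurable_past.
rewrite (@ge0_integral_last_increment k (EFin \o g) (Y k) (EFin \o expsq l))//.
- by apply: eq_integral => w _; rewrite /= integral_normal_prob_expsq.
- exact/measurable_EFinP.
- by apply/measurable_EFinP; exact: measurable_expsq.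
- by move=> x; rewrite /= lee_fin expR_ge0.
Qed.

(** The exponential of the squared norm factors over the coordinates. While coordinate [k] is
    integrated out, the factors not yet treated belong to the weight: they are measurable for
    [past k] because it contains the last increments of the other coordinates. *)
Let laplace l : (0 <= l)%R ->
  \int[P]_w (h w * expR (- (l * sqnorm n.+1 w)))%:E =
  \int[P]_w (h w * ((Num.sqrt (1 + 2 * l * s))^-1 ^+ 3 *
    expR (- (l / (1 + 2 * l * s) * sqnorm n w))))%:E.
Proof.
move=> l0.
pose i0 : 'I_3 := ord0; pose i1 : 'I_3 := lift ord0 ord0; pose i2 : 'I_3 := ord_max.
have sum3 (F : 'I_3 -> R) : (\sum_(i < 3) F i = F i0 + F i1 + F i2)%R.
  rewrite !big_ord_recr big_ord0 /= add0r.
  by congr (F _ + F _ + F _)%R; apply: val_inj.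
pose e i w := expsq l (Y i w + Z i w); pose q i w := gap l (Y i w).
have e0 i w : (0 <= e i w)%R by exact: expR_ge0.
have q0 i w : (0 <= q i w)%R by exact: gap_ge0.
have me k i : i != k -> measurable_fun [set: past k] (e i : past k -> R).
  move=> ik; apply: (measurableT_comp (measurable_expsq l)).
  apply: measurable_funD; first exact: measurable_past.
  exact: measurable_past_last.
have mq k i : measurable_fun [set: past k] (q i : past k -> R).
  apply: (measurableT_comp (measurable_gap l)); exact: measurable_past.
transitivity (\int[P]_w (h w * e i1 w * e i2 w * e i0 w)%:E).
  apply: eq_integral => w _; congr _%:E; rewrite -!mulrA; congr (_ * _)%R.
  by rewrite /e /expsq -!expRD /sqnorm sum3 !YZ; congr expR; ring.
rewrite (@step i0 l (fun w => h w * e i1 w * e i2 w)%R)//; last 2 first.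
- by apply: measurable_funM; [apply: measurable_funM => //|]; exact: me.
- by move=> w; rewrite !mulr_ge0.
transitivity (\int[P]_w (h w * e i2 w * q i0 w * e i1 w)%:E).
  by apply: eq_integral => w _; congr _%:E; rewrite /q; ring.
rewrite (@step i1 l (fun w => h w * e i2 w * q i0 w)%R)//; last 2 first.
- by apply: measurable_funM => //; apply: measurable_funM => //; exact: me.
- by move=> w; rewrite !mulr_ge0.
transitivity (\int[P]_w (h w * q i0 w * q i1 w * e i2 w)%:E).
  by apply: eq_integral => w _; congr _%:E; rewrite /q; ring.
rewrite (@step i2 l (fun w => h w * q i0 w * q i1 w)%R)//; last 2 first.
- by apply: measurable_funM => //; exact: measurable_funM.
- by move=> w; rewrite !mulr_ge0.
apply: eq_integral => w _; congr _%:E.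
rewrite /q /gap /sqnorm sum3 -/(Y i0 w) -/(Y i1 w) -/(Y i2 w).
set c := ((Num.sqrt _)^-1)%R; set l' := (l / _)%R.
have -> : (- (l' * (Y i0 w ^+ 2 + Y i1 w ^+ 2 + Y i2 w ^+ 2)) =
  - (l' * Y i0 w ^+ 2) + - (l' * Y i1 w ^+ 2) + - (l' * Y i2 w ^+ 2))%R by ring.
by rewrite !expRD; ring.
Qed.

Lemma sqnorm_ge0 j w : (0 <= sqnorm j w)%R.
Proof. by apply: sumr_ge0 => i _; exact: sqr_ge0. Qed.

Let measurable_sqnorm j : measurable_fun [set: Omega] (sqnorm j).
Proof. by apply: measurable_sum => i; exact: measurable_funX. Qed.

Let measurable_radius : measurable_fun [set: Omega] radius.
Proof.
apply: measurableT_comp (measurable_sqnorm n).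
exact: continuous_measurable_fun (@sqrt_continuous R).
Qed.

Let mhO : measurable_fun [set: Omega] h.
Proof.
have Gm := other_cylinders_measurable measurable_increments (i0 := last_incr ord0).
exact: (@sub_sigma_measurable _ _ _ Gm _ _ h (@mh ord0)).
Qed.

Let dens2 (z : Omega * R) : R := (h z.1 * bessel_pdf s (radius z.1) z.2)%R.

Let dens2_ge0 z : (0 <= dens2 z)%R.
Proof. by rewrite mulr_ge0// bessel_pdf_ge0// sqrtr_ge0. Qed.

Let measurable_dens2 : measurable_fun [set: Omega * measurableTypeR R] dens2.
Proof.
apply: measurable_funM; first exact: (measurableT_comp mhO).
apply: measurable_bessel_pdf => //.
exact: (measurableT_comp measurable_radius).
Qed.

(** [m1] is the law of the squared norm at the last time under the measure [h P]; [m2] below is the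
    law that the Bessel kernel predicts for it. Both live on the nonnegative half-line. *)
Let m1 := pushforward (density_measure P mhO h0)
  (sqnorm n.+1 : Omega -> measurableTypeR R).
Let measurable_snd2 : measurable_fun [set: Omega * measurableTypeR R]
  (fun z => (z.2 : R) ^+ 2 : measurableTypeR R)%R.
Proof. exact: measurable_funX. Qed.
Let m2 := pushforward (density_measure (P \x mu) measurable_dens2 dens2_ge0)
  (fun z => (z.2 : R) ^+ 2 : measurableTypeR R)%R.

Let integral_m1 (f : R -> \bar R) : measurable_fun [set: R] f ->
  (forall x, 0 <= f x) ->
  \int[m1]_x f x = \int[P]_w (f (sqnorm n.+1 w) * (h w)%:E).
Proof.
move=> mf f0; rewrite ge0_integral_pushforward//; last exact: measurable_sqnorm.
rewrite ge0_integral_density//; last by move=> w; exact: f0.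
exact: (measurableT_comp mf).
Qed.

Let integral_m2 (f : R -> \bar R) : measurable_fun [set: R] f ->
  (forall x, 0 <= f x) ->
  \int[m2]_x f x = \int[P]_w ((h w)%:E *
    \int[mu]_q (f (q ^+ 2)%R * (bessel_pdf s (radius w) q)%:E)).
Proof.
move=> mf f0; rewrite ge0_integral_pushforward//.
rewrite ge0_integral_density//; last 2 first.
- exact: (measurableT_comp mf).
- by move=> z; exact: f0.
rewrite fubini_tonelli1//; last 2 first.
- apply: emeasurable_funM; last exact/measurable_EFinP.
  exact: (measurableT_comp mf).
- by move=> z; apply: mule_ge0; [exact: f0|rewrite lee_fin; exact: dens2_ge0].
apply: eq_integral => w _; rewrite /fubini_F /dens2/=.
under eq_integral do rewrite EFinM muleCA.
rewrite ge0_integralZl ?lee_fin//.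
- apply: emeasurable_funM.
    by apply: (measurableT_comp mf); exact: exprn_measurable.
  by apply/measurable_EFinP; exact: measurable_bessel_pdf.
- by move=> q _; rewrite mule_ge0// lee_fin bessel_pdf_ge0// sqrtr_ge0.
Qed.

(** Markov property without conditional expectations: [h] is any weight that depends on the path up
    to [t n]. The two sides are integrals against [m1] and [m2], whose Laplace transforms agree by
    [laplace] and [has_integral_bessel_laplace]. *)
Theorem bessel_transition (f : R -> \bar R) : measurable_fun [set: R] f ->
  (forall x, 0 <= f x) ->
  \int[P]_w ((h w)%:E * f (\sum_(i < 3) B i (t n.+1) w ^+ 2)%R) =
  \int[P]_w ((h w)%:E * \int[mu]_q (f (q ^+ 2)%R *
    (bessel_pdf s (Num.sqrt (\sum_(i < 3) B i (t n) w ^+ 2)) q)%:E)).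
Proof.
move=> mf f0; rewrite -/(radius _) -integral_m2//.
under eq_integral do rewrite muleC.
rewrite -integral_m1//.
have ms : measurable_fun [set: Omega] (sqnorm n.+1 : Omega -> measurableTypeR R).
  exact: measurable_sqnorm.
apply: eq_measure_integral => A mA _.
have m1T : m1 setT < +oo.
  rewrite /m1 /pushforward preimage_setT.
  apply: (@le_lt_trans _ _ (\int[P]_w 1)).
    by apply: ge0_le_integral => //; [move=> w _; rewrite lee_fin|
      exact/measurable_EFinP|move=> w _; rewrite lee_fin].
  by rewrite integral_cst// mul1e ltey_eq fin_num_measure.
have m10 : m1 `]-oo, 0%R[%classic = 0.
  rewrite /m1 /pushforward (_ : _ @^-1` _ = set0) ?measure0//.
  apply/seteqP; split => // w /=; rewrite in_itv/= ltNge.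
  by rewrite sqnorm_ge0.
have m20 : m2 `]-oo, 0%R[%classic = 0.
  rewrite /m2 /pushforward (_ : _ @^-1` _ = set0) ?measure0//.
  by apply/seteqP; split => // w /=; rewrite in_itv/= ltNge sqr_ge0.
apply: laplace_transform_inj => //.
move=> l l0.
have me : measurable_fun [set: R] (fun x => (expR (- (l * `|x|)))%:E).
  apply/measurable_EFinP; apply: measurableT_comp => //.
  by apply: measurable_funN; apply: measurable_funM => //; exact: normr_measurable.
rewrite integral_m1//.
rewrite integral_m2//.
under eq_integral do rewrite ger0_norm ?sqnorm_ge0// muleC -EFinM.
rewrite laplace//; apply: eq_integral => w _; rewrite EFinM; congr (_ * _).
have [_] := has_integral_bessel_laplace (radius w) s0 l0.
rewrite sqr_sqrtr ?sqnorm_ge0// => <-; apply: eq_integral => q _.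
by rewrite EFinM ger0_norm// sqr_ge0.
Qed.

End bessel_transition.

(** * The image function: symmetries and growth *)

Section image_function.
Context {R : realType}.
Implicit Types b c z : R.

Definition cell_index c z : R := (Num.floor ((z + c) / (2 * c)))%:~R.

(* Method of images: the odd function that equals z on ]-c, c[ and whose
   Gaussian mean vanishes on the wall, built by reflections at the multiples
   of c and extended by 0 to the odd multiples. *)
Definition image_fun b c z : R :=
  let k := cell_index c z in
  if `|z - 2 * k * c| < c
  then (z - 2 * k * c) * expR (2 * b * k * (z - k * c)) else 0.

Lemma cell_indexE c z (k : int) : 0 < c ->
  - c <= z - 2 * k%:~R * c < c -> cell_index c z = k%:~R.
Proof.
move=> c0 /andP[h1 h2]; rewrite /cell_index (@floor_def _ _ k)//.
rewrite ler_pdivlMr ?mulr_gt0// ltr_pdivrMr ?mulr_gt0// intrD.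
by apply/andP; split; lra.
Qed.

Lemma image_fun_cell b c z (k : int) : `|z - 2 * k%:~R * c| < c ->
  image_fun b c z =
    (z - 2 * k%:~R * c) * expR (2 * b * k%:~R * (z - k%:~R * c)).
Proof.
move=> zk; have c0 : 0 < c by exact: le_lt_trans zk.
have kE : cell_index c z = k%:~R.
  by apply: cell_indexE => //; move: zk; rewrite ltr_norml => /andP[/ltW -> ->].
by rewrite /image_fun kE zk.
Qed.

Lemma image_fun_wall b c (k : int) : 0 < c ->
  image_fun b c ((2 * k%:~R - 1) * c) = 0.
Proof.
move=> c0; rewrite /image_fun (@cell_indexE _ _ k)//; last first.
  by apply/andP; split; lra.
have -> : (2 * k%:~R - 1) * c - 2 * k%:~R * c = - c by ring.
by rewrite normrN gtr0_norm// ltxx.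
Qed.

Lemma cellP c z : 0 < c ->
  {k : int | `|z - 2 * k%:~R * c| < c} + {k : int | z = (2 * k%:~R - 1) * c}.
Proof.
move=> c0; pose k := Num.floor ((z + c) / (2 * c)).
have := floor_itv ((z + c) / (2 * c)); rewrite -/k.
rewrite ler_pdivlMr ?mulr_gt0// ltr_pdivrMr ?mulr_gt0// intrD => /andP[h1 h2].
have [e|ne] := eqVneq z ((2 * k%:~R - 1) * c); [by right; exists k|left].
exists k; rewrite ltr_norml; apply/andP; split; last by lra.
have : z != (2 * k%:~R - 1) * c by [].
by rewrite neq_lt => /orP[]; lra.
Qed.

Lemma image_fun_id b c z : `|z| < c -> image_fun b c z = z.
Proof.
move=> zc; rewrite (@image_fun_cell _ _ _ 0) mulr0z mulr0 mul0r subr0//.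
by rewrite mulr0 mul0r expR0 mulr1.
Qed.

Lemma image_funN b c z : 0 < c -> image_fun b c (- z) = - image_fun b c z.
Proof.
move=> c0; have [[k zk]|[k ->]] := cellP z c0.
  have zk' : `|- z - 2 * (- k)%:~R * c| < c.
    rewrite (_ : - z - _ = - (z - 2 * k%:~R * c)) ?normrN// intrN; ring.
  rewrite (image_fun_cell _ zk) (image_fun_cell _ zk') intrN.
  by rewrite -[RHS]mulNr; congr (_ * expR _); ring.
have -> : - ((2 * k%:~R - 1) * c) = (2 * (1 - k)%:~R - 1) * c.
  by rewrite intrB; ring.
by rewrite !image_fun_wall// oppr0.
Qed.

(** The reflection sends cell [k] to cell [1 - k]. This rule and oddness force the formula: together
    they give [G (z + 2c) = exp(2b (c + z)) G z], and [k] iterations from the central cell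
    accumulate the exponent [2 b k (z - k c)]. *)
Lemma image_fun_reflect b c z : 0 < c ->
  image_fun b c (2 * c - z) = - (expR (2 * b * (c - z)) * image_fun b c z).
Proof.
move=> c0; have [[k zk]|[k ->]] := cellP z c0.
  have zk' : `|2 * c - z - 2 * (1 - k)%:~R * c| < c.
    rewrite (_ : 2 * c - z - _ = - (z - 2 * k%:~R * c)) ?normrN// intrB; ring.
  rewrite (image_fun_cell _ zk) (image_fun_cell _ zk') intrB.
  have swap (x y w : R) : - (x * (y * w)) = - y * (x * w) by ring.
  by rewrite [RHS]swap -expRD; congr (_ * expR _); ring.
have -> : 2 * c - (2 * k%:~R - 1) * c = (2 * (2 - k)%:~R - 1) * c.
  by rewrite intrB; ring.
by rewrite !image_fun_wall// mulr0 oppr0.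
Qed.

(* On the k-th cell, with y = z - 2kc, [4 c k (z - k c) = z ^+ 2 - y ^+ 2]. *)
Lemma image_fun_bound b c z : 0 < c ->
  `|image_fun b c z| <= c * expR (Num.max b 0 / (2 * c) * z ^+ 2).
Proof.
move=> c0; have [[k zk]|[k ->]] := cellP z c0; last first.
  by rewrite image_fun_wall// normr0 mulr_ge0 ?expR_ge0// ltW.
rewrite (image_fun_cell _ zk) normrM (ger0_norm (expR_ge0 _)).
apply: ler_pM => //; [exact: ltW|].
rewrite ler_expR; set K : R := k%:~R; set y := z - 2 * K * c.
have e : 4 * c * (K * (z - K * c)) = z ^+ 2 - y ^+ 2 by rewrite /y; ring.
have b0 : 0 <= Num.max b 0 by rewrite le_max lexx orbT.
(* [z - K c = K c + y] with [|y| < c], so it has the sign of [K] unless [K = 0]. Hence replacing [b]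
   by its positive part can only increase the exponent. *)
have pos : 0 <= K * (z - K * c).
  move: zk; rewrite -/K -/y ltr_norml => /andP[y1 y2].
  have -> : z - K * c = K * c + y by rewrite /y; ring.
  have [k1|k0] := leP 1 k.
    have K1 : 1 <= K by rewrite /K -[1](mulr1z 1) ler_int.
    have : c <= K * c by rewrite ler_peMl// ltW.
    by move=> h; rewrite mulr_ge0//; [lra|lra].
  have [ke|kn0] := eqVneq k 0; first by rewrite /K ke mul0r.
  have K1 : K <= -1.
    rewrite /K (_ : -1 = (-1)%:~R)// ler_int.
    by move: k0 kn0; lia.
  have : c <= - K * c by apply: ler_peMl; [exact: ltW|lra].
  by move=> h; rewrite mulr_le0//; lra.
apply: (@le_trans _ _ (2 * Num.max b 0 * (K * (z - K * c)))).
  rewrite -!mulrA ler_pM2l// mulrA -mulrA ler_wpM2r// le_max lexx//.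
have -> : Num.max b 0 / (2 * c) * z ^+ 2 = 2 * Num.max b 0 * (z ^+ 2 / (4 * c)).
  by field; rewrite gt_eqF.
rewrite ler_wpM2l ?mulr_ge0// ler_pdivlMr ?mulr_gt0//.
by rewrite mulrC e gerBl sqr_ge0.
Qed.

Lemma measurable_image_fun b c : 0 < c -> measurable_fun [set: R] (image_fun b c).
Proof.
move=> c0; have mk : measurable_fun [set: R] (cell_index c).
  apply: nondecreasing_measurable => // x y xy.
  by rewrite ler_int le_floor// ler_pM2r ?invr_gt0 ?mulr_gt0// lerD2r.
have mz : measurable_fun [set: R] (fun z => z - 2 * cell_index c z * c).
  by apply: measurable_funB => //; do 2 apply: measurable_funM => //.
apply: measurable_fun_ifT => //.
- by apply: measurable_fun_ltr => //; exact: measurableT_comp.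
- apply: measurable_funM => //; apply: measurableT_comp => //.
  apply: measurable_funM; first exact: measurable_funM.
  by apply: measurable_funB => //; exact: measurable_funM.
Qed.

End image_function.

(** * Gaussian means of the image function *)

Section image_mean.
Context {R : realType}.
Notation mu := (@lebesgue_measure R).
Variables (b c u : R).
Hypothesis c0 : 0 < c.
Hypothesis u0 : 0 < u.
Hypothesis bu : Num.max b 0 * u < c.
Implicit Types s r q z : R.

Local Notation G := (image_fun b c).

Definition image_mean s r : R := \int[mu]_z (G z * gaussian s r z).

(** The Gaussian decay rate for variance [u] minus the growth rate of the image function in
    [image_fun_bound]; it is positive precisely because [Num.max b 0 * u < c]. *)
Definition image_decay : R := (2 * u)^-1 - Num.max b 0 / (2 * c).

Lemma image_decay_gt0 : 0 < image_decay.
Proof.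
rewrite subr_gt0 ltr_pdivrMr ?mulr_gt0// ltr_pdivlMl ?mulr_gt0//.
by rewrite -mulrA ltr_pM2l// mulrC.
Qed.

Lemma image_gaussian_bound s r (rho : R) z : 0 < s -> s <= u -> `|r| <= rho ->
  `|G z * gaussian s r z| <= c * (Num.sqrt (2 * pi * s))^-1 *
    expR (rho / u * `|z| - image_decay * z ^+ 2).
Proof.
move=> s0 su rrho; rewrite normrM (ger0_norm (gaussian_ge0 _ _ _)).
apply: le_trans (ler_pM _ _ (image_fun_bound b z c0) (gaussian_le z s0 su rrho)) _ => //.
  exact: gaussian_ge0.
rewrite mulrACA -expRD ler_wpM2l ?ler_expR//.
  by rewrite mulr_ge0 ?(ltW c0)// invr_ge0.
by rewrite /image_decay mulrBl; lra.
Qed.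

Let mG := @measurable_image_fun R b c c0.

Lemma measurable_image_gaussian s r :
  measurable_fun [set: R] (fun z => G z * gaussian s r z).
Proof. by apply: measurable_funM => //; exact: measurable_gaussian. Qed.

Lemma integrable_image_gaussian s r : 0 < s -> s <= u ->
  mu.-integrable [set: R] (EFin \o (fun z => G z * gaussian s r z)).
Proof.
move=> s0 su; apply: (integrable_gauss_bound _ image_decay_gt0).
  exact: measurable_image_gaussian.
by move=> z; exact: (image_gaussian_bound z s0 su (lexx _)).
Qed.

Lemma integrable_id_image_gaussian s r : 0 < s -> s <= u ->
  mu.-integrable [set: R] (EFin \o (fun z => z * (G z * gaussian s r z))).
Proof.
move=> s0 su.
apply: (@integrable_gauss_bound _ _ (c * (Num.sqrt (2 * pi * s))^-1)
  (1 + `|r| / u) _ _ image_decay_gt0).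
  by apply: measurable_funM => //; exact: measurable_image_gaussian.
move=> z; rewrite normrM.
apply: le_trans (ler_pM _ _ (norm_le_expR z)
  (image_gaussian_bound z s0 su (lexx `|r|))) _ => //.
rewrite (_ : (1 + `|r| / u) * `|z| - image_decay * z ^+ 2 =
  `|z| + (`|r| / u * `|z| - image_decay * z ^+ 2)); last by ring.
by rewrite mulrCA -expRD.
Qed.

Lemma has_integral_image_mean s r : 0 < s -> s <= u ->
  has_integral (fun z => G z * gaussian s r z) (image_mean s r).
Proof. by move=> s0 su; apply: has_integral_Rintegral; exact: integrable_image_gaussian. Qed.

(** For the mean [c - b s] the Gaussian densities at [z] and [2 c - z] differ by the factor that
    [image_fun_reflect] produces, so the integrand is antisymmetric about [c]. With [s = u - t] this
    mean is the height [a + b t] of the line. *)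
Lemma image_mean_wall s : 0 < s -> s <= u -> image_mean s (c - b * s) = 0.
Proof.
move=> s0 su; have h := has_integral_image_mean (c - b * s) s0 su.
have h' := has_integral_reflect (2 * c) h.
have {}h' : has_integral (fun z => -1 * (G z * gaussian s (c - b * s) z))
    (image_mean s (c - b * s)).
  apply: has_integral_ext h' => z; rewrite image_fun_reflect// !gaussianE//.
  rewrite (_ : - ((z - (c - b * s)) ^+ 2 / (2 * s)) =
    2 * b * (c - z) + - ((2 * c - z - (c - b * s)) ^+ 2 / (2 * s))).
    by rewrite expRD; ring.
  by field; rewrite gt_eqF.
have := has_integral_RintegralE h'.
by rewrite (has_integral_RintegralE (has_integralZ (-1) h)); lra.
Qed.

Lemma image_meanN s r : 0 < s -> s <= u -> image_mean s (- r) = - image_mean s r.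
Proof.
move=> s0 su; have h := has_integral_reflect 0 (has_integral_image_mean r s0 su).
have {}h := has_integralZ (-1) h; rewrite -[RHS]mulN1r.
apply: has_integral_RintegralE; apply: has_integral_ext h => z.
by rewrite sub0r image_funN// gaussianN//; ring.
Qed.

Lemma cvg_gaussian (s_ r_ : nat -> R) s r z : 0 < s ->
  s_ n @[n --> \oo] --> s -> r_ n @[n --> \oo] --> r ->
  (forall n, 0 < s_ n) ->
  gaussian (s_ n) (r_ n) z @[n --> \oo] --> gaussian s r z.
Proof.
move=> s0 cs cr sn0; rewrite gaussianE//.
under eq_fun do rewrite gaussianE//.
have p0 : 0 < 2 * pi * s by rewrite !mulr_gt0// pi_gt0.
apply: cvgM.
  apply: cvgV; first by rewrite gt_eqF// sqrtr_gt0.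
  apply: (cvg_comp (fun n => 2 * pi * s_ n) Num.sqrt); last exact: sqrt_continuous.
  by apply: cvgM => //; exact: cvg_cst.
apply: (cvg_comp (fun n => - ((z - r_ n) ^+ 2 / (2 * s_ n))) expR); last first.
  exact: continuous_expR.
apply: cvgN; apply: cvgM.
  apply: (cvg_comp (fun n => z - r_ n) (fun x => x ^+ 2)); last exact: exprn_continuous.
  by apply: cvgB => //; exact: cvg_cst.
apply: cvgV; first by rewrite gt_eqF// mulr_gt0.
by apply: cvgM => //; exact: cvg_cst.
Qed.

(** From some index on, [s / 2 < s_ n <= u] and [|r_ n| <= |r| + 1], and one Gaussian bound
    dominates all the integrands. The lower bound [s / 2] keeps the normalising constants bounded,
    so the argument stops short of [s = 0]. *)
Lemma cvg_image_mean (s_ r_ : nat -> R) s r : 0 < s ->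
  s_ n @[n --> \oo] --> s -> r_ n @[n --> \oo] --> r ->
  (\forall n \near \oo, s_ n <= u) -> s <= u ->
  image_mean (s_ n) (r_ n) @[n --> \oo] --> image_mean s r.
Proof.
move=> s0 cs cr snu su.
have s2 : s / 2 < s by rewrite ltr_pdivrMr//; lra.
have sn_near : \forall n \near \oo, s / 2 < s_ n by exact: (cvgr_gt _ cs).
have rn_near : \forall n \near \oo, `|r_ n| <= `|r| + 1.
  by apply: (cvgr_norm_le _ cr); rewrite ltrDl.
have [N _ hN] : \forall n \near \oo, [/\ s / 2 < s_ n, `|r_ n| <= `|r| + 1 & s_ n <= u].
  by near=> n; split; near: n.
rewrite -(cvg_shiftn N); set s' := fun n => s_ (n + N)%N; set r' := fun n => r_ (n + N)%N.
have {}hN n : [/\ s / 2 < s' n, `|r' n| <= `|r| + 1 & s' n <= u].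
  by apply: hN => /=; exact: leq_addl.
have {}cs : s' n @[n --> \oo] --> s by rewrite /s' cvg_shiftn.
have {}cr : r' n @[n --> \oo] --> r by rewrite /r' cvg_shiftn.
have s'0 n : 0 < s' n by have [+ _ _] := hN n; apply: lt_trans; rewrite divr_gt0.
pose K := c * (Num.sqrt (2 * pi * (s / 2)))^-1.
pose rho := `|r| + 1.
pose dom z := K * expR (rho / u * `|z| - image_decay * z ^+ 2).
have idom : mu.-integrable [set: R] (EFin \o dom).
  apply: (@integrable_gauss_bound _ _ K (rho / u) _ _ image_decay_gt0); last first.
    move=> z; rewrite ger0_norm//.
    by rewrite mulr_ge0 ?expR_ge0// mulr_ge0 ?(ltW c0)// invr_ge0.
  apply: measurable_funM => //; apply: measurableT_comp => //.
  apply: measurable_funB; apply: measurable_funM => //.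
have : (\int[mu]_z (G z * gaussian (s' n) (r' n) z)%:E)%E @[n --> \oo] -->
    (\int[mu]_z (G z * gaussian s r z)%:E)%E.
  apply: (@dominated_cvg _ _ _ mu setT measurableT
    (fun n z => (G z * gaussian (s' n) (r' n) z)%:E) _ (EFin \o dom)) => //.
  - by move=> n; apply/measurable_EFinP; exact: measurable_image_gaussian.
  - move=> z _; apply: cvg_EFin; first exact: nearW.
    by apply: cvgM; [exact: cvg_cst|exact: cvg_gaussian].
  - move=> n z _; rewrite /= lee_fin; have [h1 h2 h3] := hN n.
    apply: le_trans (image_gaussian_bound z (s'0 n) h3 h2) _.
    rewrite ler_wpM2r ?expR_ge0// ler_wpM2l ?(ltW c0)//.
    rewrite lef_pV2 ?posrE ?sqrtr_gt0 ?mulr_gt0 ?pi_gt0 ?divr_gt0//.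
    by rewrite ler_wsqrtr// ler_pM2l ?mulr_gt0 ?pi_gt0// ltW.
have [_ ->] := has_integral_image_mean r s0 su.
by move=> /fine_cvg.
Unshelve. all: end_near. Qed.

Lemma measurable_image_mean s : 0 < s -> s <= u ->
  measurable_fun [set: R] (image_mean s).
Proof.
move=> s0 su; apply: continuous_measurable_fun => r.
apply/(@cvg_nbhsP _ R^o) => r_ cr; apply: cvg_image_mean => //.
  exact: cvg_cst.
exact: nearW.
Qed.

(** The value at 0 is set by hand, since division by 0 would give 0 where the continuous extension
    is 1. *)
Definition radial_fun q : R := if q == 0 then 1 else G q / q.

Lemma radial_fun1 q : `|q| < c -> radial_fun q = 1.
Proof.
rewrite /radial_fun; case: eqVneq => // q0 qc.
by rewrite image_fun_id// divff.
Qed.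

Lemma radial_funN q : radial_fun (- q) = radial_fun q.
Proof.
rewrite /radial_fun oppr_eq0; case: ifPn => // q0.
by rewrite image_funN// invrN mulrNN.
Qed.

Lemma radial_fun_norm q : radial_fun `|q| = radial_fun q.
Proof. by case: (ger0P q) => // _; rewrite radial_funN. Qed.

Lemma mul_radial_fun q : q * radial_fun q = G q.
Proof.
rewrite /radial_fun; case: eqVneq => [->|q0]; last by rewrite mulrC divfK.
by rewrite image_fun_id ?normr0// mul0r.
Qed.

Lemma measurable_radial_fun : measurable_fun [set: R] radial_fun.
Proof.
apply: measurable_fun_ifT => //.
  exact: measurable_fun_eqr.
apply: measurable_funM => //; exact: measurable_invr.
Qed.

(** The factor [q] of the kernel turns [radial_fun] into the odd image function, and by oddness the
    two Gaussian means add up instead of cancelling. *)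
Lemma has_integral_radial_bessel s r : 0 < s -> s <= u -> r != 0 ->
  has_integral (fun q => radial_fun q * bessel_pdf s r q) (image_mean s r / r).
Proof.
move=> s0 su r0; rewrite /bessel_pdf (negbTE r0).
have h := has_integralZ (2 * r)^-1 (has_integralB
  (has_integral_image_mean r s0 su) (has_integral_image_mean (- r) s0 su)).
apply: has_integral_eq (has_integral_ext _ h).
  by rewrite image_meanN//; field.
by move=> q; rewrite -mul_radial_fun; ring.
Qed.

Lemma has_integral_radial_bessel0 : has_integral
  (fun q => radial_fun q * bessel_pdf u 0 q)
  (\int[mu]_q (G q * (q / u * gaussian u 0 q))).
Proof.
have hi : mu.-integrable [set: R] (EFin \o (fun q => G q * (q / u * gaussian u 0 q))).
  have [+ _] := has_integralZ u^-1 (has_integral_Rintegral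
    (integrable_id_image_gaussian 0 u0 (lexx u))).
  by apply: eq_integrable => // q _ /=; congr _%:E; ring.
apply: has_integral_ext (has_integral_Rintegral hi) => q.
by rewrite /bessel_pdf eqxx -mul_radial_fun; ring.
Qed.

End image_mean.

(** * First exits on refining dyadic grids *)

Section dyadic_crossing.
Context {R : realType}.

Definition exit_at (v : nat -> R) (j : nat) : bool :=
  [forall i : 'I_j, v i < 0] && (0 <= v j).

Lemma exit_atP (v : nat -> R) (j : nat) :
  reflect ((forall i, (i < j)%N -> v i < 0) /\ 0 <= v j) (exit_at v j).
Proof.
apply: (iffP andP) => [[/forallP h ?]|[h ?]]; split => //.
  by move=> i ij; have := h (Ordinal ij).
by apply/forallP => i; exact: h.
Qed.

Lemma exit_at_inj (v : nat -> R) (i j : nat) :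
  exit_at v i -> exit_at v j -> i = j.
Proof.
move=> /exit_atP[hi vi] /exit_atP[hj vj].
have [ij|ji|//] := ltngtP i j.
  by have := hj _ ij; rewrite ltNge vi.
by have := hi _ ji; rewrite ltNge vj.
Qed.

Lemma exists_exit_at (v : nat -> R) (N : nat) : 0 <= v N ->
  exists2 e, (e <= N)%N & exit_at v e.
Proof.
move=> vN; have ex : exists n, 0 <= v n by exists N.
exists (ex_minn ex); case: ex_minnP => m vm mmin; first exact: mmin.
apply/exit_atP; split => // i im; rewrite ltNge; apply/negP => /mmin.
by rewrite leqNgt im.
Qed.

Definition dyadic (u : R) (M i : nat) : R := u * i%:R / (2 ^ M)%:R.

Lemma dyadic_ge0 u M i : 0 <= u -> 0 <= dyadic u M i.
Proof. by move=> u0; rewrite /dyadic divr_ge0 ?mulr_ge0. Qed.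

Lemma dyadic_mul u M k i : dyadic u (M + k) (i * 2 ^ k) = dyadic u M i.
Proof.
rewrite /dyadic expnD !natrM invfM mulrA mulrACA -!mulrA.
by rewrite divff ?mulr1// pnatr_eq0 expn_eq0.
Qed.

Lemma dyadic_max u M : dyadic u M (2 ^ M) = u.
Proof. by rewrite /dyadic mulfK// pnatr_eq0 expn_eq0. Qed.

Lemma ler_dyadic u M i j : 0 <= u -> (i <= j)%N -> dyadic u M i <= dyadic u M j.
Proof. by move=> u0 ij; rewrite ler_wpM2r// ler_wpM2l// ler_nat. Qed.

Lemma ltr_dyadic u M i j : 0 < u -> (i < j)%N -> dyadic u M i < dyadic u M j.
Proof.
by move=> u0 ij; rewrite ltr_pM2r ?invr_gt0 ?ltr0n ?expn_gt0// ltr_pM2l// ltr_nat.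
Qed.

Lemma dyadic_le u M i : 0 <= u -> (i <= 2 ^ M)%N -> dyadic u M i <= u.
Proof. by move=> u0 iM; rewrite -[leRHS](dyadic_max u M) ler_dyadic. Qed.

Lemma cvg_pow2V u : (u / (2 ^ M)%:R) @[M --> \oo] --> (0 : R).
Proof.
have -> : (fun M => u / (2 ^ M)%:R) = geometric u 2^-1 :> (nat -> R).
  by apply/funext => M; rewrite /geometric /= natrX exprVn.
by apply: cvg_geometric; rewrite ger0_norm// invf_lt1// ltr1n.
Qed.

Lemma cvg_ge (v : nat -> R) (x l : R) :
  v n @[n --> \oo] --> l -> (forall n, x <= v n) -> x <= l.
Proof.
move=> vl xv; rewrite -(cvg_lim (@Rhausdorff R) vl); apply: limr_ge.
  by apply/cvg_ex; exists l.
exact: nearW.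
Qed.

Lemma cvg_le (v : nat -> R) (x l : R) :
  v n @[n --> \oo] --> l -> (forall n, v n <= x) -> l <= x.
Proof.
move=> /cvgN vl xv; rewrite -lerN2; apply: (cvg_ge vl) => n.
by rewrite lerN2.
Qed.

(** The first exits decrease under refinement and have a limit. There [g >= 0] by continuity, and
    [g <= 0] because [g] is negative one grid step before each exit. *)
Lemma dyadic_crossing (g : R -> R) (u : R) (M0 j0 : nat) : 0 < u ->
  continuous g -> g 0 < 0 -> (j0 <= 2 ^ M0)%N -> 0 <= g (dyadic u M0 j0) ->
  exists (e : nat -> nat) (sigma : R),
    [/\ forall M, (M0 <= M)%N ->
          (e M <= 2 ^ M)%N /\ exit_at (fun i => g (dyadic u M i)) (e M),
        0 < sigma <= u, g sigma = 0 &
        dyadic u M (e M) @[M --> \oo] --> sigma].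
Proof.
move=> u0 cg g0 j0M gj0.
have hex M : exists k, (M0 <= M)%N ->
    (k <= 2 ^ M)%N /\ exit_at (fun i => g (dyadic u M i)) k.
  have [M0M|//] := leqP M0 M; last by exists 0%N.
  have : 0 <= g (dyadic u M (j0 * 2 ^ (M - M0))%N).
    by rewrite -[X in dyadic u X](subnKC M0M) dyadic_mul.
  move=> /(exists_exit_at (v := fun i => g (dyadic u M i)))[k kj kex].
  exists k => _; split => //; rewrite (leq_trans kj)//.
  by rewrite -[X in (_ <= 2 ^ X)%N](subnKC M0M) expnD leq_mul2r j0M orbT.
have {hex}[e he] := choice hex; exists e.
pose a M := dyadic u (M + M0) (e (M + M0)%N).
have heM M := he (M + M0)%N (leq_addl _ _).
(* The finer grid contains the previous exit point, with doubled index, so its own first exit cannot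
   come later. *)
have a_ni : nonincreasing_seq a.
  apply/nonincreasing_seqP => M; rewrite /a addSn.
  have [_ ex0] := heM M; have [_ ex1] := heM M.+1; rewrite addSn in ex1.
  have /exit_atP[_ g1] := ex0.
  rewrite -(dyadic_mul u (M + M0) 1) addn1; apply: ler_dyadic; first exact: ltW.
  rewrite leqNgt; apply/negP => lt; have /exit_atP[/(_ _ lt)] := ex1.
  by rewrite -[(M + M0).+1]addn1 dyadic_mul ltNge g1.
have a_ge0 M : 0 <= a M by apply: dyadic_ge0; exact: ltW.
have a_le M : a M <= u by apply: dyadic_le; [exact: ltW|case: (heM M)].
have a_cvg : cvgn a.
  by apply: nonincreasing_is_cvgn => //; exists 0 => _ [M _ <-].
set sigma := limn a in a_cvg.
have ga : g (a M) @[M --> \oo] --> g sigma by apply: (cvg_comp _ _ a_cvg); exact: cg.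
have gsig0 : 0 <= g sigma.
  by apply: (cvg_ge ga) => M; have [_ /exit_atP[]] := heM M.
(* The grid point just before the exit; it exists because [g 0 < 0] excludes an exit at index 0. *)
pose a' M := a M - u / (2 ^ (M + M0))%:R.
have a'_cvg : a' M @[M --> \oo] --> sigma.
  rewrite -[sigma]subr0; apply: cvgB => //.
  by rewrite (cvg_shiftn M0 (fun M => u / (2 ^ M)%:R)); exact: cvg_pow2V.
have ga' : g (a' M) @[M --> \oo] --> g sigma.
  by apply: (cvg_comp _ _ a'_cvg); exact: cg.
have gsig0' : g sigma <= 0.
  apply: (cvg_le ga') => M; have [_ /exit_atP[h1 h2]] := heM M.
  rewrite /a' /a; case E : (e (M + M0)%N) => [|k].
    move: h2; rewrite E /dyadic mulr0 mul0r => /(lt_le_trans g0).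
    by rewrite ltxx.
  have -> : dyadic u (M + M0) k.+1 - u / (2 ^ (M + M0))%:R = dyadic u (M + M0) k.
    by rewrite /dyadic -mulrBl -natr1 mulrDr mulr1 addrK.
  by apply/ltW/h1; rewrite E.
have gsig : g sigma = 0 by apply/le_anti/andP.
have sig_ge0 : 0 <= sigma by exact: cvg_ge a_cvg a_ge0.
exists sigma; split => //.
- apply/andP; split; last by exact: cvg_le a_cvg a_le.
  rewrite lt_neqAle sig_ge0 andbT; apply/eqP => s0.
  by move: g0; rewrite [X in g X]s0 gsig ltxx.
- by rewrite -(cvg_shiftn M0); exact: a_cvg.
Qed.

End dyadic_crossing.

Section clamp.
Context {R : realType}.

Lemma clamp_subproof (x : R) : Num.max x 0 \in (`[0, +oo[%classic : set R).
Proof. by rewrite inE/= in_itv/= andbT le_max lexx orbT. Qed.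

(** Composition with it extends a path by a constant to negative times, so that continuity and the
    intermediate value theorem can be used on the real line. *)
Definition clamp (x : R) : halfline R := exist _ (Num.max x 0) (clamp_subproof x).

Lemma val_clamp (x : R) : 0 <= x -> \val (clamp x) = x.
Proof. by move=> x0; rewrite /= max_l. Qed.

Lemma clampK (t : halfline R) : clamp (\val t) = t.
Proof.
apply: val_inj; rewrite val_clamp//.
by have := valP t; rewrite inE/= in_itv/= andbT.
Qed.

Lemma continuous_clamp : continuous (clamp : R -> halfline R).
Proof.
apply: continuous_comp_initial.
have -> : \val \o clamp = (fun x : R^o => x) \max (fun=> 0) by [].
by move=> x; apply: continuous_max; [exact: cvg_id|exact: cvg_cst].
Qed.

End clamp.

Section positive_negative_parts.
Context {R : realType}.
Notation mu := (@lebesgue_measure R).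

Lemma posnegE (x : R) : Num.max x 0 = Num.max (- x) 0 + x.
Proof. by case: (leP x 0); case: (leP (- x) 0); lra. Qed.

Lemma norm_posneg (x : R) : `|x| = Num.max x 0 + Num.max (- x) 0.
Proof. by case: (ler0P x); case: (leP x 0); case: (leP (- x) 0); lra. Qed.

(** The transition formula accepts only nonnegative functions, whereas [radial_fun] changes sign. A
    signed mean [v] is rewritten as an identity between integrals of the two parts. *)
Lemma integral_posneg (F k : R -> R) (v : R) :
  measurable_fun [set: R] F -> measurable_fun [set: R] k -> (forall q, 0 <= k q) ->
  has_integral (fun q => F q * k q) v ->
  mu.-integrable [set: R] (EFin \o (fun q => Num.max (- F q) 0 * k q)) /\
  (\int[mu]_q (Num.max (F q) 0 * k q)%:E =
   \int[mu]_q (Num.max (- F q) 0 * k q)%:E + v%:E)%E.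
Proof.
move=> mF mk k0 [Fi Fv].
have ni : mu.-integrable [set: R] (EFin \o (fun q => Num.max (- F q) 0 * k q)).
  apply: le_integrable Fi => //.
    apply/measurable_EFinP; apply: measurable_funM => //.
    by apply: measurable_maxr => //; exact: measurable_funN.
  move=> q _ /=; rewrite lee_fin !normrM ler_wpM2r//.
  rewrite [leRHS]norm_posneg ger0_norm ?lerDr le_max lexx ?orbT//.
split => //; rewrite -Fv -integralD_EFin//.
by apply: eq_integral => q _; rewrite -EFinD posnegE mulrDl.
Qed.

End positive_negative_parts.

Section bessel_path.
Context {d} {Omega : measurableType d} {R : realType}.
Variables (P : probability Omega R) (B : 'I_3 -> halfline R -> Omega -> R).
Hypothesis BM : standard_brownian_motion P B.

Definition radius (t : R) (w : Omega) : R :=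
  Num.sqrt (\sum_(i < 3) B i (clamp t) w ^+ 2).

Lemma radius_ge0 t w : 0 <= radius t w.
Proof. exact: sqrtr_ge0. Qed.

Lemma radius0 w : radius 0 w = 0.
Proof.
rewrite /radius big1 ?sqrtr0// => i _.
have [_ B0 _ _ _] := BM; rewrite B0 ?expr0n//.
exact: val_clamp.
Qed.

Lemma continuous_radius w : continuous (fun t => radius t w).
Proof.
have cB i : continuous (fun s => B i (clamp s) w ^+ 2).
  move=> s; apply: (cvg_comp (fun t => B i (clamp t) w) (fun x => x ^+ 2));
    last exact: exprn_continuous.
  apply: (cvg_comp clamp (fun t => B i t w)); first exact: continuous_clamp.
  by have [_ _ + _ _] := BM; exact.
have cs (l : seq 'I_3) : continuous (fun s => \sum_(i <- l) B i (clamp s) w ^+ 2).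
  elim: l => [|i l IH] s.
    by under eq_fun do rewrite big_nil; exact: cvg_cst.
  under eq_fun do rewrite big_cons.
  by apply: cvgD; [exact: cB|exact: IH].
move=> t; apply: (cvg_comp (fun t => \sum_(i < 3) B i (clamp t) w ^+ 2) Num.sqrt).
  exact: cs.
exact: sqrt_continuous.
Qed.

Lemma measurable_fun_radius t : measurable_fun [set: Omega] (radius t).
Proof.
apply: (measurableT_comp (continuous_measurable_fun (@sqrt_continuous R))).
by apply: measurable_sum => i; apply: measurable_funX; have [+ _ _ _ _] := BM; exact.
Qed.

End bessel_path.

(** * Optional stopping at one grid time *)

Section stopping.
Context {d} {Omega : measurableType d} {R : realType}.
Notation mu := (@lebesgue_measure R).
Variables (P : probability Omega R) (B : 'I_3 -> halfline R -> Omega -> R).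
Hypothesis BM : standard_brownian_motion P B.
Variables (a b u : R).
Hypothesis a0 : 0 < a.
Hypothesis u0 : 0 < u.
Hypothesis abu0 : 0 < a + b * u.

Local Notation c := (a + b * u).
Local Notation rad := (radius B).
Local Notation F := (radial_fun b c).
Local Notation W := (image_mean b c).

(** For [b > 0] this is [0 < a], otherwise it is [0 < a + b u]. *)
Lemma max_slope_lt : Num.max b 0 * u < c.
Proof. by case: (leP b 0) => _; rewrite ?mul0r// ltrDr. Qed.

Let bu := max_slope_lt.

Lemma line_gt0 (t : R) : 0 <= t -> t <= u -> 0 < a + b * t.
Proof.
move=> t0 tu; have [b0|b0] := leP 0 b.
  by rewrite ltr_wpDr// mulr_ge0.
by rewrite (lt_le_trans abu0)// lerD2l ler_nM2l.
Qed.

Definition line_gap (t : R) (w : Omega) : R := rad t w - (a + b * t).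

Lemma line_gap0 w : line_gap 0 w < 0.
Proof. by rewrite /line_gap (radius0 BM) mulr0 addr0 sub0r oppr_lt0. Qed.

Lemma continuous_line_gap w : continuous (fun t => line_gap t w).
Proof.
move=> t; apply: cvgB; first exact: (continuous_radius BM).
by apply: cvgD; [exact: cvg_cst|apply: cvgM; [exact: cvg_cst|exact: cvg_id]].
Qed.

Section one_step.
Variables (M j : nat) (e : R).
Hypothesis jM : (j < 2 ^ M)%N.
Hypothesis e0 : 0 < e.

Let tj := dyadic u M j.
Let tj_ge0 : 0 <= tj. Proof. by apply: dyadic_ge0; exact: ltW. Qed.
Let tj_lt : tj < u.
Proof. by rewrite -[ltRHS](dyadic_max u M) ltr_dyadic. Qed.

(** Because of the overshoot [W] need not vanish at the exit. The tolerance is proportional to the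
    radius because the conditional mean of [F] is [W] divided by the radius. *)
Definition good_exit (w : Omega) : bool :=
  exit_at (fun i => line_gap (dyadic u M i) w) j &&
  (`|W (u - tj) (rad tj w)| <= e * rad tj w).

(** The grid is followed up to the exit index and then jumps to [u], so that the last increment
    covers all the remaining time. *)
Let tm (i : nat) : halfline R := if (i <= j)%N then clamp (dyadic u M i) else clamp u.

Let tm_le i : (i <= j)%N -> tm i = clamp (dyadic u M i).
Proof. by rewrite /tm => ->. Qed.

Let tmS : tm j.+1 = clamp u. Proof. by rewrite /tm ltnn. Qed.

Let tm0 : \val (tm 0%N) = 0.
Proof. by rewrite tm_le// val_clamp /dyadic mulr0 mul0r. Qed.

Let tm_nd i : \val (tm i) <= \val (tm i.+1).
Proof.
have val_dy k : \val (clamp (dyadic u M k)) = dyadic u M k.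
  by rewrite val_clamp// dyadic_ge0// ltW.
have [ij|ji] := leqP i.+1 j.
  by rewrite !tm_le ?(ltnW ij)// !val_dy ler_dyadic// ltW.
have -> : tm i.+1 = clamp u by rewrite /tm leqNgt ji.
rewrite (val_clamp (ltW u0)) /tm; case: ifP => ij; last by rewrite (val_clamp (ltW u0)).
rewrite val_dy; apply: dyadic_le; first exact: ltW.
by rewrite (leq_trans ij)// ltnW.
Qed.

Let radE i w : (i <= j)%N ->
  rad (dyadic u M i) w = Num.sqrt (\sum_(k < 3) B k (tm i) w ^+ 2).
Proof. by move=> ij; rewrite tm_le. Qed.

Let measurable_past_radius k i : (i <= j)%N ->
  measurable_fun [set: past B tm j k] (rad (dyadic u M i) : past B tm j k -> R).
Proof.
move=> ij; rewrite (_ : rad _ = fun w => Num.sqrt (\sum_(k < 3) B k (tm i) w ^+ 2)).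
  apply: (measurableT_comp (continuous_measurable_fun (@sqrt_continuous R))).
  apply: measurable_sum => l; apply: measurable_funX.
  exact: (measurable_past BM tm0).
by apply/funext => w; rewrite radE.
Qed.

Let s := u - tj.
Let s0 : 0 < s. Proof. by rewrite subr_gt0. Qed.
Let su : s <= u. Proof. by rewrite /s gerBl. Qed.
Let s_val : \val (tm j.+1) - \val (tm j) = s.
Proof. by rewrite tmS tm_le// !val_clamp// ltW. Qed.

Let h (w : Omega) : R := (good_exit w)%:R.

Let h0 w : 0 <= h w. Proof. exact: ler0n. Qed.
Let h1 w : h w <= 1. Proof. by rewrite /h; case: good_exit; rewrite ?ler01. Qed.

Let measurable_past_h k : measurable_fun [set: past B tm j k] (h : past B tm j k -> R).
Proof.
have mg i : (i <= j)%N -> measurable_fun [set: past B tm j k]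
    (line_gap (dyadic u M i) : past B tm j k -> R).
  by move=> ij; apply: measurable_funB => //; exact: measurable_past_radius.
rewrite (_ : h = fun w => if good_exit w then 1 else 0); last first.
  by apply/funext => w; rewrite /h; case: good_exit.
apply: measurable_fun_ifT => //.
apply: measurable_and.
  apply: measurable_and.
    rewrite (_ : (fun w => [forall i : 'I_j, line_gap (dyadic u M i) w < 0]) =
      (fun w => all (fun i : 'I_j => line_gap (dyadic u M i) w < 0) (enum 'I_j))).
      elim: (enum 'I_j) => [|i l IH] //=.
      apply: measurable_and => //; apply: measurable_fun_ltr => //.
      by apply: mg; exact: ltnW.
    apply/funext => w; apply/forallP/allP => [hw i _|hw i]; first exact: hw.
    by apply: hw; rewrite mem_enum.
  by apply: measurable_fun_ler => //; exact: mg.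
apply: measurable_fun_ler.
  apply: measurableT_comp => //.
  apply: (measurableT_comp (measurable_image_mean abu0 u0 bu s0 su)).
  exact: measurable_past_radius.
by apply: measurable_funM => //; exact: measurable_past_radius.
Qed.

Let measurable_h : measurable_fun [set: Omega] h.
Proof.
have Gm := @other_cylinders_measurable _ _ _ _ _
  (@measurable_increments _ _ _ P B BM tm j) (ord0, ord_max).
exact: (@sub_sigma_measurable _ _ _ Gm _ _ h (@measurable_past_h ord0)).
Qed.

Lemma measurable_good_exit :
  measurable_fun [set: Omega] (fun w => (good_exit w)%:R : R).
Proof. exact: measurable_h. Qed.

Let transition (f : R -> R) : measurable_fun [set: R] f -> (forall q, 0 <= f q) ->
  (forall q, f `|q| = f q) ->
  (\int[P]_w (h w * f (rad u w))%:E =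
   \int[P]_w ((h w)%:E * \int[mu]_q (f q * bessel_pdf s (rad tj w) q)%:E))%E.
Proof.
move=> mf f0 feven.
have mfs : measurable_fun [set: R] (fun x => (f (Num.sqrt x))%:E).
  apply/measurable_EFinP; apply: (measurableT_comp mf).
  exact: continuous_measurable_fun (@sqrt_continuous R).
have fs0 x : (0 <= (f (Num.sqrt x))%:E)%E by rewrite lee_fin.
have sv : 0 < \val (tm j.+1) - \val (tm j) by rewrite s_val.
have := bessel_transition BM tm0 tm_nd sv h0 h1 measurable_past_h mfs fs0.
rewrite s_val tmS tm_le// -/tj => eE.
transitivity (\int[P]_w ((h w)%:E *
    (f (Num.sqrt (\sum_(i < 3) B i (clamp u) w ^+ 2)))%:E))%E.
  by apply: eq_integral => w _; rewrite EFinM.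
rewrite eE; apply: eq_integral => w _; congr (_ * _)%E.
by apply: eq_integral => q _; rewrite sqrtr_sqr feven EFinM.
Qed.

Let K (f : R -> R) (w : Omega) : \bar R := (\int[mu]_q (f q * bessel_pdf s (rad tj w) q)%:E)%E.

Let measurable_K (f : R -> R) : measurable_fun [set: R] f -> (forall q, 0 <= f q) ->
  measurable_fun [set: Omega] (K f).
Proof.
move=> mf f0.
pose g (z : Omega * R) := (f z.2 * bessel_pdf s (rad tj z.1) z.2)%:E.
apply: (@measurable_fun_fubini_tonelli_F _ _ _ _ _ mu g).
  apply/measurable_EFinP; apply: measurable_funM; first exact: (measurableT_comp mf).
  apply: measurable_bessel_pdf => //.
  exact: (measurableT_comp (@measurable_fun_radius _ _ _ P B BM tj)).
by move=> z; rewrite lee_fin mulr_ge0// bessel_pdf_ge0// radius_ge0.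
Qed.

Let K_ge0 (f : R -> R) w : (forall q, 0 <= f q) -> (0 <= K f w)%E.
Proof.
move=> f0; apply: integral_ge0 => q _.
by rewrite lee_fin mulr_ge0// bessel_pdf_ge0// radius_ge0.
Qed.

Let mF := @measurable_radial_fun R b c abu0 : measurable_fun [set: R] F.

Lemma good_exit_radius w : good_exit w -> 0 < rad tj w.
Proof.
move=> /andP[/exit_atP[_]]; rewrite subr_ge0 => h2 _.
by apply: lt_le_trans h2; rewrite line_gt0// ltW.
Qed.

(** On a good exit the kernel mean of [F] has absolute value at most [e]. The inequality between the
    two parts makes sense before [F] is known to be integrable along the path; the two signs [sg]
    give the two sides of the bound. *)
Lemma expectation_good_exit (sg : R) : `|sg| = 1 ->
  (\int[P]_w (h w * Num.max (sg * F (rad u w)) 0)%:E <=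
   \int[P]_w (h w * Num.max (- (sg * F (rad u w))) 0)%:E +
   e%:E * \int[P]_w (h w)%:E)%E.
Proof.
move=> sg1.
have msF : measurable_fun [set: R] (fun q => sg * F q) by exact: measurable_funM.
have mpos : measurable_fun [set: R] (fun q => Num.max (sg * F q) 0).
  exact: measurable_maxr.
have mneg : measurable_fun [set: R] (fun q => Num.max (- (sg * F q)) 0).
  by apply: measurable_maxr => //; exact: measurable_funN.
have pos0 q : 0 <= Num.max (sg * F q) 0 by rewrite le_max lexx orbT.
have neg0 q : 0 <= Num.max (- (sg * F q)) 0 by rewrite le_max lexx orbT.
rewrite (transition mpos)//; last by move=> q; rewrite radial_fun_norm.
rewrite (transition mneg)//; last by move=> q; rewrite radial_fun_norm.
have mh : measurable_fun [set: Omega] (EFin \o h) by exact/measurable_EFinP.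
rewrite -ge0_integralZl_EFin ?(ltW e0)//; last by move=> w _; rewrite lee_fin.
have mKn := measurable_K mneg neg0; have mKp := measurable_K mpos pos0.
rewrite -ge0_integralD//; last 4 first.
- by move=> w _; rewrite mule_ge0 ?lee_fin// K_ge0.
- exact: emeasurable_funM.
- by move=> w _; rewrite -EFinM lee_fin mulr_ge0// ltW.
- exact: measurable_funeM.
apply: ge0_le_integral => //.
- by move=> w _; rewrite mule_ge0 ?lee_fin// K_ge0.
- exact: emeasurable_funM.
- apply: emeasurable_funD; first exact: emeasurable_funM.
  exact: measurable_funeM.
move=> w _; rewrite /h; case gw: (good_exit w); last by rewrite !mul0e mule0 adde0.
rewrite !mul1e mule1.
have r0 := good_exit_radius gw.
have hF := has_integralZ sg (has_integral_radial_bessel abu0 u0 bu s0 su (lt0r_neq0 r0)).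
have {}hF : has_integral (fun q => (sg * F q) * bessel_pdf s (rad tj w) q)
    (sg * (W s (rad tj w) / rad tj w)).
  by apply: has_integral_ext hF => q; rewrite mulrA.
have mk : measurable_fun [set: R] (bessel_pdf s (rad tj w)).
  exact: measurable_bessel_pdf.
have k0 q : 0 <= bessel_pdf s (rad tj w) q by rewrite bessel_pdf_ge0// ltW.
have [_ ->] := integral_posneg msF mk k0 hF.
rewrite leeD2l// lee_fin (le_trans (ler_norm _))// normrM sg1 mul1r normrM.
rewrite normfV (gtr0_norm r0) ler_pdivrMr//.
by have /andP[] := gw.
Qed.

End one_step.
End stopping.

(** * The mean of the radial function at time u *)

Section grid_survival.
Context {d} {Omega : measurableType d} {R : realType}.
Notation mu := (@lebesgue_measure R).
Variables (P : probability Omega R) (B : 'I_3 -> halfline R -> Omega -> R).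
Hypothesis BM : standard_brownian_motion P B.
Variables (a b u : R).
Hypothesis a0 : 0 < a.
Hypothesis u0 : 0 < u.
Hypothesis abu0 : 0 < a + b * u.

Local Notation c := (a + b * u).
Local Notation rad := (radius B).
Local Notation F := (radial_fun b c).
Local Notation W := (image_mean b c).
Local Notation gap := (line_gap B a b).

Let bu := max_slope_lt a0 abu0.
Let mF := @measurable_radial_fun R b c abu0 : measurable_fun [set: R] F.

Definition bessel_image_mean : R :=
  \int[mu]_q (image_fun b c q * (q / u * gaussian u 0 q)).

(** This is [bessel_transition] for the single step from 0 to [u] with weight 1. For an even [f] the
    kernel on the whole line stands for the density of the radius. *)
Lemma radius_law (f : R -> R) : measurable_fun [set: R] f -> (forall q, 0 <= f q) ->
  (forall q, f `|q| = f q) ->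
  (\int[P]_w (f (rad u w))%:E = \int[mu]_q (f q * bessel_pdf u 0 q)%:E)%E.
Proof.
move=> mf f0 feven.
pose tm (i : nat) : halfline R := if i is 0%N then clamp 0 else clamp u.
have v0 : \val (clamp 0 : halfline R) = 0 by exact: val_clamp.
have vu : \val (clamp u : halfline R) = u by apply: val_clamp; exact: ltW.
have tm0 : \val (tm 0%N) = 0 by [].
have tm_nd i : \val (tm i) <= \val (tm i.+1).
  by case: i => [|i]; rewrite /tm ?v0 vu// ltW.
have sE : \val (tm 1%N) - \val (tm 0%N) = u by rewrite /tm v0 vu subr0.
have s0 : 0 < \val (tm 1%N) - \val (tm 0%N) by rewrite sE.
have mfs : measurable_fun [set: R] (fun x => (f (Num.sqrt x))%:E).
  apply/measurable_EFinP; apply: (measurableT_comp mf).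
  exact: continuous_measurable_fun (@sqrt_continuous R).
have fs0 x : (0 <= (f (Num.sqrt x))%:E)%E by rewrite lee_fin.
have mh k : measurable_fun [set: past B tm 0 k] (fun=> 1 : R) by [].
have := bessel_transition (h := fun=> 1) BM tm0 tm_nd s0
  (fun=> ler01) (fun=> lexx 1) mh mfs fs0.
rewrite sE => eE.
transitivity (\int[P]_w (1%:E *
    (f (Num.sqrt (\sum_(i < 3) B i (clamp u) w ^+ 2)))%:E))%E.
  by apply: eq_integral => w _; rewrite mul1e.
rewrite [LHS]eE.
transitivity (\int[P]_w (cst (\int[mu]_q (f q * bessel_pdf u 0 q)%:E)%E w))%E.
  apply: eq_integral => w _; rewrite mul1e.
  apply: eq_integral => q _; rewrite sqrtr_sqr feven EFinM.
  by have := radius0 BM w; rewrite /radius => ->.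
by rewrite integral_cst// [X in (_ * X)%E](@probability_setT _ _ _ P) mule1.
Qed.

Let X w := F (rad u w).

Let mX : measurable_fun [set: Omega] X.
Proof. exact: (measurableT_comp mF (@measurable_fun_radius _ _ _ P B BM u)). Qed.

Let kpos q : 0 <= bessel_pdf u 0 q. Proof. exact: bessel_pdf_ge0. Qed.

Let expectation_radial_aux :
  P.-integrable [set: Omega] (EFin \o X) /\
  (\int[P]_w (X w)%:E = bessel_image_mean%:E)%E.
Proof.
have hF := has_integral_radial_bessel0 abu0 u0 bu.
have mk : measurable_fun [set: R] (bessel_pdf u 0).
  exact: measurable_bessel_pdf.
have [ni pE] := integral_posneg mF mk kpos hF.
have mp : measurable_fun [set: R] (fun q => Num.max (F q) 0) by exact: measurable_maxr.
have mn : measurable_fun [set: R] (fun q => Num.max (- F q) 0).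
  by apply: measurable_maxr => //; exact: measurable_funN.
have p0 q : 0 <= Num.max (F q) 0 by rewrite le_max lexx orbT.
have n0 q : 0 <= Num.max (- F q) 0 by rewrite le_max lexx orbT.
have lp := radius_law mp p0 (fun q => congr1 (Num.max^~ 0) (radial_fun_norm b abu0 q)).
have ln := radius_law mn n0
  (fun q => congr1 (fun x => Num.max (- x) 0) (radial_fun_norm b abu0 q)).
have nfin : (\int[mu]_q (Num.max (- F q) 0 * bessel_pdf u 0 q)%:E)%E \is a fin_num.
  exact (integrable_fin_num measurableT ni).
have pi_ : P.-integrable [set: Omega] (fun w => (Num.max (X w) 0)%:E).
  apply/integrableP; split; first exact/measurable_EFinP/(measurableT_comp mp
    (@measurable_fun_radius _ _ _ P B BM u)).
  under eq_integral do rewrite gee0_abs ?lee_fin ?p0//.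
  by rewrite [ltLHS]lp pE ltey_eq fin_numD nfin.
have ni_ : P.-integrable [set: Omega] (fun w => (Num.max (- X w) 0)%:E).
  apply/integrableP; split; first exact/measurable_EFinP/(measurableT_comp mn
    (@measurable_fun_radius _ _ _ P B BM u)).
  under eq_integral do rewrite gee0_abs ?lee_fin ?n0//.
  by rewrite [ltLHS]ln ltey_eq nfin.
have XE w : (X w)%:E = ((Num.max (X w) 0)%:E - (Num.max (- X w) 0)%:E)%E.
  by rewrite -EFinB posnegE [in RHS]addrAC subrr add0r.
split.
  by apply: eq_integrable (integrableB measurableT pi_ ni_) => // w _; rewrite /= XE.
under eq_integral do rewrite XE.
rewrite integralB_EFin// [X in (X - _)%E]lp [X in (_ - X)%E]ln pE.
by rewrite addeAC subee// add0e.
Qed.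

Lemma integrable_radial : P.-integrable [set: Omega] (EFin \o X).
Proof. by have [] := expectation_radial_aux. Qed.

Lemma expectation_radial : (\int[P]_w (X w)%:E = bessel_image_mean%:E)%E.
Proof. by have [] := expectation_radial_aux. Qed.

Let iX := integrable_radial.

Let integrable_Xmul (h : Omega -> R) : measurable_fun [set: Omega] h ->
  (forall w, `|h w| <= 1) -> P.-integrable [set: Omega] (EFin \o (fun w => h w * X w)).
Proof.
move=> mh h1; apply: le_integrable iX => //.
  exact/measurable_EFinP/measurable_funM.
by move=> w _; rewrite /= lee_fin normrM ler_piMl.
Qed.

Let hM e M j w : R := (good_exit B a b u M j e w)%:R.

Let hM_norm e M j w : `|hM e M j w| <= 1.
Proof. by rewrite /hM; case: good_exit; rewrite ?normr1 ?normr0. Qed.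
Let mhM e M j : (j < 2 ^ M)%N -> measurable_fun [set: Omega] (hM e M j).
Proof. by move=> jM; exact: (measurable_good_exit BM). Qed.

Lemma expectation_good_exit_le e M j : 0 < e -> (j < 2 ^ M)%N ->
  `| \int[P]_w (hM e M j w * X w) | <= e * \int[P]_w hM e M j w.
Proof.
move=> e0 jM; pose h := hM e M j; have mh := mhM e jM.
have ih : P.-integrable [set: Omega] (EFin \o h).
  apply: (@bounded_integrable _ _ _ P _ h 1) => //.
    by rewrite ltey_eq fin_num_measure.
  exact: hM_norm.
have ihX := integrable_Xmul mh (hM_norm e M j).
have hE : (\int[P]_w (h w)%:E = (\int[P]_w h w)%:E)%E.
  by rewrite fineK// integrable_fin_num.
have hXE : (\int[P]_w (h w * X w)%:E = (\int[P]_w (h w * X w))%:E)%E.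
  by rewrite fineK// integrable_fin_num.
have in_ : P.-integrable [set: Omega] (EFin \o (fun w => h w * Num.max (- X w) 0)).
  apply: le_integrable iX => //.
    apply/measurable_EFinP; apply: measurable_funM => //.
    by apply: measurable_maxr => //; exact: measurable_funN.
  move=> w _; rewrite /= lee_fin normrM -[leRHS]mul1r ler_pM//; first exact: hM_norm.
  by rewrite [leRHS]norm_posneg ger0_norm ?lerDr le_max lexx ?orbT.
have nE : (\int[P]_w (h w * Num.max (- X w) 0)%:E =
    (\int[P]_w (h w * Num.max (- X w) 0))%:E)%E.
  by rewrite fineK// integrable_fin_num.
have pE : (\int[P]_w (h w * Num.max (X w) 0)%:E =
    (\int[P]_w (h w * Num.max (- X w) 0) + \int[P]_w (h w * X w))%:E)%E.
  rewrite EFinD -nE -hXE -integralD_EFin//.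
  by apply: eq_integral => w _; rewrite -EFinD posnegE mulrDr.
have e1 : (\int[P]_w (h w * Num.max (X w) 0)%:E <=
    \int[P]_w (h w * Num.max (- X w) 0)%:E + e%:E * \int[P]_w (h w)%:E)%E.
  have := expectation_good_exit BM a0 u0 abu0 jM e0 (normr1 R).
  under eq_integral do rewrite mul1r.
  by under [X in (_ <= X + _)%E -> _]eq_integral do rewrite mul1r.
have e2 : (\int[P]_w (h w * Num.max (- X w) 0)%:E <=
    \int[P]_w (h w * Num.max (X w) 0)%:E + e%:E * \int[P]_w (h w)%:E)%E.
  have N1 : `|-1 : R| = 1 by rewrite normrN normr1.
  have := expectation_good_exit BM a0 u0 abu0 jM e0 N1.
  under eq_integral do rewrite mulN1r.
  by under [X in (_ <= X + _)%E -> _]eq_integral do rewrite mulN1r opprK.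
move: e1 e2; rewrite pE nE hE -!EFinM -!EFinD !lee_fin => e1 e2.
by rewrite ler_norml; apply/andP; split; lra.
Qed.

End grid_survival.

(** * Good and bad exits on a grid *)

Section dyadic_survival.
Context {d} {Omega : measurableType d} {R : realType}.
Notation mu := (@lebesgue_measure R).
Variables (P : probability Omega R) (B : 'I_3 -> halfline R -> Omega -> R).
Hypothesis BM : standard_brownian_motion P B.
Variables (a b u : R).
Hypothesis a0 : 0 < a.
Hypothesis u0 : 0 < u.
Hypothesis abu0 : 0 < a + b * u.

Local Notation c := (a + b * u).
Local Notation rad := (radius B).
Local Notation F := (radial_fun b c).
Local Notation W := (image_mean b c).
Local Notation gap := (line_gap B a b).

Let bu := max_slope_lt a0 abu0.
Let X w := F (rad u w).

Definition below_grid (M : nat) (w : Omega) : bool :=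
  [forall i : 'I_(2 ^ M).+1, gap (dyadic u M i) w < 0].

Lemma below_gridP M w :
  reflect (forall i, (i <= 2 ^ M)%N -> gap (dyadic u M i) w < 0) (below_grid M w).
Proof.
apply: (iffP forallP) => [h i iM|h i]; last by apply: h; rewrite -ltnS.
by have := h (Ordinal (iM : (i < (2 ^ M).+1)%N)).
Qed.

Lemma measurable_below_grid M :
  measurable_fun [set: Omega] (fun w => (below_grid M w)%:R : R).
Proof.
rewrite (_ : (fun w => _) = fun w => if below_grid M w then 1 else 0); last first.
  by apply/funext => w; case: below_grid.
apply: measurable_fun_ifT => //.
rewrite (_ : below_grid M = (fun w =>
    all (fun i : 'I_(2 ^ M).+1 => gap (dyadic u M i) w < 0) (enum 'I_(2 ^ M).+1))).
  elim: (enum _) => [|i l IH] //=.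
  apply: measurable_and => //; apply: measurable_fun_ltr => //.
  by apply: measurable_funB => //; exact: (measurable_fun_radius BM).
apply/funext => w; apply/forallP/allP => [hw i _|hw i]; first exact: hw.
by apply: hw; rewrite mem_enum.
Qed.

Variable e : R.
Hypothesis e0 : 0 < e.

(** The sum stops before the last grid point: at time [u] no time is left, and [image_mean_wall]
    does not apply. An exit there counts as bad. *)
Definition exit_sum (M : nat) (w : Omega) : R :=
  \sum_(j < 2 ^ M) (good_exit B a b u M j e w)%:R.

Lemma exit_sum_unique M w j0 : (j0 < 2 ^ M)%N ->
  exit_at (fun i => gap (dyadic u M i) w) j0 ->
  exit_sum M w = (good_exit B a b u M j0 e w)%:R.
Proof.
move=> j0M ex0; rewrite /exit_sum (bigD1 (Ordinal j0M))//= big1 ?addr0// => j jj0.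
case g : good_exit => //; case/andP: g => exj _.
by move: jj0; rewrite -val_eqE/= (exit_at_inj exj ex0) eqxx.
Qed.

Lemma exit_sum_last M w : exit_at (fun i => gap (dyadic u M i) w) (2 ^ M) ->
  exit_sum M w = 0.
Proof.
move=> ex0; rewrite /exit_sum big1// => j _.
case g : good_exit => //; case/andP: g => exj _.
by have := ltn_ord j; rewrite (exit_at_inj exj ex0) ltnn.
Qed.

Lemma exit_sum_below M w : below_grid M w -> exit_sum M w = 0.
Proof.
move=> /below_gridP bM; rewrite /exit_sum big1// => j _.
case g : good_exit => //; case/andP: g => /exit_atP[_].
by rewrite leNgt bM// ltnW.
Qed.

Lemma not_below_exit M w : ~~ below_grid M w ->
  exists2 j, (j <= 2 ^ M)%N & exit_at (fun i => gap (dyadic u M i) w) j.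
Proof.
rewrite negb_forall => /existsP[i]; rewrite -leNgt.
move=> /(exists_exit_at (v := fun i => gap (dyadic u M i) w))[j ji ex].
by exists j => //; rewrite (leq_trans ji)// -ltnS.
Qed.

Definition bad_exit (M : nat) (w : Omega) : R :=
  1 - (below_grid M w)%:R - exit_sum M w.

Lemma bad_exit_norm M w : `|bad_exit M w| <= 1.
Proof.
rewrite /bad_exit; have [bM|nb] := boolP (below_grid M w).
  by rewrite exit_sum_below// subr0 subrr normr0.
rewrite subr0; have [j jM ex] := not_below_exit nb.
move: jM; rewrite leq_eqVlt => /predU1P[jE|jM].
  by rewrite jE in ex; rewrite exit_sum_last// subr0 normr1.
rewrite (exit_sum_unique jM ex); case: good_exit; rewrite ?subr0 ?subrr ?normr0 ?normr1//.
Qed.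

Lemma below_radial M w : below_grid M w -> X w = 1.
Proof.
move=> /below_gridP /(_ (2 ^ M)%N (leqnn _)); rewrite dyadic_max subr_lt0 => h.
by apply: radial_fun1 => //; rewrite ger0_norm// radius_ge0.
Qed.

Lemma radial_fun_wall : F c = 0.
Proof.
rewrite /radial_fun gt_eqF//.
have -> : image_fun b c c = 0; last by rewrite mul0r.
rewrite -[RHS](image_fun_wall b 1 abu0); congr image_fun.
by rewrite mulr1z; ring.
Qed.

(** If some grid sees an exit, the exit times tend to a time [sg] at which the path is on the line.
    For [sg = u] the factor [X] is [F c = 0]. For [sg < u] continuity makes [W] tend to its value 0
    on the wall while the radius tends to a positive limit, so on fine grids the exit is good. *)
Lemma bad_exit_vanish w : bad_exit M w * X w @[M --> \oo] --> (0 : R).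
Proof.
have [allb|] := pselect (forall M, below_grid M w).
  apply: cvg_near_cst; apply: nearW => M.
  by rewrite /bad_exit allb exit_sum_below// subrr subr0 mul0r.
move=> /existsNP[M0 /negP nb].
have [j0 j0M ex0] := not_below_exit nb; have /exit_atP[_ gj0] := ex0.
have cg : continuous (fun t => gap t w) by exact: (continuous_line_gap BM).
have g0 : gap 0 w < 0 by exact: (line_gap0 BM).
have [ee [sg [hee /andP[sg0 sgu] gsg cvs]]] := dyadic_crossing u0 cg g0 j0M gj0.
have radsg : rad sg w = a + b * sg by apply/eqP; rewrite -subr_eq0; apply/eqP.
have [sgE|sgN] := eqVneq sg u.
  have -> : X w = 0 by rewrite /X -sgE radsg sgE radial_fun_wall.
  by apply: cvg_near_cst; apply: nearW => M; rewrite mulr0.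
have {sgN}sgu : sg < u by rewrite lt_neqAle sgN.
have line0 : 0 < a + b * sg by apply: (line_gt0 (u := u)) => //; exact: ltW.
apply: cvg_near_cst.
have cvr : rad (dyadic u M (ee M)) w @[M --> \oo] --> a + b * sg.
  rewrite -radsg; apply: (cvg_comp _ (fun t => rad t w) cvs).
  exact: (continuous_radius BM).
have cvW : W (u - dyadic u M (ee M)) (rad (dyadic u M (ee M)) w) @[M --> \oo] --> (0 : R).
  have us : u - sg <= u by rewrite gerBl ltW.
  have <- : W (u - sg) (a + b * sg) = 0.
    rewrite -[RHS](image_mean_wall abu0 u0 bu (s := u - sg))// ?subr_gt0//.
    by congr image_mean; ring.
  apply: (cvg_image_mean abu0 u0 bu) => //.
  - by rewrite subr_gt0.
  - by apply: cvgB => //; exact: cvg_cst.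
  - by apply: nearW => M; rewrite gerBl dyadic_ge0// ltW.
near=> M.
have M0M : (M0 <= M)%N by near: M; exists M0.
have [eeM exM] := hee _ M0M.
have dlt : dyadic u M (ee M) < u by near: M; exact: (cvgr_lt _ cvs).
have eeM' : (ee M < 2 ^ M)%N.
  by rewrite ltn_neqAle eeM andbT; apply/eqP => E; move: dlt; rewrite E dyadic_max ltxx.
have nbM : ~~ below_grid M w.
  apply/negP => /below_gridP/(_ _ eeM); have /exit_atP[_] := exM.
  by rewrite leNgt => /negP.
have good : good_exit B a b u M (ee M) e w.
  rewrite /good_exit exM/=.
  have r2 : (a + b * sg) / 2 < rad (dyadic u M (ee M)) w.
    near: M; apply: (cvgr_gt _ cvr).
    by rewrite ltr_pdivrMr// ltr_pMr// ltr1n.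
  have W2 : `|W (u - dyadic u M (ee M)) (rad (dyadic u M (ee M)) w)| <=
      e * ((a + b * sg) / 2).
    near: M; apply: (cvgr_norm_le _ cvW); rewrite normr0.
    by rewrite mulr_gt0// divr_gt0.
  by rewrite (le_trans W2)// ler_pM2l// ltW.
by rewrite /bad_exit (negbTE nbM) (exit_sum_unique eeM' exM) good subr0 subrr mul0r.
Unshelve. all: end_near. Qed.

End dyadic_survival.

Section finite_sums.
Context {d} {T : measurableType d} {R : realType}.
Variable m : {measure set T -> \bar R}.

Lemma Rintegral_sum (I : Type) (s : seq I) (f : I -> T -> R) :
  (forall i, m.-integrable [set: T] (EFin \o f i)) ->
  m.-integrable [set: T] (EFin \o (fun x => \sum_(i <- s) f i x)) /\
  \int[m]_x (\sum_(i <- s) f i x) = \sum_(i <- s) \int[m]_x f i x.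
Proof.
move=> fi; elim: s => [|i s [IHi IHe]].
  split; first by under eq_fun do rewrite big_nil; exact: integrable0.
  by under eq_Rintegral do rewrite big_nil; rewrite Rintegral_cst// mul0r big_nil.
have e x : \sum_(j <- i :: s) f j x = f i x + \sum_(j <- s) f j x by rewrite big_cons.
split.
  by apply: eq_integrable (integrableD measurableT (fi i) IHi) => // x _; rewrite /= e.
under eq_Rintegral do rewrite e.
by rewrite RintegralD// IHe big_cons.
Qed.

End finite_sums.

(** * The probability of staying below the line at all dyadic times *)

Section grid_survival_probability.
Context {d} {Omega : measurableType d} {R : realType}.
Notation mu := (@lebesgue_measure R).
Variables (P : probability Omega R) (B : 'I_3 -> halfline R -> Omega -> R).
Hypothesis BM : standard_brownian_motion P B.
Variables (a b u : R).
Hypothesis a0 : 0 < a.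
Hypothesis u0 : 0 < u.
Hypothesis abu0 : 0 < a + b * u.

Local Notation c := (a + b * u).
Let X w := radial_fun b c (radius B u w).
Let iX : P.-integrable [set: Omega] (EFin \o X) := integrable_radial BM a0 u0 abu0.
Let Pfin : (P [set: Omega] < +oo)%E.
Proof. by rewrite ltey_eq fin_num_measure. Qed.

Local Notation below M := (fun w => (below_grid B a b u M w)%:R : R).

Lemma below_grid_le M N w : (M <= N)%N -> below_grid B a b u N w -> below_grid B a b u M w.
Proof.
move=> MN /below_gridP h; apply/below_gridP => i iM.
rewrite -(dyadic_mul u M (N - M)) subnKC//; apply: h.
by rewrite -[X in (_ <= 2 ^ X)%N](subnKC MN) expnD leq_mul2r iM orbT.
Qed.

Definition below_all : set Omega := [set w | forall M, below_grid B a b u M w].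

Lemma cvg_below_grid w : below M w @[M --> \oo] --> (\1_below_all w : R).
Proof.
rewrite indicE; have [h|h] := pselect (below_all w).
  by rewrite mem_set//; apply: cvg_near_cst; apply: nearW => M; rewrite h.
rewrite memNset//; move/existsNP: h => [M0 /negP nb].
apply: cvg_near_cst; exists M0 => // M /= M0M.
by rewrite (negbTE (contra (below_grid_le M0M) nb)).
Qed.

Lemma measurable_below_all : measurable below_all.
Proof.
apply/measurable_indicP; apply: (@measurable_fun_cvg _ _ _ setT (fun M => below M)).
  by move=> M; exact: (measurable_below_grid BM).
by move=> w _; exact: cvg_below_grid.
Qed.

Let integrableX (f : Omega -> R) : measurable_fun [set: Omega] f ->
  (forall w, `|f w| <= 1) -> P.-integrable [set: Omega] (EFin \o (fun w => f w * X w)).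
Proof.
move=> mf f1; apply: le_integrable iX => //.
  apply/measurable_EFinP/measurable_funM => //.
  by apply/measurable_EFinP; exact: measurable_int iX.
by move=> w _; rewrite /= lee_fin normrM ler_piMl.
Qed.

Let EX : \int[P]_w X w = bessel_image_mean a b u.
Proof. by rewrite /Rintegral (expectation_radial BM a0 u0 abu0). Qed.

Section error.
Variable e : R.
Hypothesis e0 : 0 < e.

Let h M (j : 'I_(2 ^ M)) w : R := (good_exit B a b u M j e w)%:R.

Let mh M j : measurable_fun [set: Omega] (@h M j).
Proof. by apply: (measurable_good_exit BM). Qed.

Let h1 M j w : `|@h M j w| <= 1.
Proof. by rewrite /h; case: good_exit; rewrite ?normr1 ?normr0. Qed.

Let ih M j : P.-integrable [set: Omega] (EFin \o @h M j).
Proof. exact: (bounded_integrable Pfin (@mh M j) (@h1 M j)). Qed.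

Let exit_sum_norm M w : `|exit_sum B a b u e M w| <= 1.
Proof.
have [bM|nb] := boolP (below_grid B a b u M w).
  by rewrite exit_sum_below// normr0.
have [j jM ex] := not_below_exit nb.
move: jM; rewrite leq_eqVlt => /predU1P[jE|jM].
  by rewrite jE in ex; rewrite exit_sum_last// normr0.
by rewrite (exit_sum_unique e jM ex); case: good_exit; rewrite ?normr0 ?normr1.
Qed.

Let mexit M : measurable_fun [set: Omega] (exit_sum B a b u e M).
Proof. by apply: measurable_sum => j; exact: mh. Qed.

Let mbad M : measurable_fun [set: Omega] (bad_exit B a b u e M).
Proof.
apply: measurable_funB => //; apply: measurable_funB => //.
exact: (measurable_below_grid BM).
Qed.

(** Each good exit costs at most [e] times its probability, and first exits at different grid points
    exclude one another; the bound therefore does not grow with the grid. *)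
Let exit_small M : `|\int[P]_w (exit_sum B a b u e M w * X w)| <= e.
Proof.
have [_ eS] := Rintegral_sum (index_enum 'I_(2 ^ M))
  (fun j => integrableX (@mh M j) (@h1 M j)).
have [iS eH] := Rintegral_sum (index_enum 'I_(2 ^ M)) (@ih M).
under eq_Rintegral do rewrite mulr_suml.
rewrite eS (le_trans (ler_norm_sum _ _ _))//.
apply: (@le_trans _ _ (\sum_(j < 2 ^ M) e * \int[P]_w (@h M j w))).
  by apply: ler_sum => j _; exact: (expectation_good_exit_le BM a0 u0 abu0).
rewrite -mulr_sumr -[leRHS]mulr1 ler_pM2l// -eH.
apply: (@le_trans _ _ (\int[P]_w (cst 1 w))).
  apply: le_Rintegral => //.
    exact: finite_measure_integrable_cst.
  by move=> w _; rewrite (le_trans (ler_norm _))//; exact: exit_sum_norm.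
by rewrite Rintegral_cst// mul1r [X in fine X](@probability_setT _ _ _ P).
Qed.

Let decomposition M : bessel_image_mean a b u = \int[P]_w (below M w) +
  \int[P]_w (exit_sum B a b u e M w * X w) + \int[P]_w (bad_exit B a b u e M w * X w).
Proof.
have ib : P.-integrable [set: Omega] (EFin \o (below M)).
  apply: (bounded_integrable Pfin (M := 1)); first exact: (measurable_below_grid BM).
  by move=> w; case: below_grid; rewrite ?normr1 ?normr0.
have ie := integrableX (mexit M) (exit_sum_norm M).
have iB := integrableX (mbad M) (bad_exit_norm B a b u e M).
rewrite -EX -RintegralD// -RintegralD//; last first.
  by apply: eq_integrable (integrableD measurableT ib ie).
apply: eq_Rintegral => w _; rewrite /bad_exit.
case bw : (below_grid B a b u M w).
  by rewrite /X (below_radial bw); ring.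
by rewrite /= mulr0n; ring.
Qed.

(** In [decomposition] the good part is at most [e] on every grid, and the bad part tends to 0 under
    domination by [|X|]; only the limit of the survival probabilities remains. *)
Lemma survival_error :
  `|bessel_image_mean a b u - fine (P below_all)| <= e.
Proof.
have cb : \int[P]_w (below M w) @[M --> \oo] --> fine (P below_all).
  apply: fine_cvg; rewrite fineK ?fin_num_measure//; last exact: measurable_below_all.
  rewrite -[X in P X]setIT -integral_indic//; last exact: measurable_below_all.
  apply: (bounded_cvg_integral Pfin (M := 1)).
  - by move=> M; exact: (measurable_below_grid BM).
  - by move=> M w; case: below_grid; rewrite ?normr1 ?normr0.
  - exact: cvg_below_grid.
have cB : \int[P]_w (bad_exit B a b u e M w * X w) @[M --> \oo] --> (0 : R).
  have -> : (0 : R) = fine (\int[P]_w (cst 0 w)%:E)%E.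
    by rewrite integral0_eq.
  apply: fine_cvg; rewrite fineK; last by rewrite integral0_eq.
  apply: (@dominated_cvg _ _ _ P setT measurableT
    (fun M w => (bad_exit B a b u e M w * X w)%:E) _ (abse \o (EFin \o X))) => //.
  - move=> M; exact: measurable_int (integrableX (mbad M) (bad_exit_norm B a b u e M)).
  - move=> w _; apply: cvg_EFin; first exact: nearW.
    exact: (bad_exit_vanish BM a0 u0 abu0 e0).
  - exact: integrable_abse iX.
  - move=> M w _; rewrite /= lee_fin normrM ler_piMl//.
    exact: bad_exit_norm.
have cv : (bessel_image_mean a b u - \int[P]_w (below M w) -
    \int[P]_w (bad_exit B a b u e M w * X w)) @[M --> \oo] -->
    bessel_image_mean a b u - fine (P below_all).
  rewrite -[X in _ --> X]subr0; apply: cvgB => //.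
  by apply: cvgB => //; exact: cvg_cst.
apply: (cvg_le (cvg_norm cv)) => M; rewrite {1}(decomposition M).
by rewrite [X in `|X|](_ : _ = \int[P]_w (exit_sum B a b u e M w * X w)) ?exit_small//; ring.
Qed.

End error.

Lemma probability_below_all : P below_all = (bessel_image_mean a b u)%:E.
Proof.
rewrite -[LHS]fineK ?fin_num_measure//; last exact: measurable_below_all.
congr _%:E; apply/esym/eqP; rewrite -subr_eq0 -normr_le0.
by apply/ler_addgt0Pr => e e0; rewrite add0r; exact: survival_error.
Qed.

End grid_survival_probability.

Section dyadic_density.
Context {R : realType}.
Variables (g : R -> R) (u : R).
Hypothesis u0 : 0 < u.
Hypothesis cg : continuous g.

Lemma dyadic_approximation (t : R) : 0 <= t -> t <= u ->
  exists i : nat -> nat, (forall M, (i M <= 2 ^ M)%N) /\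
    dyadic u M (i M) @[M --> \oo] --> t.
Proof.
move=> t0 tu; pose i M := Num.Def.trunc (t / u * (2 ^ M)%:R).
have pM M : (0 : R) < (2 ^ M)%:R by rewrite ltr0n expn_gt0.
have x0 M : 0 <= t / u * (2 ^ M)%:R by rewrite mulr_ge0 ?divr_ge0// ltW.
exists i; split => [M|].
  have /andP[iM _] := truncn_itv (x0 M).
  rewrite -(ler_nat R) (le_trans iM)// ler_piMl ?(ltW (pM M))//.
  by rewrite ler_pdivrMr// mul1r.
apply: (@squeeze_cvgr _ _ _ _ (fun M => t - u / (2 ^ M)%:R) (cst t)).
- near=> M; have /andP[i1 i2] := truncn_itv (x0 M).
  have tE : t = u * (t / u * (2 ^ M)%:R) / (2 ^ M)%:R.
    by field; rewrite !gt_eqF// pM.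
  rewrite /dyadic {1 2}tE; apply/andP; split; last first.
    by rewrite ler_pM2r ?invr_gt0// ler_pM2l.
  rewrite -mulrBl ler_pM2r ?invr_gt0//.
  rewrite [leLHS](_ : _ = u * (t / u * (2 ^ M)%:R - 1)); last by ring.
  by rewrite ler_pM2l// lerBlDr natr1 ltW.
- rewrite -[X in _ --> X]subr0; apply: cvgB; first exact: cvg_cst.
  exact: cvg_pow2V.
- exact: cvg_cst.
Unshelve. all: end_near. Qed.

Lemma dyadic_ge (x : R) :
  (forall M i, (i <= 2 ^ M)%N -> x <= g (dyadic u M i)) ->
  forall t, 0 <= t -> t <= u -> x <= g t.
Proof.
move=> h t t0 tu; have [i [iM it]] := dyadic_approximation t0 tu.
have gi : g (dyadic u M (i M)) @[M --> \oo] --> g t by apply: (cvg_comp _ _ it); exact: cg.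
by apply: (cvg_ge gi) => M; exact: h.
Qed.

Lemma nonzero_bounded_away : (forall t, 0 <= t -> t <= u -> g t != 0) ->
  exists2 dl : R, 0 < dl & forall t, 0 <= t -> t <= u -> dl <= `|g t|.
Proof.
move=> gn0; have cn : {within `[0, u], continuous (fun t => `|g t|)}.
  by apply: continuous_subspaceT => t; apply: cvg_norm; exact: cg.
have [t0 t0u h] := EVT_min (ltW u0) cn.
exists `|g t0|.
  by rewrite normr_gt0; move: t0u; rewrite in_itv/= => /andP[? ?]; exact: gn0.
by move=> t t1 t2; apply: h; rewrite in_itv/= t1.
Qed.

Lemma nonzero_negative : g 0 < 0 -> (forall t, 0 <= t -> t <= u -> g t != 0) ->
  forall t, 0 <= t -> t <= u -> g t < 0.
Proof.
move=> g0 gn0 t t0 tu; rewrite ltNge; apply/negP => gt.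
have cw : {within `[0, t], continuous g} by exact: continuous_subspaceT.
have : Num.min (g 0) (g t) <= 0 <= Num.max (g 0) (g t).
  by rewrite ge_min (ltW g0) le_max gt orbT.
move=> /(IVT t0 cw)[x]; rewrite in_itv/= => /andP[x0 xt] gx.
by have := gn0 x x0 (le_trans xt tu); rewrite gx eqxx.
Qed.

End dyadic_density.

(** * From dyadic times to paths that do not touch the line *)

Section level_sequence.
Context {R : realType}.
Variables (a b u : R).
Hypothesis a0 : 0 < a.
Hypothesis abu0 : 0 < a + b * u.

(** Half the smaller of the heights at times 0 and [u] keeps every lower line positive at both ends,
    the first one included. *)
Definition lower_level (n : nat) : R := a - Num.min a (a + b * u) / 2 / n.+1%:R.

Let m0 : 0 < Num.min a (a + b * u) / 2.
Proof. by rewrite divr_gt0// lt_min a0. Qed.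

Lemma lower_level_lt n : lower_level n < a.
Proof. by rewrite ltrBlDr ltrDl divr_gt0. Qed.

Lemma lower_level_nd n k : (n <= k)%N -> lower_level n <= lower_level k.
Proof.
move=> nk; rewrite lerD2l lerN2 ler_wpM2l ?(ltW m0)//.
by rewrite lef_pV2 ?posrE// ler_nat.
Qed.

Let level0 : lower_level 0 = a - Num.min a (a + b * u) / 2.
Proof. by rewrite /lower_level divr1. Qed.

Lemma lower_level_gt0 n : 0 < lower_level n.
Proof.
apply: lt_le_trans (lower_level_nd (leq0n n)); rewrite level0.
have : Num.min a (a + b * u) <= a by rewrite ge_min lexx.
by move: (Num.min _ _) a0 => m a0'; lra.
Qed.

Lemma lower_level_end_gt0 n : 0 < lower_level n + b * u.
Proof.
apply: (@lt_le_trans _ _ (lower_level 0 + b * u)).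
  rewrite level0; have : Num.min a (a + b * u) <= a + b * u by rewrite ge_min lexx orbT.
  by move: (Num.min _ _) abu0 => m h1 h2; lra.
by rewrite lerD2r lower_level_nd.
Qed.

Lemma cvg_lower_level : lower_level n @[n --> \oo] --> a.
Proof.
rewrite -[X in _ --> X]subr0; apply: cvgB; first exact: cvg_cst.
rewrite -[X in _ --> X](mulr0 (Num.min a (a + b * u) / 2)).
by apply: cvgM; [exact: cvg_cst|exact: cvg_harmonic].
Qed.

End level_sequence.

Section no_touch.
Context {d} {Omega : measurableType d} {R : realType}.
Variables (P : probability Omega R) (B : 'I_3 -> halfline R -> Omega -> R).
Hypothesis BM : standard_brownian_motion P B.
Variables (a b u : R).
Hypothesis a0 : 0 < a.
Hypothesis u0 : 0 < u.
Hypothesis abu0 : 0 < a + b * u.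

Definition no_touch : set Omega :=
  [set w | forall t, 0 <= t -> t <= u -> line_gap B a b t w != 0].

Local Notation level := (lower_level a b u).

(** On the compact interval a path that avoids the line keeps a positive distance from it, hence
    stays below some lower line. Conversely, dyadic times only give a weak inequality with the lower
    line, which is strict for the line itself. *)
Lemma no_touchE : no_touch = \bigcup_n below_all B (level n) b u.
Proof.
apply/seteqP; split => w.
  move=> nt; have cg : continuous (fun t => line_gap B a b t w).
    exact: (continuous_line_gap BM).
  have g0 : line_gap B a b 0 w < 0 by exact: (line_gap0 BM).
  have [dl dl0 hdl] := nonzero_bounded_away u0 cg nt.
  have lt := nonzero_negative cg g0 nt.
  have adl : a - dl < a by rewrite ltrBlDr ltrDl.
  have [n _ hn] := cvgr_gt _ (@cvg_lower_level R a b u) _ adl.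
  exists n => // M; apply/below_gridP => i iM.
  have t0 : 0 <= dyadic u M i by rewrite dyadic_ge0// ltW.
  have tu : dyadic u M i <= u by rewrite dyadic_le// ltW.
  have := hdl _ t0 tu; rewrite ltr0_norm ?lt// /line_gap.
  have := hn n (leqnn n); rewrite /=; lra.
move=> [n _ bn] t t0 tu; rewrite lt_eqF//.
have cg : continuous (fun t => - line_gap B (level n) b t w).
  by move=> s; apply: cvgN; exact: (continuous_line_gap BM).
have : 0 <= - line_gap B (level n) b t w.
  apply: (dyadic_ge u0 cg _ t0 tu) => M i iM.
  by rewrite oppr_ge0 ltW//; have /below_gridP := bn M; exact.
have := lower_level_lt a0 abu0 n; rewrite /line_gap; lra.
Qed.

Lemma probability_no_touch (v : R) :
  bessel_image_mean (level n) b u @[n --> \oo] --> v -> P no_touch = v%:E.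
Proof.
move=> Iv.
have mb n : measurable (below_all B (level n) b u) by exact: (measurable_below_all BM).
have mU : measurable (\bigcup_n below_all B (level n) b u) by exact: bigcupT_measurable.
have nd : {homo (fun n => below_all B (level n) b u) : n k / (n <= k)%N >-> (n <= k)%O}.
  move=> n k nk; apply/subsetPset => w h M; apply/below_gridP => i iM.
  have /below_gridP/(_ i iM) := h M; rewrite /line_gap.
  have := lower_level_nd a0 abu0 nk; lra.
rewrite no_touchE; have c1 := nondecreasing_cvg_mu mb mU nd (mu := P).
apply: (cvg_unique (@ereal_hausdorff R) c1).
have -> : P \o (fun n => below_all B (level n) b u) =
    EFin \o (fun n => bessel_image_mean (level n) b u).
  apply/funext => n /=; apply: (probability_below_all BM) => //.
    exact: lower_level_gt0.
  exact: lower_level_end_gt0.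
by apply: cvg_EFin => //; exact: nearW.
Qed.

End no_touch.

(** * The event that the hitting time exceeds u *)

Section hitting_time_event.
Context {R : realType}.
Variables (a b u : R).
Hypothesis u0 : 0 < u.

Let gap (t : R) (w : path_space R) : R := path_at (clamp t) w - (a + b * t).

Let continuous_gap (w : path_space R) : continuous (fun t => gap t w).
Proof.
move=> t; apply: cvgB; last first.
  by apply: cvgD; [exact: cvg_cst|apply: cvgM; [exact: cvg_cst|exact: cvg_id]].
apply: (cvg_comp clamp (w : continuousType (halfline R) R)); first exact: continuous_clamp.
exact: cts_fun.
Qed.

(** A strict inequality for the infimum needs a margin: since the gap is nonzero at [u], it stays
    nonzero up to some [u + r], and the infimum is at least [u + r]. *)
Lemma lt_hitting_timeP (w : path_space R) :
  (u%:E < hitting_time a b w)%E <-> forall t, 0 <= t -> t <= u -> gap t w != 0.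
Proof.
split.
  move=> uH t t0 tu; apply/eqP => /eqP; rewrite subr_eq0 => /eqP e.
  have : (hitting_time a b w <= t%:E)%E.
    apply: ereal_inf_lbound; exists (clamp t); last by rewrite (val_clamp t0).
    by change (path_at (clamp t) w = a + b * \val (clamp t)); rewrite (val_clamp t0).
  by move=> /(lt_le_trans uH); rewrite lte_fin ltNge tu.
move=> h; have gu : gap u w != 0 by apply: h; [exact: ltW|].
have cgu : gap t w @[t --> u] --> gap u w by exact: continuous_gap.
have : \forall t \near u, gap t w != 0 by exact: (cvgr_neq0 _ cgu gu).
move=> /nbhs_ballP[r /= r0 hr].
apply: (@lt_le_trans _ _ (u + r)%:E); first by rewrite lte_fin ltrDl.
apply: le_ereal_inf_tmp => _ [t /= ht <-]; rewrite lee_fin leNgt; apply/negP => tr.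
have t0 : 0 <= \val t by have := valP t; rewrite inE/= in_itv/= andbT.
have gt0 : gap (\val t) w = 0 by rewrite /gap clampK ht subrr.
have [tu|ut] := leP (\val t) u; first by have := h _ t0 tu; rewrite gt0 eqxx.
have : ball u r (\val t).
  rewrite /ball/= ltr_distlC tr andbT (lt_trans _ ut)//.
  by rewrite ltrBlDr ltrDl.
by move=> /hr; rewrite gt0 eqxx.
Qed.

Lemma measurable_path_at (t : halfline R) :
  measurable_fun [set: path_space R] (path_at t : path_space R -> R).
Proof.
move=> _ A mA; rewrite setTI; apply: sub_sigma_algebra.
by exists t, A.
Qed.

(** By compactness the gap stays away from 0 by some [1 / (n + 1)], and continuity reduces this to
    the dyadic times: countably many coordinate conditions. *)
Lemma measurable_lt_hitting_time :
  measurable [set w : path_space R | (u%:E < hitting_time a b w)%E].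
Proof.
have -> : [set w : path_space R | (u%:E < hitting_time a b w)%E] =
    \bigcup_n \bigcap_M \bigcap_(i in [set i | (i <= 2 ^ M)%N])
      [set w | n.+1%:R^-1 <= `|gap (dyadic u M i) w|].
  apply/seteqP; split => w /=.
    move=> /lt_hitting_timeP h.
    have [dl dl0 hdl] := nonzero_bounded_away u0 (@continuous_gap w) h.
    have [n _ hn] := cvgr_lt _ (@cvg_harmonic R) _ dl0.
    exists n => // M _ i /= iM; apply: le_trans (hdl _ _ _).
    - by apply: ltW; exact: hn n (leqnn n).
    - by rewrite dyadic_ge0// ltW.
    - by rewrite dyadic_le// ltW.
  move=> [n _ hn]; apply/lt_hitting_timeP => t t0 tu; rewrite -normr_gt0.
  apply: (@lt_le_trans _ _ n.+1%:R^-1); first by rewrite invr_gt0.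
  have cn : continuous (fun t => `|gap t w|).
    by move=> s; apply: cvg_norm; exact: continuous_gap.
  by apply: (dyadic_ge u0 cn _ t0 tu) => M i iM; exact: hn.
apply: bigcupT_measurable => n; apply: bigcapT_measurable => M.
apply: bigcap_measurable => [|i _]; first by exists 0%N.
have mg : measurable_fun [set: path_space R] (fun w => `|gap (dyadic u M i) w|).
  apply: measurableT_comp => //; apply: measurable_funB => //.
  exact: measurable_path_at.
rewrite (_ : mkset _ = (fun w => `|gap (dyadic u M i) w|) @^-1` `[n.+1%:R^-1, +oo[%classic).
  by rewrite -[X in measurable X]setTI; exact: mg.
by apply/seteqP; split => w; rewrite /= in_itv/= andbT.
Qed.

End hitting_time_event.

(** * Continuity of the survival probability in the level *)

Section image_mean_continuity.
Context {R : realType}.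
Notation mu := (@lebesgue_measure R).
Variables (a b u : R).
Hypothesis a0 : 0 < a.
Hypothesis u0 : 0 < u.
Hypothesis abu0 : 0 < a + b * u.

(** Strictly inside a cell the index [k] does not change for nearby values of [c], and the branch
    formula is continuous in [c]. *)
Lemma cvg_image_fun (c_ : nat -> R) (c q : R) (k : int) :
  c_ n @[n --> \oo] --> c -> `|q - 2 * k%:~R * c| < c ->
  image_fun b (c_ n) q @[n --> \oo] --> image_fun b c q.
Proof.
move=> cc qk; set K : R := k%:~R.
have cdist : c_ n - `|q - 2 * K * c_ n| @[n --> \oo] --> c - `|q - 2 * K * c|.
  apply: cvgB => //; apply: cvg_norm; apply: cvgB; first exact: cvg_cst.
  by apply: cvgM => //; exact: cvg_cst.
have near_cell : \forall n \near \oo, 0 < c_ n - `|q - 2 * K * c_ n|.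
  by apply: (cvgr_gt _ cdist); rewrite subr_gt0.
rewrite (image_fun_cell b qk) -/K.
apply: (@cvg_trans _ ((fun n => (q - 2 * K * c_ n) *
    expR (2 * b * K * (q - K * c_ n))) @ \oo)); last first.
  apply: cvgM.
    by apply: cvgB; [exact: cvg_cst|apply: cvgM => //; exact: cvg_cst].
  apply: (cvg_comp (fun n => 2 * b * K * (q - K * c_ n)) expR); last exact: continuous_expR.
  apply: cvgM; first exact: cvg_cst.
  by apply: cvgB; [exact: cvg_cst|apply: cvgM => //; exact: cvg_cst].
apply: near_eq_cvg; near=> n.
rewrite (@image_fun_cell _ b (c_ n) q k)// -subr_gt0.
by near: n.
Unshelve. all: end_near. Qed.

Lemma countable_walls (c : R) :
  countable [set (2 * k%:~R - 1) * c | k in [set: int]].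
Proof.
apply: (card_le_trans (card_image_le _ _)).
exact: countableP.
Qed.

Lemma cvg_bessel_image_mean :
  bessel_image_mean (lower_level a b u n) b u @[n --> \oo] -->
  bessel_image_mean a b u.
Proof.
pose c_ n := lower_level a b u n + b * u.
pose c := a + b * u.
have c_gt0 n : 0 < c_ n by exact: lower_level_end_gt0.
have c_lt n : c_ n < c by rewrite ltrD2r lower_level_lt.
have c0_le n : c_ 0%N <= c_ n by rewrite lerD2r lower_level_nd.
have bu0 : Num.max b 0 * u < c_ 0%N.
  exact: (max_slope_lt (lower_level_gt0 a0 abu0 0) (c_gt0 0%N)).
have bu : Num.max b 0 * u < c by exact: lt_trans bu0 (c_lt 0%N).
have cc : c_ n @[n --> \oo] --> c.
  by apply: cvgD; [exact: cvg_lower_level|exact: cvg_cst].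
pose f n q := image_fun b (c_ n) q * (q / u * gaussian u 0 q).
pose f0 q := image_fun b c q * (q / u * gaussian u 0 q).
have mq : measurable_fun [set: R] (fun q => q / u * gaussian u 0 q).
  by apply: measurable_funM; [exact: measurable_funM|exact: measurable_gaussian].
have mf n : measurable_fun [set: R] (f n).
  by apply: measurable_funM => //; exact: measurable_image_fun.
have mf0 : measurable_fun [set: R] f0.
  by apply: measurable_funM => //; exact: measurable_image_fun.
(* [c_ 0] is the smallest of the [c_ n], so its growth rate bounds all the others. In [dom] below,
   the linear exponent absorbs the factor [q / u]. *)
pose g := image_decay b (c_ 0%N) u.
have g0 : 0 < g by exact: image_decay_gt0.
pose K := c / u * (Num.sqrt (2 * pi * u))^-1.
pose dom q : R := K * expR (1 * `|q| - g * q ^+ 2).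
have K0 : 0 <= K by rewrite /K mulr_ge0 ?divr_ge0 ?invr_ge0// ltW.
have idom : mu.-integrable [set: R] (EFin \o dom).
  apply: (@integrable_gauss_bound _ _ K 1 g) => //.
    apply: measurable_funM => //; apply: measurableT_comp => //.
    by apply: measurable_funB; apply: measurable_funM => //; exact: normr_measurable.
  by move=> q; rewrite /dom ger0_norm// mulr_ge0// expR_ge0.
have fdom n q : `|f n q| <= dom q.
  have n0 : `|0 : R| <= 0 by rewrite normr0.
  rewrite /f normrM; have gle := gaussian_le q u0 (lexx u) n0.
  have b0 : 0 <= Num.max b 0 by rewrite le_max lexx orbT.
  have h1 : `|image_fun b (c_ n) q| <= c * expR (Num.max b 0 / (2 * c_ 0%N) * q ^+ 2).
    apply: (le_trans (image_fun_bound b q (c_gt0 n))); apply: ler_pM.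
    - exact: ltW.
    - exact: expR_ge0.
    - exact: ltW.
    - rewrite ler_expR ler_wpM2r ?sqr_ge0// ler_wpM2l// lef_pV2 ?posrE ?mulr_gt0//.
      by rewrite ler_pM2l.
  have h2 : `|q / u * gaussian u 0 q| <= u^-1 * (Num.sqrt (2 * pi * u))^-1 *
      (expR `|q| * expR (- ((2 * u)^-1 * q ^+ 2))).
    rewrite normrM (ger0_norm (gaussian_ge0 _ _ _)) normrM.
    rewrite (ger0_norm (_ : 0 <= u^-1)) ?invr_ge0 ?(ltW u0)//.
    rewrite mul0r mul0r sub0r in gle.
    rewrite [leRHS](_ : _ = (expR `|q| / u) * ((Num.sqrt (2 * pi * u))^-1 *
      expR (- ((2 * u)^-1 * q ^+ 2)))); last by ring.
    apply: ler_pM; [|exact: gaussian_ge0| |exact: gle].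
      by rewrite divr_ge0// ltW.
    by rewrite ler_wpM2r ?invr_ge0 ?(ltW u0)// norm_le_expR.
  apply: (le_trans (ler_pM _ _ h1 h2)) => //.
  rewrite [leLHS](_ : _ = K * (expR (Num.max b 0 / (2 * c_ 0%N) * q ^+ 2) *
    expR `|q| * expR (- ((2 * u)^-1 * q ^+ 2)))); last by rewrite /K; ring.
  rewrite /dom ler_wpM2l// -!expRD ler_expR /g /image_decay mul1r mulrBl.
  by move: (_ / _ * _) => x; move: (_^-1 * _) => y; lra.
pose N := [set (2 * k%:~R - 1) * c | k in [set: int]].
have N0 : mu N = 0%E by apply: countable_lebesgue_measure0; exact: countable_walls.
have mN : measurable N.
  by apply: countable_measurable => [q|]; [exact: measurable_set1|exact: countable_walls].
have int0 : mu.-integrable [set: R] (EFin \o f0).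
  have fE q : f0 q = u^-1 * (q * (image_fun b c q * gaussian u 0 q)).
    by rewrite /f0; ring.
  have := integrableZl measurableT u^-1
    (integrable_id_image_gaussian abu0 u0 bu 0 u0 (lexx u)).
  by apply: eq_integrable => // q _; rewrite /= fE.
have [_ _ cv] := @dominated_convergence _ _ _ mu setT measurableT
  (fun n q => (f n q)%:E) (EFin \o f0) (EFin \o dom)
  (fun n => (measurable_EFinP _ _).2 (mf n)) ((measurable_EFinP _ _).2 mf0)
  (ltac:(exists N; split => // q /= /not_implyP[_ nq]; have [[k kq]|[k kq]] := cellP q abu0;
    [exfalso; apply: nq; apply: cvg_EFin; [exact: nearW|
      by apply: cvgM; [exact: (cvg_image_fun cc kq)|exact: cvg_cst]]|by exists k]))
  idom
  (ltac:(apply: nearW => q n _; rewrite /= lee_fin; exact: fdom)).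
have fin0 : (\int[mu]_q (f0 q)%:E = (bessel_image_mean a b u)%:E)%E.
  by rewrite /bessel_image_mean fineK//; exact: integrable_fin_num.
have := cv; rewrite [X in _ --> X -> _]fin0 => cv'.
exact: (fine_cvg cv').
Qed.

End image_mean_continuity.

Section normal_distribution.
Context {R : realType}.
Notation mu := (@lebesgue_measure R).
Implicit Types x : R.

Lemma phi_gaussian x : phi x = gaussian 1 0 x.
Proof. by rewrite phiE /gaussian sqrtr1. Qed.

Lemma phiN x : phi (- x) = phi x :> R.
Proof. by rewrite /phi sqrrN. Qed.

Lemma has_integral_phi : has_integral (@phi R) 1.
Proof.
by apply: (has_integral_ext _ (@has_integral_gaussian R 1 0)) => x; rewrite phi_gaussian.
Qed.

Lemma is_derive_phi x : is_derive x 1 (@phi R) (- x * phi x).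
Proof.
rewrite (_ : @phi R = gaussian 1 0); last by apply/funext => y; rewrite phi_gaussian.
by have := @is_derive_gaussian R 1 0 x ltr01; rewrite subr0 divr1.
Qed.

Lemma continuous_phi : continuous (@phi R).
Proof.
move=> x; apply/differentiable_continuous/derivable1_diffP.
exact: (@ex_derive _ _ _ _ _ _ _ (is_derive_phi x)).
Qed.

Lemma is_derive_Phi x : is_derive x 1 (@Phi R) (phi x).
Proof.
have [ip _] := has_integral_phi.
have ip1 : mu.-integrable [set` Interval -oo%O (BRight (x + 1))] (EFin \o @phi R).
  exact: integrableS ip.
have [d1 d2] := @continuous_FTC1 R (@phi R) -oo%O x (x + 1) (ltr_pwDr ltr01 (lexx x)) ip1
  (ltNyr _) (@continuous_phi x).
by apply: DeriveDef => //; rewrite -derive1E d2.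
Qed.

Lemma PhiN x : Phi (- x) = 1 - Phi x :> R.
Proof.
have [ip vp] := has_integral_phi.
have iA (A : set R) : measurable A -> mu.-integrable A (EFin \o @phi R).
  by move=> mA; exact: integrableS ip.
have e1 : Phi (- x) = \int[mu]_(y in `]x, +oo[) phi y.
  pose f : R -> R := (@phi R \_ `[x, +oo[).
  have fi : has_integral f (\int[mu]_(y in `[x, +oo[) phi y).
    rewrite Rintegral_mkcond; apply: has_integral_Rintegral.
    have -> : EFin \o f = (EFin \o @phi R) \_ `[x, +oo[.
      by apply/funext => y; rewrite /f/= !patchE; case: ifP.
    by apply/(integrable_mkcond _ _).1 => //; exact: iA.
  have := has_integral_reflect 0 fi => /has_integral_RintegralE.
  rewrite Rintegral_itv_obnd_cbnd; last exact: iA.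
  move=> <-; rewrite /Phi Rintegral_mkcond; congr Rintegral; apply/funext => y.
  rewrite /f !patchE !mem_setE !in_itv/= andbT sub0r phiN.
  by rewrite lerNr.
rewrite e1; apply/esym/eqP; rewrite subr_eq addrC; apply/eqP.
rewrite /Phi -Rintegral_setU//=; first last.
- apply/disj_setPS => y [] /=; rewrite !in_itv/= andbT => h1 h2.
  by move: (le_lt_trans h1 h2); rewrite ltxx.
- by apply: iA; exact: measurableU.
have -> : `]-oo, x] `|` `]x, +oo[ = [set: R] :> set R.
  apply/seteqP; split => // y _; rewrite /= !in_itv/= andbT.
  by case: (leP y x); [left|right].
by rewrite (has_integral_RintegralE has_integral_phi).
Qed.

End normal_distribution.

(** * Explicit integration over the cells *)

Section cell_primitive.
Context {R : realType}.
Notation mu := (@lebesgue_measure R).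
Variables (a b u : R).
Hypotheses (a0 : 0 < a) (u0 : 0 < u) (abu0 : 0 < a + b * u).
Local Notation c := (a + b * u).

(** Completing the square in [y] gives [exp(2bk (q - kc)) * gaussian u 0 q = exp(-2 k^2 a b) phi(y)
    / sqrt u]. The polynomial factor becomes [y (y + m) - 4 k^2 a b] with
    [m = 2k (b sqrt u - a / sqrt u)], and [(1 - 4 k^2 a b) Phi - (y + m) phi] is a primitive of it
    times [phi]. *)
Definition cell_primitive (k q : R) : R :=
  let y := (q - 2 * k * b * u) / Num.sqrt u in
  expR (- (2 * k ^+ 2 * a * b)) *
  ((1 - 4 * k ^+ 2 * a * b) * Phi y
   - (y + 2 * k * (b * Num.sqrt u - a / Num.sqrt u)) * phi y).

Lemma is_derive_cell_primitive (k q : R) :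
  is_derive q 1 (cell_primitive k)
    ((q - 2 * k * c) * expR (2 * b * k * (q - k * c)) * (q / u * gaussian u 0 q)).
Proof.
have s0 : 0 < Num.sqrt u by rewrite sqrtr_gt0.
have su : Num.sqrt u ^+ 2 = u by rewrite sqr_sqrtr// ltW.
pose y (r : R) := (r - 2 * k * b * u) / Num.sqrt u.
have dy : is_derive q 1 y (Num.sqrt u)^-1.
  rewrite (_ : y = fun r => (Num.sqrt u)^-1 *: (r - 2 * k * b * u)); last first.
    by apply/funext => r; rewrite /y [LHS]mulrC.
  by apply: is_derive_eq; rewrite subr0 [LHS]mulr1.
have dPhi : is_derive q 1 (@Phi R \o y) (phi (y q) * (Num.sqrt u)^-1).
  by apply: is_derive1_comp; exact: is_derive_Phi.
have dphi : is_derive q 1 (@phi R \o y) (- y q * phi (y q) * (Num.sqrt u)^-1).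
  by apply: is_derive1_comp; exact: is_derive_phi.
set m := 2 * k * (b * Num.sqrt u - a / Num.sqrt u).
set e := expR (- (2 * k ^+ 2 * a * b)).
have -> : cell_primitive k = fun r =>
    e *: ((1 - 4 * k ^+ 2 * a * b) *: (@Phi R \o y) r - ((y r + m) * (@phi R \o y) r)).
  by [].
apply: is_derive_eq.
have gE : e * phi (y q) * (Num.sqrt u)^-1 =
    expR (2 * b * k * (q - k * c)) * gaussian u 0 q.
  have pe : expR (- (2 * k ^+ 2 * a * b)) * expR (- (y q ^+ 2 / 2)) =
      expR (2 * b * k * (q - k * c)) * expR (- (q ^+ 2 / (2 * u))).
    rewrite -!expRD; congr expR; rewrite /y expr_div_n su; field; rewrite gt_eqF//.
  have ss : Num.sqrt (2 * pi * u) = Num.sqrt (2 * pi) * Num.sqrt u.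
    by rewrite sqrtrM// mulr_ge0// pi_ge0.
  rewrite (@gaussianE R u 0 q u0) subr0 /phi ss invfM.
  move: pe; rewrite -/e; move: (Num.sqrt (2 * pi))^-1 (Num.sqrt u)^-1 => i1 i2.
  move: (expR (- (y q ^+ 2 / 2))) (expR (2 * b * k * (q - k * c))) => x1 x2.
  move: (expR (- (q ^+ 2 / (2 * u)))) => x3 pe.
  transitivity (i1 * i2 * (e * x1)); first by ring.
  by rewrite pe; ring.
have ye : y q * (y q + m) - 4 * k ^+ 2 * a * b = q / u * (q - 2 * k * c).
  move: su s0; rewrite /y /m; move: (Num.sqrt u) => s us s0.
  by rewrite -us; field; rewrite gt_eqF.
transitivity ((q / u * (q - 2 * k * c)) * (e * phi (y q) * (Num.sqrt u)^-1)); last first.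
  by rewrite gE; ring.
rewrite -ye /GRing.scale/=; ring.
Qed.

End cell_primitive.

Section cells.
Context {R : realType}.
Notation mu := (@lebesgue_measure R).
Variables (a b u : R).
Hypotheses (a0 : 0 < a) (u0 : 0 < u) (abu0 : 0 < a + b * u).
Local Notation c := (a + b * u).

Definition image_density (q : R) : R := image_fun b c q * (q / u * gaussian u 0 q).

Definition series_term (K : R) : R :=
  expR (- (2 * K ^+ 2 * a * b)) *
  ((1 - 4 * K ^+ 2 * a * b) *
     (Phi ((a + b * u - 2 * K * a) / Num.sqrt u)
      - Phi (- (2 * K * a / Num.sqrt u)))
   + (2 * K * b * u - a - b * u) / Num.sqrt u *
     phi ((a + b * u - 2 * K * a) / Num.sqrt u)).

(* The boundary term of [cell_primitive K] at the centre [2 * K * c] of its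
   cell; it cancels between the two halves of the cell. *)
Definition centre_term (K : R) : R :=
  expR (- (2 * K ^+ 2 * a * b)) * (2 * K * b * Num.sqrt u) *
  phi (2 * K * a / Num.sqrt u).

Definition cell (m : nat) : set R := `]m%:R * c, m.+1%:R * c[.

Let branch (k q : R) : R :=
  (q - 2 * k * c) * expR (2 * b * k * (q - k * c)) * (q / u * gaussian u 0 q).

Let continuous_branch (k : R) : continuous (branch k).
Proof.
move=> q; apply: cvgM; last first.
  apply: cvgM; last exact: continuous_gaussian.
  by apply: cvgM; [exact: cvg_id|exact: cvg_cst].
apply: cvgM; first by apply: cvgB; [exact: cvg_id|exact: cvg_cst].
apply: (@continuous_comp _ _ _ (fun q => 2 * b * k * (q - k * c)) expR); last first.
  exact: continuous_expR.
apply: cvgM; first exact: cvg_cst.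
by apply: cvgB; [exact: cvg_id|exact: cvg_cst].
Qed.

Lemma integral_image_density (k : int) (x y : R) :
  (2 * k%:~R - 1) * c <= x -> x < y -> y <= (2 * k%:~R + 1) * c ->
  \int[mu]_(q in `]x, y[) image_density q =
  cell_primitive a b u k%:~R y - cell_primitive a b u k%:~R x.
Proof.
move=> kx xy yk.
transitivity (\int[mu]_(q in `]x, y[) branch k%:~R q).
  apply: eq_Rintegral => q; rewrite inE/= in_itv/= => /andP[xq qy].
  rewrite /image_density (@image_fun_cell _ _ _ _ k)// ltr_norml.
  by apply/andP; split; lra.
have icc : mu.-integrable `[x, y] (EFin \o branch k%:~R).
  apply: continuous_compact_integrable; first exact: segment_compact.
  exact/continuous_subspaceT/continuous_branch.
have dP := is_derive_cell_primitive a b u0 k%:~R.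
have dr q : derivable (cell_primitive a b u k%:~R) q 1 by exact: (@ex_derive _ _ _ _ _ _ _ (dP q)).
have cP q : {for q, continuous (cell_primitive a b u k%:~R)}.
  exact/differentiable_continuous/derivable1_diffP.
rewrite Rintegral_itv_bndo_bndc; last first.
  by apply: integrableS icc => //; exact: subset_itv_oo_cc.
rewrite Rintegral_itv_obnd_cbnd; last first.
  by apply: integrableS icc => //; exact: subset_itv_oc_cc.
rewrite /Rintegral (@continuous_FTC2 _ (branch k%:~R) (cell_primitive a b u k%:~R))//.
- exact/continuous_subspaceT/continuous_branch.
- by split => [q _||]; [exact: dr|exact/cvg_at_right_filter/cP|
    exact/cvg_at_left_filter/cP].
- by move=> q _; rewrite derive1E (@derive_val _ _ _ _ _ _ _ (dP q)).
Qed.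

(** This is the right half of cell [j]. At its outer end the argument of [Phi] is
    [(c + 2 j a) / sqrt u], hence the index [- j] in the series. *)
Lemma integral_cell_even (j : nat) :
  \int[mu]_(q in cell j.*2) image_density q =
  series_term (- j%:R) + centre_term j%:R.
Proof.
have c1 : j.*2.+1%:R = 2 * j%:R + 1 :> R by rewrite -addn1 natrD -mul2n natrM.
have c0 : j.*2%:R = 2 * j%:R :> R by rewrite -mul2n natrM.
have s0 : 0 < Num.sqrt u by rewrite sqrtr_gt0.
have us : u = Num.sqrt u ^+ 2 by rewrite sqr_sqrtr// ltW.
rewrite /cell (@integral_image_density j); first last.
- by rewrite -pmulrn c1.
- by rewrite c1 c0 ltr_pM2r//; lra.
- by rewrite -pmulrn c0 ler_pM2r//; lra.
rewrite -pmulrn c1 c0.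
rewrite /cell_primitive /series_term /centre_term sqrrN.
have e1 : ((2 * j%:R + 1) * c - 2 * j%:R * b * u) / Num.sqrt u =
  (c - 2 * - j%:R * a) / Num.sqrt u by congr (_ / _); ring.
have e2 : (2 * j%:R * c - 2 * j%:R * b * u) / Num.sqrt u =
  2 * j%:R * a / Num.sqrt u by congr (_ / _); ring.
have e3 : - (2 * - j%:R * a / Num.sqrt u) = 2 * j%:R * a / Num.sqrt u :> R by ring.
rewrite e1 e2 e3.
move: (Phi _) (Phi _) (phi _) (phi _) (expR _) => F1 F2 f1 f2 E.
move: us s0; move: (Num.sqrt u) => s -> s0.
by field; rewrite gt_eqF.
Qed.

(** This is the left half of cell [j + 1]. At its outer end the argument is the opposite of the one
    in the series term, and the symmetries of [Phi] and [phi] restore the sign. *)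
Lemma integral_cell_odd (j : nat) :
  \int[mu]_(q in cell j.*2.+1) image_density q =
  series_term j.+1%:R - centre_term j.+1%:R.
Proof.
have c1 : j.*2.+2%:R = 2 * j.+1%:R :> R by rewrite -doubleS -mul2n natrM.
have c0 : j.*2.+1%:R = 2 * j.+1%:R - 1 :> R.
  by rewrite -c1 -[in RHS]natr1 addrK.
have s0 : 0 < Num.sqrt u by rewrite sqrtr_gt0.
have us : u = Num.sqrt u ^+ 2 by rewrite sqr_sqrtr// ltW.
rewrite /cell (@integral_image_density j.+1); first last.
- by rewrite -pmulrn c1 ler_pM2r//; lra.
- by rewrite c1 c0 ltr_pM2r//; lra.
- by rewrite -pmulrn c0.
rewrite -pmulrn c1 c0.
rewrite /cell_primitive /series_term /centre_term.
have e1 : (2 * j.+1%:R * c - 2 * j.+1%:R * b * u) / Num.sqrt u =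
  2 * j.+1%:R * a / Num.sqrt u by congr (_ / _); ring.
have e2 : ((2 * j.+1%:R - 1) * c - 2 * j.+1%:R * b * u) / Num.sqrt u =
  - ((c - 2 * j.+1%:R * a) / Num.sqrt u) by rewrite -[RHS]mulNr; congr (_ / _); ring.
rewrite e1 e2 !PhiN phiN.
move: (Phi _) (Phi _) (phi _) (phi _) (expR _) => F1 F2 f1 f2 E.
move: us s0; move: (Num.sqrt u) => s -> s0.
by field; rewrite gt_eqF.
Qed.

End cells.

(** * Summation over the cells *)

Section series_of_integrals.
Context d (T : measurableType d) (R : realType) (mu : {measure set T -> \bar R}).

Lemma sum_disjoint_restrict (f : T -> R) (A : nat -> set T) (n j : nat) (x : T) :
  trivIset setT A -> A j x -> \sum_(0 <= i < n) (f \_ (A i)) x = (j < n)%:R * f x.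
Proof.
move=> tA Ajx; rewrite big_mkord.
have E (i : 'I_n) : (f \_ (A i)) x = (i == j :> nat)%:R * f x.
  rewrite patchE; have [/set_mem Aix|nA] := boolP (x \in A i).
    have -> : (i : nat) = j by apply: (tA i j) => //; exists x.
    by rewrite eqxx mul1r.
  have [ij|_] := eqVneq (i : nat) j; last by rewrite mul0r.
  by case/negP: nA; rewrite ij mem_set.
rewrite (eq_bigr _ (fun i _ => E i)) -mulr_suml; congr (_ * _).
have [jn|nj] := ltnP j n.
  rewrite (bigD1 (Ordinal jn))//= eqxx big1 ?addr0// => i /negPf.
  by rewrite -val_eqE/= => ->.
by rewrite big1// => i _; rewrite ltn_eqF// (leq_trans (ltn_ord i)).
Qed.

(** Disjointness makes every partial sum equal to 0 or [f] at each point, so [|f|] dominates. *)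
Lemma cvg_series_Rintegral (f : T -> R) (A : nat -> set T) :
  mu.-integrable [set: T] (EFin \o f) -> (forall j, measurable (A j)) ->
  trivIset setT A ->
  series (fun j => \int[mu]_(x in A j) f x) @ \oo -->
  \int[mu]_(x in \bigcup_j A j) f x.
Proof.
move=> fi mA tA; have mU : measurable (\bigcup_j A j) by exact: bigcup_measurable.
have fiB (B : set T) : measurable B -> mu.-integrable [set: T] (EFin \o (f \_ B)).
  move=> mB; rewrite (_ : EFin \o _ = (EFin \o f) \_ B); last first.
    by apply/funext => x; rewrite /= !patchE; case: ifP.
  by apply/(integrable_mkcond _ mB).1; exact: integrableS fi.
pose F n x := \sum_(0 <= i < n) (f \_ (A i)) x.
have Fi n : mu.-integrable [set: T] (EFin \o F n).
  by apply: (Rintegral_sum _ (fun i => fiB _ (mA i))).1.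
have FE n : series (fun j => \int[mu]_(x in A j) f x) n = \int[mu]_x F n x.
  rewrite /F (Rintegral_sum _ (fun i => fiB _ (mA i))).2.
  by rewrite /series/=; apply: eq_bigr => i _; rewrite Rintegral_mkcond.
rewrite Rintegral_mkcond (funext FE).
have Fx x n : F n x = 0 \/ F n x = f x.
  have [[j _ Ajx]|nU] := pselect ((\bigcup_j A j) x).
    rewrite /F (sum_disjoint_restrict f n tA Ajx).
    by case: (j < n)%N; [right; rewrite mul1r|left; rewrite mul0r].
  left; rewrite /F big1// => i _; rewrite patchE memNset// => Aix.
  by apply: nU; exists i.
apply: fine_cvg; rewrite fineK; last exact: integrable_fin_num (fiB _ mU).
apply: (@dominated_cvg _ _ _ mu setT measurableT (fun n => EFin \o F n)
  (EFin \o (f \_ (\bigcup_j A j))) (abse \o (EFin \o f))).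
- by move=> n; exact: measurable_int (Fi n).
- move=> x _; apply: cvg_EFin; first exact: nearW.
  rewrite patchE; case: ifPn => [/set_mem[j _ Ajx]|/negP nU].
    apply: cvg_near_cst; exists j.+1 => // n /= jn.
    by rewrite /F (sum_disjoint_restrict f n tA Ajx) jn mul1r.
  apply: cvg_near_cst; apply: nearW => n.
  rewrite /= /F big1// => i _; rewrite patchE memNset// => Aix.
  by apply: nU; apply/mem_set; exists i.
- by [].
- exact: integrable_abse fi.
- by move=> n x _ /=; rewrite lee_fin; have [->|->] := Fx x n; rewrite ?normr0.
Qed.

End series_of_integrals.

Section image_series.
Context {R : realType}.
Notation mu := (@lebesgue_measure R).
Variables (a b u : R).
Hypotheses (a0 : 0 < a) (u0 : 0 < u) (abu0 : 0 < a + b * u).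
Local Notation c := (a + b * u).
Local Notation g := (image_density a b u).

(** For [b < 0] the factor [exp(-2 n^2 a b)] grows, but together with [phi] the exponent is
    [- 2 a c n^2 / u], which is negative because [c > 0]. *)
Lemma is_cvg_series_centre_term :
  cvgn (series (fun n => centre_term a b u n.+1%:R)).
Proof.
have s0 : 0 < Num.sqrt u by rewrite sqrtr_gt0.
pose kappa := 2 * a * c / u.
have k0 : 0 < kappa by rewrite divr_gt0 ?mulr_gt0.
pose C := 2 * `|b| * Num.sqrt u * (Num.sqrt (2 * pi))^-1.
have C0 : 0 <= C by rewrite /C !mulr_ge0 ?invr_ge0// ltW.
pose z := expR (- (kappa / 2)).
have z1 : `|z| < 1 by rewrite expR_geometric_lt1// divr_gt0.
apply: normed_cvg; apply: (@series_le_cvg _ _ (geometric (C * (2 / kappa) * z) z)).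
- by move=> n; exact: normr_ge0.
- move=> n; rewrite /geometric/=.
  apply: mulr_ge0; last by rewrite exprn_ge0// expR_ge0.
  by apply: mulr_ge0; [rewrite mulr_ge0// divr_ge0// ltW|exact: expR_ge0].
- move=> n; rewrite /geometric/=.
  have -> : C * (2 / kappa) * z * z ^+ n = C * (2 / kappa * z ^+ n.+1).
    by rewrite exprS; ring.
  have E : `|centre_term a b u n.+1%:R| =
      C * (n.+1%:R * expR (- (kappa * n.+1%:R ^+ 2))).
    have ex : expR (- (2 * n.+1%:R ^+ 2 * a * b)) *
        expR (- ((2 * n.+1%:R * a / Num.sqrt u) ^+ 2 / 2)) =
        expR (- (kappa * n.+1%:R ^+ 2)).
      rewrite -expRD; congr expR; rewrite expr_div_n sqr_sqrtr ?(ltW u0)// /kappa.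
      by field; rewrite gt_eqF.
    rewrite /centre_term /phi /C -ex !normrM !(ger0_norm (expR_ge0 _)).
    rewrite (ger0_norm (sqrtr_ge0 u)) !normr_nat.
    rewrite [ `|(Num.sqrt _)^-1|]ger0_norm ?invr_ge0//.
    ring.
  rewrite E; apply: ler_wpM2l => //; apply: le_trans (nat_expR_le n.+1 k0).
  apply: ler_wpM2l => //; rewrite ler_expR lerN2 ler_pM2l// expr2.
  by rewrite ler_peMl// ler1n.
- exact: is_cvg_geometric_series.
Qed.

Lemma cvg_series_shift (f : nat -> R) (l : R) :
  (series f @ \oo --> f 0%N + l) <-> (series (fun n => f n.+1) @ \oo --> l).
Proof.
have E n : series f n.+1 = f 0%N + series (fun n => f n.+1) n.
  by rewrite /series/= big_nat_recl.
rewrite -(cvg_shiftS (series f)) (funext E); split => h.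
  have -> : l = - f 0%N + (f 0%N + l) by ring.
  have -> : series (fun n => f n.+1) =
      fun n => - f 0%N + (f 0%N + series (fun n => f n.+1) n).
    by apply/funext => n; ring.
  by apply: cvgD => //; exact: cvg_cst.
by apply: cvgD => //; exact: cvg_cst.
Qed.

Lemma image_densityN q : g (- q) = g q.
Proof.
rewrite /image_density image_funN// !gaussianE// !subr0 sqrrN; ring.
Qed.

(** Odd multiples are walls, and at even ones, the centres of cells, the linear factor vanishes; the
    end points of the open half-cells can thus be ignored pointwise. *)
Lemma image_density_multiple (m : nat) : g (m%:R * c) = 0.
Proof.
rewrite /image_density -[in m%:R](odd_double_half m) natrD -mul2n natrM.
case: (odd m) => /=.
  rewrite (_ : (_ + _) * c = (2 * (m./2.+1)%:~R - 1) * c).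
    by rewrite image_fun_wall// mul0r.
  by rewrite -pmulrn -natr1; ring.
rewrite add0r (@image_fun_cell _ _ _ _ m./2) -?pmulrn subrr ?normr0//.
by rewrite !mul0r.
Qed.

Lemma cell_pos m q : cell a b u m q -> 0 < q.
Proof.
rewrite /cell/= in_itv/= => /andP[+ _]; apply: le_lt_trans.
by rewrite mulr_ge0// ltW.
Qed.

Lemma trivIset_cell : trivIset setT (cell a b u).
Proof.
move=> i j _ _ [q []]; rewrite /cell/= !in_itv/= => /andP[i1 i2] /andP[j1 j2].
have := lt_trans i1 j2; have := lt_trans j1 i2.
rewrite !ltr_pM2r// !ltr_nat !ltnS => h1 h2.
by apply/eqP; rewrite eqn_leq h1 h2.
Qed.

Lemma cell_cover q : 0 < q -> g q = 0 \/ exists m, cell a b u m q.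
Proof.
move=> q0; have := @truncn_itv _ (q / c) (divr_ge0 (ltW q0) (ltW abu0)).
set m := Num.truncn _; rewrite ler_pdivlMr// ltr_pdivrMr// => /andP[h1 h2].
move: h1; rewrite le_eqVlt => /orP[/eqP <-|h1].
  by left; exact: image_density_multiple.
by right; exists m; rewrite /cell/= in_itv/= h1 h2.
Qed.

Let even_cells := \bigcup_j cell a b u j.*2.
Let odd_cells := \bigcup_j cell a b u j.*2.+1.

Let measurable_cell m : measurable (cell a b u m).
Proof. exact: measurable_itv. Qed.

Let measurable_even_cells : measurable even_cells.
Proof. exact: bigcup_measurable. Qed.

Let measurable_odd_cells : measurable odd_cells.
Proof. exact: bigcup_measurable. Qed.

Let gp (q : R) : R := (g \_ even_cells) q + (g \_ odd_cells) q.

Let gp_pos q : 0 < q -> gp q = g q.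
Proof.
move=> /cell_cover[gq|[m mq]].
  by rewrite /gp !patchE gq !if_same addr0.
rewrite /gp !patchE; have [om|em] := boolP (odd m).
  rewrite memNset; last first.
    move=> [j _ jq]; have := @trivIset_cell _ _ I I (ex_intro _ q (conj jq mq)).
    by move=> jm; move: om; rewrite -jm odd_double.
  rewrite mem_set ?add0r//; exists m./2 => //.
  by rewrite -[m]odd_double_half om in mq.
rewrite [q \in odd_cells]memNset; last first.
  move=> [j _ jq]; have := @trivIset_cell _ _ I I (ex_intro _ q (conj jq mq)).
  by move=> jm; move: em; rewrite -jm /= odd_double.
rewrite mem_set ?addr0//; exists m./2 => //.
by rewrite -[m]odd_double_half (negbTE em) in mq.
Qed.

Let gp_neg q : q <= 0 -> gp q = 0.
Proof.
move=> q0; rewrite /gp !patchE !memNset ?addr0// => -[j _ /cell_pos];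
by rewrite ltNge q0.
Qed.

Lemma integrable_image_density : mu.-integrable [set: R] (EFin \o g).
Proof.
have bu := max_slope_lt a0 abu0.
have := integrableZl measurableT u^-1
  (integrable_id_image_gaussian abu0 u0 bu 0 u0 (lexx u)).
by apply: eq_integrable => // q _; rewrite /= /image_density -EFinM; congr EFin; ring.
Qed.

(** The density is even, so it is its part on the positive axis plus the reflection of that part. *)
Lemma bessel_image_mean_cells : bessel_image_mean a b u =
  2 * (\int[mu]_(q in even_cells) g q + \int[mu]_(q in odd_cells) g q).
Proof.
have hi (A : set R) : measurable A ->
    has_integral (g \_ A) (\int[mu]_(q in A) g q).
  move=> mA; rewrite Rintegral_mkcond; apply: has_integral_Rintegral.
  rewrite (_ : EFin \o _ = (EFin \o g) \_ A); last first.
    by apply/funext => x; rewrite /= !patchE; case: ifP.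
  apply/(integrable_mkcond _ _).1 => //.
  by apply: integrableS integrable_image_density.
have hgp := has_integralD (hi _ measurable_even_cells) (hi _ measurable_odd_cells).
rewrite mulr_natl mulr2n.
rewrite -(has_integral_RintegralE (has_integralD hgp (has_integral_reflect 0 hgp))).
apply: eq_Rintegral => q _; rewrite -/(image_density a b u q) -/(gp q) -/(gp (0 - q)).
rewrite sub0r; have [q0|q0|->] := ltgtP q 0.
- by rewrite gp_neg ?ltW// add0r gp_pos ?oppr_gt0// image_densityN.
- by rewrite gp_pos// [gp (- q)]gp_neg ?addr0// oppr_le0 ltW.
- have g0 := image_density_multiple 0; rewrite mul0r in g0.
  by rewrite g0 oppr0 gp_neg// addr0.
Qed.

(** Even half-cells yield the indices [k <= 0] and odd ones [k >= 1], each with a centre term. The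
    centre terms are summable by themselves, so the two halves of the series converge separately. *)
Lemma bisum_series_term (term : int -> R) :
  (forall k, term k = series_term a b u k%:~R) ->
  is_cvg_bisum term /\ bessel_image_mean a b u = 2 * bisum term.
Proof.
move=> termE; have gi := integrable_image_density.
have hE := cvg_series_Rintegral gi (fun j => measurable_cell j.*2)
  (ltac:(by move=> i j _ _ /(trivIset_cell I I) /double_inj)).
have hO := cvg_series_Rintegral gi (fun j => measurable_cell j.*2.+1)
  (ltac:(by move=> i j _ _ /(trivIset_cell I I) [] /double_inj)).
rewrite -/even_cells in hE; rewrite -/odd_cells in hO.
rewrite bessel_image_mean_cells.
move: (\int[mu]_(x in even_cells) g x) (\int[mu]_(x in odd_cells) g x) hE hO => IE IO.
rewrite (funext (@integral_cell_even _ a b u u0 abu0)).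
rewrite (funext (@integral_cell_odd _ a b u u0 abu0)) => hE hO.
have /cvg_ex[D hD] := is_cvg_series_centre_term.
have T0 : term 0 = series_term a b u (- 0) + centre_term a b u 0.
  by rewrite termE /centre_term mulr0 !mul0r mulr0 mul0r addr0 oppr0.
(* The index 0 comes from the even cells, but [bisum] counts it with [k >= 0]: [term 0] and the sum
   [D] of the centre terms are added here and subtracted in [h2]. *)
have h1 : series (fun n : nat => term n%:Z) @ \oo --> term 0 + (IO + D).
  apply/cvg_series_shift.
  have -> : series (fun n : nat => term n.+1%:Z) =
    series (fun n => series_term a b u n.+1%:R - centre_term a b u n.+1%:R) +
    series (fun n => centre_term a b u n.+1%:R).
    rewrite -seriesD; congr series; apply/funext => n; rewrite /= termE -pmulrn.
    by rewrite /GRing.add/= subrK.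
  exact: cvgD.
have h2 : series (fun n : nat => term (- n.+1%:Z)) @ \oo --> IE - term 0 - D.
  have -> : series (fun n : nat => term (- n.+1%:Z)) =
    series (fun n => series_term a b u (- n.+1%:R) + centre_term a b u n.+1%:R) -
    series (fun n => centre_term a b u n.+1%:R).
    rewrite -seriesN -seriesD; congr series; apply/funext => n.
    by rewrite /= termE intrN -pmulrn /GRing.add/= addrK.
  apply: cvgB => //; apply/(cvg_series_shift
    (fun n => series_term a b u (- n%:R) + centre_term a b u n%:R)).
  by rewrite -T0 addrC subrK.
split; first by split; [exact: cvgP h1|exact: cvgP h2].
rewrite /bisum (cvg_lim _ h1)// (cvg_lim _ h2)//; ring.
Qed.

End image_series.

Theorem theorem12 (R : realType) (PBES0 : probability (path_space R) R)
    (hBES : is_bessel3_law PBES0)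
    (a b u : R) (ha : 0 < a) (hu : 0 < u) (hbu : b < 0 -> u < - a / b) :
  let term (k : int) : R :=
    let K : R := k%:~R in
    expR (- (2 * K ^+ 2 * a * b)) *
    ((1 - 4 * K ^+ 2 * a * b) *
       (Phi ((a + b * u - 2 * K * a) / Num.sqrt u)
        - Phi (- (2 * K * a / Num.sqrt u)))
     + (2 * K * b * u - a - b * u) / Num.sqrt u *
       phi ((a + b * u - 2 * K * a) / Num.sqrt u)) in
  is_cvg_bisum term /\
  PBES0 [set w | (u%:E < hitting_time a b w)%E] = (2 * bisum term)%:E.
Proof.
move=> term.
have abu0 : 0 < a + b * u.
  have [b0|b0] := ltP b 0; last by rewrite ltr_pwDl// mulr_ge0// ltW.
  by have := hbu b0; rewrite ltr_ndivlMr// => h; rewrite -ltrBlDl sub0r mulrC.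
have [cv <-] : is_cvg_bisum term /\ bessel_image_mean a b u = 2 * bisum term.
  exact: bisum_series_term.
split=> //; case: hBES => d [T [P [B [X [BM pathX QX]]]]].
(* [QX] compares the two laws on measurable sets only, which is where the measurability of the event
   enters. *)
rewrite QX; last exact: measurable_lt_hitting_time.
rewrite -(probability_no_touch BM ha hu abu0 (cvg_bessel_image_mean ha hu abu0)).
rewrite /distribution /pushforward; congr (P _).
apply/seteqP; split=> w /=; rewrite lt_hitting_timeP// => h t t0 tu;
  by have := h t t0 tu; rewrite /line_gap /radius pathX.
Qed.
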